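(* Let $w$ be a Robinsonian graphon satisfying Assumptions (A1)–(A4), let $\tau\in[0,1)$, $\rho_N=N^{-\tau}$, $G^{(N)}\sim\rho_N w$, and fix $0<\eta<\frac{1-\tau}{3}$. Let $\phi$ be a Fiedler function of $\mathbb{L}$ and $\hat\phi_N$ the step function built from a Fiedler vector of $G^{(N)}$, normalized so that $\|\phi\|=\|\hat\phi_N\|=1$ and $\langle\phi,\hat\phi_N\rangle\ge0$. Then for every $\varepsilon\in(0,1)$ there are a constant $C=C(w)>0$ and an integer $N_0=N_0(w,\tau,\eta,\varepsilon)$ such that for all $N\ge N_0$, $$\mathbb{P}\big(\|\hat\phi_N-\phi\|\le C N^{-3\eta/2}\big)\ge 1-\varepsilon .$$ Moreover, for every $\gamma>1$ there are $C'=C'(w)>0$ and $N_0'=N_0'(w,\tau,\eta,\gamma)$ such that for all $N\ge N_0'$, $\mathbb{P}(\|\hat\phi_N-\phi\|\le C' N^{-3\eta/2})\ge 1-\varepsilon_\gamma(N)$.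
   Context: A graphon is a measurable symmetric $w:[0,1]^2\to[0,1]$; it is Robinsonian if for all $x,y,z$: $y<z<x\Rightarrow w(x,y)\le w(x,z)$ and $x<y<z\Rightarrow w(x,y)\ge w(x,z)$. Degree $d(x)=\int_0^1 w(x,y)dy$; graphon-Laplacian $(\mathbb{L}f)(x)=\int_0^1 w(x,y)(f(x)-f(y))dy$ on $L^2([0,1])$ with inner product $\langle f,g\rangle=\int_0^1 fg$ and norm $\|\cdot\|$; its isolated eigenvalues of finite multiplicity are $0=\lambda_1<\lambda_2<\cdots$, and a Fiedler function is an eigenfunction for $\lambda_2$. Assumptions: (A1) $|w(x,y)-w(x',y')|\le K(|x-x'|+|y-y'|)$ for some $K>0$; (A2) for every $x$, $\partial w(x,y)/\partial x$ exists and is nonzero for a.e. $y$; (A3) $d'$ exists everywhere on $[0,1]$ and $\{d'=0\}$ is countable; (A4) with $\mathcal{H}=\{f:\int_0^1 f=0,\int_0^1 f^2=1\}$, $\inf_{f\in\mathcal{H}}\langle\mathbb{L}f,f\rangle<\inf_x d(x)$. Random graph $G^{(N)}\sim\rho_N w$: vertices $v_i=i/N$, $i\in[N]$; each edge $\{i,j\}$, $i<j$, present independently with probability $\rho_N w(i/N,j/N)$. The Laplacian of a graph with adjacency matrix $A$ is $D-A$, $D$ the diagonal degree matrix; a Fiedler vector is an eigenvector of it for its second-smallest eigenvalue. If $(\hat\phi_i)_{i\in[N]}$ is a Fiedler vector of $G^{(N)}$, the associated step function is $\hat\phi_N(x)=\sum_i\hat\phi_i\mathbf{1}_{\mathcal{I}_i}(x)$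 with $\mathcal{I}_1=[0,1/N]$, $\mathcal{I}_i=((i-1)/N,i/N]$. $\varepsilon_\gamma(N)=\exp(-(\log N)^\gamma)$. *)

(* Defs.v *)
From HB Require Import structures.
From mathcomp Require Import all_boot all_order all_algebra.
From mathcomp Require Import all_classical all_reals all_analysis.
Set Implicit Arguments. Unset Strict Implicit. Unset Printing Implicit Defensive.
Import Order.TTheory GRing.Theory Num.Theory.
Import numFieldNormedType.Exports.
Local Open Scope classical_set_scope.
Local Open Scope ring_scope.

Section Graphon.
Variable R : realType.

Definition I01 : set R := [set x | 0 <= x <= 1].

Definition leb : set R -> \bar R := @lebesgue_measure R.

Definition is_graphon (w : R -> R -> R) : Prop :=
  measurable_fun (I01 `*` I01) (fun p : R * R => w p.1 p.2) /\
  (forall x y, I01 x -> I01 y -> w x y = w y x) /\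
  (forall x y, I01 x -> I01 y -> 0 <= w x y <= 1).

Definition robinsonian (w : R -> R -> R) : Prop :=
  forall x y z, I01 x -> I01 y -> I01 z ->
    (y < z < x -> w x y <= w x z) /\ (x < y < z -> w x z <= w x y).

(* derivative of f at x relative to [0,1] (one-sided at the endpoints) *)
Definition has_deriv01 (f : R -> R) (x l : R) : Prop :=
  (fun h => h^-1 * (f (x + h) - f x))
    @ within [set h | h != 0 /\ I01 (x + h)] (nbhs (0 : R)) --> l.

Definition degree (w : R -> R -> R) (x : R) : R := Rintegral leb I01 (w x).

Definition L2 (f : R -> R) : Prop :=
  measurable_fun I01 f /\ leb.-integrable I01 (fun x => ((f x) ^+ 2)%:E).

Definition inner (f g : R -> R) : R := Rintegral leb I01 (fun x => f x * g x).
Definition L2norm (f : R -> R) : R := Num.sqrt (inner f f).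

Definition ae_eq01 (f g : R -> R) : Prop :=
  {ae leb, forall x, I01 x -> f x = g x}.

Definition Lop (w : R -> R -> R) (f : R -> R) : R -> R :=
  fun x => Rintegral leb I01 (fun y => w x y * (f x - f y)).

Definition A1 (w : R -> R -> R) : Prop :=
  exists K : R, 0 < K /\ forall x x' y y', I01 x -> I01 x' -> I01 y -> I01 y' ->
    `|w x y - w x' y'| <= K * (`|x - x'| + `|y - y'|).

Definition A2 (w : R -> R -> R) : Prop :=
  forall x, I01 x ->
    {ae leb, forall y, I01 y -> exists l, l != 0 /\ has_deriv01 (fun t => w t y) x l}.

Definition A3 (w : R -> R -> R) : Prop :=
  (forall x, I01 x -> exists l, has_deriv01 (degree w) x l) /\
  countable [set x | I01 x /\ has_deriv01 (degree w) x 0].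

Definition Hset : set (R -> R) :=
  [set f | L2 f /\ Rintegral leb I01 f = 0 /\ Rintegral leb I01 (fun x => f x ^+ 2) = 1].

Definition A4 (w : R -> R -> R) : Prop :=
  inf [set inner (Lop w f) f | f in Hset] < inf [set degree w x | x in I01].

Definition resolvent (w : R -> R -> R) (lam : R) : Prop :=
  (forall g, L2 g -> exists f, L2 f /\ ae_eq01 (fun x => Lop w f x - lam * f x) g) /\
  (forall f, L2 f -> ae_eq01 (fun x => Lop w f x - lam * f x) (fun=> 0) ->
     ae_eq01 f (fun=> 0)).

Definition spectrum (w : R -> R -> R) (lam : R) : Prop := ~ resolvent w lam.

Definition eigenfun (w : R -> R -> R) (lam : R) (f : R -> R) : Prop :=
  L2 f /\ ~ ae_eq01 f (fun=> 0) /\ ae_eq01 (Lop w f) (fun x => lam * f x).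

Definition finite_multiplicity (w : R -> R -> R) (lam : R) : Prop :=
  exists (n : nat) (b : 'I_n -> R -> R), (forall i, L2 (b i)) /\
    forall f, L2 f -> ae_eq01 (Lop w f) (fun x => lam * f x) ->
      exists c : 'I_n -> R, ae_eq01 f (fun x => \sum_(i < n) c i * b i x).

Definition discrete_eigenvalue (w : R -> R -> R) (lam : R) : Prop :=
  (exists f, eigenfun w lam f) /\ finite_multiplicity w lam /\
  exists e : R, 0 < e /\ forall mu, spectrum w mu -> `|mu - lam| < e -> mu = lam.

Definition second_smallest (D : set R) (lam : R) : Prop :=
  D lam /\ exists mu, D mu /\ mu < lam /\ forall nu, D nu -> nu < lam -> nu = mu.

Definition lambda2 (w : R -> R -> R) (lam : R) : Prop :=
  second_smallest (discrete_eigenvalue w) lam.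

Definition fiedler_function (w : R -> R -> R) (phi : R -> R) : Prop :=
  exists lam, lambda2 w lam /\ eigenfun w lam phi.

(* vertex v_i = i/N, i in [N]; here k : 'I_N stands for i = k+1 *)
Definition vtx (N : nat) (k : 'I_N) : R := (k.+1)%:R / N%:R.

Definition rho (tau : R) (N : nat) : R := N%:R `^ (- tau).

Definition edge_prob (w : R -> R -> R) (tau : R) (N : nat) (i j : 'I_N) : R :=
  rho tau N * w (vtx i) (vtx j).

Definition simple_adj (N : nat) (A : 'M[bool]_N) : bool :=
  [forall i, forall j, A i j == A j i] && [forall i, ~~ A i i].

Definition graph_weight (w : R -> R -> R) (tau : R) (N : nat) (A : 'M[bool]_N) : R :=
  if simple_adj A then
    \prod_(i < N) \prod_(j < N | (i < j)%N)
       (if A i j then edge_prob w tau i j else 1 - edge_prob w tau i j)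
  else 0.

Definition graph_prob (w : R -> R -> R) (tau : R) (N : nat)
  (E : 'M[bool]_N -> Prop) : R :=
  \sum_(A : 'M[bool]_N) graph_weight w tau A * (`[< E A >] : bool)%:R.

Definition adjR (N : nat) (A : 'M[bool]_N) : 'M[R]_N :=
  \matrix_(i, j) ((A i j : nat)%:R).

Definition laplacian (N : nat) (A : 'M[bool]_N) : 'M[R]_N :=
  \matrix_(i, j) ((i == j)%:R * (\sum_(k < N) adjR A i k) - adjR A i j).

(* lam is the second-smallest eigenvalue of M, counted with multiplicity *)
Definition second_eigenvalue (N : nat) (M : 'M[R]_N) (lam : R) : Prop :=
  eigenvalue M lam /\
  ( ((2 <= \rank (eigenspace M lam))%N /\ forall mu, eigenvalue M mu -> lam <= mu)
  \/ (exists mu, eigenvalue M mu /\ mu < lam /\ \rank (eigenspace M mu) = 1%N /\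
        forall nu, eigenvalue M nu -> nu < lam -> nu = mu)).

Definition fiedler_vector (N : nat) (A : 'M[bool]_N) (v : 'rV[R]_N) : Prop :=
  v != 0 /\ exists lam, second_eigenvalue (laplacian A) lam /\ v *m laplacian A = lam *: v.

(* I_1 = [0,1/N], I_i = ((i-1)/N, i/N] *)
Definition in_cell (N : nat) (k : 'I_N) (x : R) : bool :=
  if k == 0 :> nat then (0 <= x) && (x <= 1 / N%:R)
  else (k%:R / N%:R < x) && (x <= k.+1%:R / N%:R).

Definition stepfun (N : nat) (v : 'rV[R]_N) (x : R) : R :=
  \sum_(k < N) v 0 k * (in_cell k x)%:R.

Definition good_event (N : nat) (phi : R -> R) (r : R) (A : 'M[bool]_N) : Prop :=
  forall v : 'rV[R]_N, fiedler_vector A v ->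
    L2norm (stepfun v) = 1 -> 0 <= inner phi (stepfun v) ->
    L2norm (fun x => stepfun v x - phi x) <= r.

Definition eps_gamma (gamma : R) (N : nat) : R := expR (- ((ln N%:R) `^ gamma)).

End Graphon.

(* Main.v *)
Require Import Defs.
From HB Require Import structures.
From mathcomp Require Import all_boot all_order all_algebra.
From mathcomp Require Import all_classical all_reals all_analysis.
From mathcomp Require Import measurable_realfun ring lra zify.
Import Order.TTheory GRing.Theory Num.Theory.
Import numFieldNormedType.Exports.
Set Implicit Arguments.
Unset Strict Implicit.
Unset Printing Implicit Defensive.
Local Open Scope classical_set_scope.
Local Open Scope ring_scope.

(** Write L for the graphon Laplacian, W for the integral operator with kernel w
    and mu for the infimum of the Rayleigh quotient of L on mean-zero functions.
    By (A4), mu < inf d, so an approximate eigenfunction f for mu is recovered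
    from the Lipschitz function W f by dividing by d - mu; Arzela-Ascoli then
    shows that mu is attained by Lipschitz eigenfunctions.

    For a Robinsonian kernel 2 u - L u is nondecreasing whenever u is. Applied to
    the total variation F of an eigenfunction f for mu, this shows that F is again
    an eigenfunction. If f were not monotone, F + f and F - f would both dominate
    a nonconstant function, contradicting the minimality of F. So eigenfunctions
    for mu are monotone, and one that takes equal values at 0 and 1 vanishes:
    mu is simple. The same compactness gives a spectral gap above mu and shows
    that 0 and mu are the two lowest discrete eigenvalues.

    On step functions the rescaled graph Laplacian differs from L by O(1/N) plus
    the operator norm of its deviation Q from its mean, and a Davis-Kahan argument
    transfers the gap. The norm of Q is controlled by the trace of a power Q^(2k)
    with k about (log N)^gamma, whose mean is bounded by a walk count. *)

(** * Integration on the unit interval *)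

(** Simplicity is a Perron-Frobenius argument in disguise. For differentiable [u] the map sending
    the derivative of [u] to that of [2 u - L u] preserves positivity, and an eigenfunction of L for
    mu yields one for [2 - mu]. The classical proof would compare [f'] with its absolute value; here
    the kernel is only Lipschitz, so [|f'|] is replaced by the total variation of [f], and
    inequalities between derivatives by inequalities between increments. The strictness that
    irreducibility would supply comes from (A2) at the endpoint 1. The rate has one source. With x =
    N rho_N = N^(1 - tau), the norm of Q is of order sqrt x up to powers of log N, hence sqrt (1 /
    x) relative to the mean. This is below N^(-3 eta / 2) exactly because 3 eta < 1 - tau leaves a
    positive power of N to absorb the logarithms. Discretization costs only O(1/N), which is of
    lower order since 3 eta / 2 < 1/2. The constants depend on w alone, as they come from the gap
    and the Lipschitz bound of one fixed eigenfunction. *)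

Section Bridge.
Import HBNNSimple.
Variable R : realType.
Local Notation TR := (measurableTypeR R).

Let nnsfun_default_sigma (h : {nnsfun R >-> R}) : exists h' : {nnsfun TR >-> R}, h' = h :> (R -> R).
Proof.
case: h => h [m1 m2 m3].
have m1' : isMeasurableFun _ _ TR R h by case: m1 => H; split; exact: H.
have m2' : FiniteImage TR R h by case: m2.
have m3' : isNonNegFun TR R h by case: m3.
pose h' : {nnsfun TR >-> R} := HB.pack (h : TR -> R) m1' m2' m3'.
by exists h'.
Qed.

Let nnsfun_sigma_default (h : {nnsfun TR >-> R}) : exists h' : {nnsfun R >-> R}, h' = h :> (R -> R).
Proof.
case: h => h [m1 m2 m3].
have m1' : isMeasurableFun _ _ R R h by case: m1 => H; split; exact: H.
have m2' : FiniteImage R R h by case: m2.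
have m3' : isNonNegFun R R h by case: m3.
pose h' : {nnsfun R >-> R} := HB.pack (h : R -> R) m1' m2' m3'.
by exists h'.
Qed.

(* [L2] integrates over [R] with the default display whereas [inner] and
   [degree] integrate over [measurableTypeR R]; the two measurable structures
   have the same sets but are not convertible, hence this bridge. *)
Lemma integral_default_sigma (D : set R) (f : R -> \bar R) :
  integral (T := R) (@leb R) D f = integral (T := TR) (@leb R) D f.
Proof.
rewrite /integral; congr (_ - _)%E; congr ereal_sup; apply/seteqP; split => _ [h hf <-].
- by have [h' hh'] := nnsfun_default_sigma h; exists h'; rewrite ?hh'// => x; rewrite hh'; exact: hf.
- by have [h' hh'] := nnsfun_sigma_default h; exists h'; rewrite ?hh'// => x; rewrite hh'; exact: hf.
- by have [h' hh'] := nnsfun_default_sigma h; exists h'; rewrite ?hh'// => x; rewrite hh'; exact: hf.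
- by have [h' hh'] := nnsfun_sigma_default h; exists h'; rewrite ?hh'// => x; rewrite hh'; exact: hf.
Qed.

Lemma integrable_default_sigma (D : set R) (f : R -> \bar R) :
  integrable (T := R) (@leb R) D f = integrable (T := TR) (@leb R) D f.
Proof. by rewrite !unlock; congr asbool; rewrite integral_default_sigma. Qed.
End Bridge.

Section Integral01.
Variable R : realType.
Implicit Types (f g h : R -> R) (x y c : R).
Local Notation I := (@I01 R).

Definition J f : R := Rintegral (@leb R) I f.
Definition intg f : Prop := (@lebesgue_measure R).-integrable I (EFin \o f).

Lemma I01E : I = `[0, 1]%classic.
Proof. by apply/seteqP; split => x /=; rewrite in_itv. Qed.

Lemma measurable_I01 : @measurable _ (measurableTypeR R) I.
Proof. by rewrite I01E; exact: measurable_itv. Qed.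
Hint Resolve measurable_I01 : core.

Lemma leb_I01 : (@leb R) I = 1%E.
Proof. by rewrite I01E /leb lebesgue_measure_itv/= lte01 sube0. Qed.

Lemma intgD f g : intg f -> intg g -> intg (fun x => f x + g x).
Proof.
move=> fi gi; have := integrableD measurable_I01 fi gi.
by apply: eq_integrable => // x _; rewrite /= EFinD.
Qed.

Lemma intgZ c f : intg f -> intg (fun x => c * f x).
Proof.
move=> fi; have := integrableZl measurable_I01 c fi.
by apply: eq_integrable => // x _; rewrite /= EFinM.
Qed.

Lemma intg_meas f : intg f -> measurable_fun I f.
Proof. by move=> /measurable_int /measurable_EFinP. Qed.

Lemma intgS f g : measurable_fun I f -> intg g -> (forall x, I x -> `|f x| <= g x) -> intg f.
Proof.
move=> mf ig fg; apply: (le_integrable _ _ _ ig) => //; first exact/measurable_EFinP.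
by move=> x Ix; rewrite /= lee_fin (le_trans (fg x Ix))// ler_norm.
Qed.

Lemma intgN f : intg f -> intg (fun x => - f x).
Proof.
move=> fi; have -> : (fun x => - f x) = (fun x => -1 * f x) by apply/funext => x; rewrite mulN1r.
exact: intgZ.
Qed.

Lemma intgB f g : intg f -> intg g -> intg (fun x => f x - g x).
Proof. by move=> fi gi; apply: intgD => //; exact: intgN. Qed.

Lemma intg_bnd f c : measurable_fun I f -> (forall x, I x -> `|f x| <= c) -> intg f.
Proof.
move=> mf fc; apply: measurable_bounded_integrable => //.
  by rewrite [X in (X < _)%E]leb_I01 ltry.
exists c; split; first exact: num_real.
by move=> z cz x Ix /=; rewrite (le_trans (fc x Ix))// ltW.
Qed.

Lemma intg_cst c : intg (fun=> c).
Proof. by apply: (@intg_bnd _ `|c|) => //; exact: measurable_cst. Qed.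

Lemma intg_norm f : intg f -> intg (fun x => `|f x|).
Proof. by move=> fi; exact: (@integrable_norm _ _ _ lebesgue_measure I f). Qed.

Lemma intg_ext f g : (forall x, I x -> f x = g x) -> intg f -> intg g.
Proof.
by move=> fg; apply: eq_integrable => // x /set_mem Ix /=; rewrite fg.
Qed.

Lemma J_ext f g : (forall x, I x -> f x = g x) -> J f = J g.
Proof. by move=> fg; apply: eq_Rintegral => x /set_mem; exact: fg. Qed.

Lemma JD f g : intg f -> intg g -> J (fun x => f x + g x) = J f + J g.
Proof. by move=> *; exact: RintegralD. Qed.

Lemma JB f g : intg f -> intg g -> J (fun x => f x - g x) = J f - J g.
Proof. by move=> *; exact: RintegralB. Qed.

Lemma JZ c f : intg f -> J (fun x => c * f x) = c * J f.
Proof. by move=> *; exact: RintegralZl. Qed.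

Lemma JN f : intg f -> J (fun x => - f x) = - J f.
Proof.
by move=> fi; rewrite -mulN1r -JZ//; apply: J_ext => x _; rewrite mulN1r.
Qed.

Lemma J_cst c : J (fun=> c) = c.
Proof. by rewrite /J Rintegral_cst// [X in fine X]leb_I01 /= mulr1. Qed.

Lemma J_le f g : intg f -> intg g -> (forall x, I x -> f x <= g x) -> J f <= J g.
Proof. by move=> *; exact: le_Rintegral. Qed.

Lemma J_ge0 f : (forall x, I x -> 0 <= f x) -> 0 <= J f.
Proof. by move=> *; exact: Rintegral_ge0. Qed.

Lemma J_norm f : intg f -> `|J f| <= J (fun x => `|f x|).
Proof. by move=> *; exact: le_normr_Rintegral. Qed.

Lemma J_bnd f c : intg f -> (forall x, I x -> `|f x| <= c) -> `|J f| <= c.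
Proof.
move=> fi fc; apply: (le_trans (J_norm fi)); rewrite -[leRHS]J_cst.
by apply: J_le => //; [exact: intg_norm|exact: intg_cst].
Qed.

Lemma intg_sum (T : Type) (s : seq T) (P : pred T) (F : T -> R -> R) :
  (forall i, intg (F i)) -> intg (fun x => \sum_(i <- s | P i) F i x).
Proof.
move=> Fi; elim: s => [|i s IH].
  by apply: (@intg_ext (fun=> 0)) (intg_cst 0) => x _; rewrite big_nil.
have [Pi|/negPf Pi] := boolP (P i).
  apply: (@intg_ext (fun x => F i x + \sum_(i <- s | P i) F i x)); last exact: intgD.
  by move=> x _; rewrite big_cons Pi.
by apply: intg_ext IH => x _; rewrite big_cons Pi.
Qed.

Lemma J_sum (T : Type) (s : seq T) (P : pred T) (F : T -> R -> R) :
  (forall i, intg (F i)) ->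
  J (fun x => \sum_(i <- s | P i) F i x) = \sum_(i <- s | P i) J (F i).
Proof.
move=> Fi; elim: s => [|i s IH].
  by rewrite big_nil -[RHS]J_cst; apply: J_ext => x _; rewrite big_nil.
rewrite big_cons; have [Pi|/negPf Pi] := boolP (P i).
  rewrite -IH -JD//; last exact: intg_sum.
  by apply: J_ext => x _; rewrite big_cons Pi.
by rewrite -IH; apply: J_ext => x _; rewrite big_cons Pi.
Qed.

(** [ae_eq01] unfolds to an almost-everywhere statement for the bare set function [leb]; this
    instance makes [filterS] available for it. *)
#[global] Instance ae_leb_filter : Filter (nbhs (almost_everywhere (T := R) (@leb R))).
Proof.
exact: (@ae_filter_ringOfSetsType _ (measurableTypeR R) R (@lebesgue_measure R)).
Qed.

Lemma J_ae f g : measurable_fun I f -> measurable_fun I g -> ae_eq01 f g -> J f = J g.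
Proof.
move=> mf mg fg; rewrite /J /Rintegral; congr fine.
apply: ae_eq_integral => //; [exact/measurable_EFinP..|].
apply: filterS fg => x /= fg Ix; by rewrite fg.
Qed.

Lemma J_ge0_eq0 f : intg f -> (forall x, I x -> 0 <= f x) -> J f = 0 -> ae_eq01 f (fun=> 0).
Proof.
move=> fi f0 Jf; have mf := intg_meas fi.
have mE : measurable_fun (T := measurableTypeR R) I (EFin \o f) by exact/measurable_EFinP.
have [+ _] := @ae_eq_integral_abs _ (measurableTypeR R) R lebesgue_measure I measurable_I01 _ mE.
have -> : (\int[@lebesgue_measure R]_(x in I) `|(EFin \o f) x|)%E = 0%E.
  transitivity (\int[@lebesgue_measure R]_(x in I) ((EFin \o f) x))%E.
    by apply: eq_integral => x /set_mem Ix /=; rewrite ger0_norm// f0.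
  have := integrable_fin_num measurable_I01 fi.
  by move=> /fineK <-; rewrite -[fine _]/(J f) Jf.
move=> /(_ erefl) H.
rewrite /ae_eq01; apply: filterS (H : almost_everywhere (T := R) _ _) => x /= fx Ix.
by have := fx Ix => -[].
Qed.

Lemma measM f g : measurable_fun I f -> measurable_fun I g -> measurable_fun I (fun x => f x * g x).
Proof. exact: measurable_funM. Qed.

Lemma measD f g : measurable_fun I f -> measurable_fun I g -> measurable_fun I (fun x => f x + g x).
Proof. exact: measurable_funD. Qed.

Lemma measB f g : measurable_fun I f -> measurable_fun I g -> measurable_fun I (fun x => f x - g x).
Proof. exact: measurable_funB. Qed.

Lemma L2P f : L2 f <-> measurable_fun I f /\ intg (fun x => f x ^+ 2).
Proof. by rewrite /L2 integrable_default_sigma. Qed.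

Lemma L2_intg2 f : L2 f -> intg (fun x => f x * f x).
Proof. by move=> /L2P[_]; apply: intg_ext => x _; rewrite expr2. Qed.

Lemma L2_meas f : L2 f -> measurable_fun I f.
Proof. by case. Qed.

Lemma L2_intgM f g : L2 f -> L2 g -> intg (fun x => f x * g x).
Proof.
move=> fL gL; apply: (@intgS _ (fun x => f x * f x + g x * g x)).
- by apply: measM; exact: L2_meas.
- by apply: intgD; exact: L2_intg2.
- move=> x _; rewrite ler_norml; apply/andP; split.
    by have := sqr_ge0 (f x + g x); have := sqr_ge0 (f x); have := sqr_ge0 (g x); rewrite !expr2; lra.
  by have := sqr_ge0 (f x - g x); have := sqr_ge0 (f x); have := sqr_ge0 (g x); rewrite !expr2; lra.
Qed.

Lemma L2_ext f g : (forall x, I x -> f x = g x) -> L2 f -> L2 g.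
Proof.
move=> fg /L2P[mf fi]; apply/L2P; split; first by apply: eq_measurable_fun mf => x /set_mem; exact: fg.
by apply: (@intg_ext (fun x => f x ^+ 2)) fi => x Ix; rewrite fg.
Qed.

Lemma L2_bnd f c : measurable_fun I f -> (forall x, I x -> `|f x| <= c) -> L2 f.
Proof.
move=> mf fc; apply/L2P; split => //; apply: (@intg_bnd (fun x => f x ^+ 2) (c ^+ 2)).
  by apply: eq_measurable_fun (measM mf mf) => x _; rewrite expr2.
by move=> x Ix; rewrite normrX lerXn2r// ?nnegrE ?fc// (le_trans _ (fc x Ix)).
Qed.

Lemma L2_cst c : L2 (fun=> c : R).
Proof. by apply: (@L2_bnd _ `|c|) => //; exact: measurable_cst. Qed.

Lemma L2_intg f : L2 f -> intg f.
Proof.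
move=> fL; have := L2_intgM fL (L2_cst 1); apply: intg_ext => x _; exact: mulr1.
Qed.

Lemma L2D f g : L2 f -> L2 g -> L2 (fun x => f x + g x).
Proof.
move=> fL gL; apply/L2P; split; first by apply: measD; exact: L2_meas.
have H := intgD (L2_intg2 fL) (intgD (intgZ 2 (L2_intgM fL gL)) (L2_intg2 gL)).
by apply: (intg_ext _ H) => x _ /=; ring.
Qed.

Lemma L2Z c f : L2 f -> L2 (fun x => c * f x).
Proof.
move=> fL; apply/L2P; split; first by apply: measM; [exact: measurable_cst|exact: L2_meas].
by apply: (intg_ext _ (intgZ (c ^+ 2) (L2_intg2 fL))) => x _ /=; ring.
Qed.

Lemma L2N f : L2 f -> L2 (fun x => - f x).
Proof. by move=> fL; apply: L2_ext (L2Z (-1) fL) => x _; rewrite mulN1r. Qed.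

Lemma L2B f g : L2 f -> L2 g -> L2 (fun x => f x - g x).
Proof. by move=> fL gL; apply: L2D => //; exact: L2N. Qed.

Lemma L2Mb f g c : measurable_fun I g -> (forall x, I x -> `|g x| <= c) -> L2 f ->
  L2 (fun x => g x * f x).
Proof.
move=> mg gc fL; have mgf := measM mg (L2_meas fL); apply/L2P; split => //.
apply: (@intgS (fun x => (g x * f x) ^+ 2) (fun x => c ^+ 2 * (f x * f x))).
- by apply: eq_measurable_fun (measM mgf mgf) => x _; rewrite expr2.
- by apply: intgZ; exact: L2_intg2.
- move=> x Ix; rewrite ger0_norm ?sqr_ge0// exprMn -expr2.
  by rewrite ler_wpM2r ?sqr_ge0// -[leLHS]real_normK ?num_real// lerXn2r// ?nnegrE ?gc// (le_trans _ (gc x Ix)).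
Qed.

End Integral01.

(** * Inner product, norm, and Lipschitz functions on the unit interval *)

Section Inner.
Variable R : realType.
Implicit Types (f g h : R -> R) (x y c : R).
Local Notation I := (@I01 R).

Lemma innerC f g : inner f g = inner g f.
Proof. by apply: J_ext => x _; rewrite mulrC. Qed.

Lemma innerDl f g h : L2 f -> L2 g -> L2 h ->
  inner (fun x => f x + g x) h = inner f h + inner g h.
Proof.
move=> fL gL hL; rewrite -[RHS]JD; [|exact: L2_intgM..].
by apply: J_ext => x _; rewrite mulrDl.
Qed.

Lemma innerZl c f g : L2 f -> L2 g -> inner (fun x => c * f x) g = c * inner f g.
Proof.
move=> fL gL; rewrite -[RHS]JZ; last exact: L2_intgM.
by apply: J_ext => x _; rewrite mulrA.
Qed.

Lemma innerNl f g : L2 f -> L2 g -> inner (fun x => - f x) g = - inner f g.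
Proof.
move=> fL gL; rewrite -mulN1r -innerZl//; apply: J_ext => x _; by rewrite mulN1r.
Qed.

Lemma innerBl f g h : L2 f -> L2 g -> L2 h ->
  inner (fun x => f x - g x) h = inner f h - inner g h.
Proof. by move=> fL gL hL; rewrite innerDl ?innerNl//; exact: L2N. Qed.

Lemma innerDr f g h : L2 f -> L2 g -> L2 h ->
  inner h (fun x => f x + g x) = inner h f + inner h g.
Proof. by move=> *; rewrite innerC innerDl// !(innerC h). Qed.

Lemma innerZr c f g : L2 f -> L2 g -> inner g (fun x => c * f x) = c * inner g f.
Proof. by move=> *; rewrite innerC innerZl// !(innerC g). Qed.

Lemma innerBr f g h : L2 f -> L2 g -> L2 h ->
  inner h (fun x => f x - g x) = inner h f - inner h g.
Proof. by move=> *; rewrite innerC innerBl// !(innerC h). Qed.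

Lemma inner_ext f f' g g' : (forall x, I x -> f x = f' x) -> (forall x, I x -> g x = g' x) ->
  inner f g = inner f' g'.
Proof. by move=> ff gg; apply: J_ext => x Ix; rewrite ff ?gg. Qed.

Lemma inner_ae f f' g : L2 f -> L2 f' -> L2 g -> ae_eq01 f f' -> inner f g = inner f' g.
Proof.
move=> fL fL' gL ff; apply: J_ae; [exact: measM (L2_meas _) (L2_meas _)..|].
by rewrite /ae_eq01; apply: filterS ff => x /= ff Ix; rewrite ff.
Qed.

Lemma inner1 f : inner f (fun=> 1) = J f.
Proof. by apply: J_ext => x _; rewrite mulr1. Qed.

Lemma inner_ge0 f : 0 <= inner f f.
Proof. by apply: J_ge0 => x _; rewrite -expr2 sqr_ge0. Qed.

(** Common source of the Cauchy-Schwarz inequalities below, including those for semidefinite forms.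
    No sign of [c] is assumed: when [c <= 0], the chosen values of [t] make the quadratic negative
    unless [b = c = 0]. *)
Lemma quad_disc (a b c : R) : (forall t, 0 <= a + 2 * b * t + c * t ^+ 2) -> b ^+ 2 <= a * c.
Proof.
move=> H; have a0 : 0 <= a by have := H 0; rewrite !expr2 !mulr0 !addr0.
have [c0|c0] := leP c 0.
  have [b0|b0] := eqVneq b 0.
    have {}c0 : c = 0.
      apply/eqP; rewrite eq_le c0 /=; rewrite leNgt; apply/negP => cn.
      have := H (- (a + 1) / c - (1 - (a + 1) / c)); rewrite b0.
      have := H (1 - (a+1) / c); rewrite b0.
      set t := 1 - (a + 1) / c => + _.
      have t1 : 1 <= t by rewrite /t lerDl oppr_ge0 mulr_ge0_le0 ?invr_le0// addr_ge0.
      have ct : c * t = c - (a + 1) by rewrite /t mulrBr mulrCA divff ?lt_eqF// !mulr1.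
      rewrite mulr0 mul0r addr0 expr2 mulrA ct => h.
      have : (c - (a + 1)) * t <= c - (a + 1) by rewrite ger_nMr//; lra.
      lra.
    by rewrite b0 c0 mulr0 expr0n.
  exfalso; have := H (- (a + 1) / (2 * b)).
  have -> : 2 * b * (- (a + 1) / (2 * b)) = - (a + 1) by field.
  have : c * (- (a + 1) / (2 * b)) ^+ 2 <= 0 by rewrite mulr_le0_ge0// sqr_ge0.
  by set u := c * _; lra.
have := H (- b / c); have -> : a + 2 * b * (- b / c) + c * (- b / c) ^+ 2 = a - b ^+ 2 / c.
  by field; rewrite gt_eqF.
by rewrite subr_ge0 ler_pdivrMr.
Qed.

Lemma inner_CS2 f g : L2 f -> L2 g -> inner f g ^+ 2 <= inner f f * inner g g.
Proof.
move=> fL gL; apply: quad_disc => t.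
have tgL := L2Z t gL.
have := inner_ge0 (fun x => f x + t * g x).
rewrite innerDl ?innerDr ?innerZl ?innerZr//; try exact: L2D.
by rewrite (innerC g f); congr (_ <= _); ring.
Qed.

Lemma L2norm_ge0 f : 0 <= L2norm f.
Proof. exact: sqrtr_ge0. Qed.

Lemma L2norm2 f : L2norm f ^+ 2 = inner f f.
Proof. by rewrite sqr_sqrtr// inner_ge0. Qed.

Lemma inner_CS f g : L2 f -> L2 g -> `|inner f g| <= L2norm f * L2norm g.
Proof.
move=> fL gL; rewrite -(@ler_pXn2r _ 2)// ?nnegrE ?mulr_ge0 ?L2norm_ge0//.
by rewrite real_normK ?num_real// exprMn !L2norm2 inner_CS2.
Qed.

Lemma L2norm_le f c : 0 <= c -> inner f f <= c ^+ 2 -> L2norm f <= c.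
Proof. by move=> c0 fc; rewrite -(@ler_pXn2r _ 2)// ?nnegrE ?L2norm_ge0// L2norm2. Qed.

Lemma L2norm_ext f g : (forall x, I x -> f x = g x) -> L2norm f = L2norm g.
Proof. by move=> fg; rewrite /L2norm (inner_ext fg fg). Qed.

Lemma L2normD f g : L2 f -> L2 g -> L2norm (fun x => f x + g x) <= L2norm f + L2norm g.
Proof.
move=> fL gL; apply: L2norm_le; first by rewrite addr_ge0 ?L2norm_ge0.
rewrite innerDl ?innerDr//; try exact: L2D.
have := inner_CS fL gL; rewrite (innerC g f) sqrrD !L2norm2 => /(le_trans (ler_norm _)) H.
by rewrite addrA -(addrA (inner f f)) lerD2r lerD2l -mulr2n lerMn2r.
Qed.

Lemma L2normZ c f : L2 f -> L2norm (fun x => c * f x) = `|c| * L2norm f.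
Proof.
move=> fL; rewrite /L2norm innerZl ?innerZr//; last exact: L2Z.
by rewrite mulrA -expr2 sqrtrM ?sqr_ge0// sqrtr_sqr.
Qed.

Lemma L2normN f : L2 f -> L2norm (fun x => - f x) = L2norm f.
Proof.
move=> fL; rewrite -[RHS]mul1r -(normr1 R) -normrN -L2normZ//.
by apply: L2norm_ext => x _; rewrite mulN1r.
Qed.

Lemma L2normB f g : L2 f -> L2 g -> L2norm (fun x => f x - g x) <= L2norm f + L2norm g.
Proof. by move=> fL gL; rewrite -(L2normN gL); apply: L2normD => //; exact: L2N. Qed.

Lemma L2norm_mono f g : L2 f -> L2 g -> (forall x, I x -> `|f x| <= `|g x|) ->
  L2norm f <= L2norm g.
Proof.
move=> fL gL fg; apply: L2norm_le; first exact: L2norm_ge0.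
rewrite L2norm2; apply: J_le; [exact: L2_intgM..|] => x Ix.
by rewrite -!expr2 -[leLHS]real_normK ?num_real// -[leRHS]real_normK ?num_real// lerXn2r ?nnegrE ?fg.
Qed.

Lemma L2norm_cst c : L2norm (fun=> c) = `|c|.
Proof. by rewrite /L2norm /inner -/(J _) J_cst -expr2 sqrtr_sqr. Qed.

Lemma L2norm_bnd f c : L2 f -> 0 <= c -> (forall x, I x -> `|f x| <= c) -> L2norm f <= c.
Proof.
move=> fL c0 fc; rewrite -[leRHS](ger0_norm c0) -L2norm_cst; apply: L2norm_mono => //.
  exact: L2_cst.
by move=> x Ix; rewrite [leRHS]ger0_norm ?fc.
Qed.

Lemma L2_abs f : L2 f -> L2 (fun x => `|f x|).
Proof.
move=> /L2P[mf fi]; apply/L2P; split.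
  by have := intg_meas (intg_norm (L2_intg (proj2 (L2P f) (conj mf fi)))).
by apply: intg_ext fi => x _; rewrite real_normK ?num_real.
Qed.

Lemma J_abs_le f : L2 f -> J (fun x => `|f x|) <= L2norm f.
Proof.
move=> fL; rewrite -inner1; apply: (le_trans (ler_norm _)).
apply: (le_trans (inner_CS (L2_abs fL) (L2_cst 1))).
rewrite L2norm_cst normr1 mulr1; apply: L2norm_mono => //; first exact: L2_abs.
by move=> x _; rewrite normr_id.
Qed.

Lemma J_le_norm f : L2 f -> `|J f| <= L2norm f.
Proof. by move=> fL; apply: (le_trans (J_norm (L2_intg fL))); exact: J_abs_le. Qed.

Lemma L2norm_eq0_ae f : L2 f -> L2norm f = 0 -> ae_eq01 f (fun=> 0).
Proof.
move=> fL f0; have : inner f f = 0 by rewrite -L2norm2 f0 expr0n.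
move=> /(J_ge0_eq0 (L2_intg2 fL)) H; rewrite /ae_eq01.
apply: filterS (H _) => [x /= fx Ix|x _]; last by rewrite -expr2 sqr_ge0.
by apply/eqP; have /eqP := fx Ix; rewrite mulf_eq0 orbb.
Qed.

Lemma J_itv (b1 b2 : bool) a b (i := Interval (BSide b1 a) (BSide b2 b)) :
  0 <= a -> a <= b -> b <= 1 ->
  intg (fun x => (x \in i)%:R) /\ J (fun x => (x \in i)%:R) = b - a.
Proof.
move=> a0 ab b1'.
have mi : @measurable _ (measurableTypeR R) [set` i] by exact: measurable_itv.
have E : (fun x : R => (x \in i)%:R) = (\1_[set` i] : R -> R).
  by apply/funext => x; rewrite indicE mem_setE.
split.
  apply: (@intg_bnd _ _ 1); first by rewrite E; exact: measurable_indic.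
  by move=> x _; case: (_ \in _); rewrite ?normr1 ?normr0.
rewrite E /J /Rintegral integral_indic//; last exact: measurable_I01.
have -> : [set` i] `&` I = [set` i].
  apply/seteqP; split => [x []//|x /= xi]; split => //.
  rewrite /I01 /=; move: xi; rewrite /i; case: (b1) (b2) => -[]; rewrite in_itv /= => /andP[]; lra.
transitivity (fine (@lebesgue_measure R [set` i])) => //.
rewrite lebesgue_measure_itv /= lte_fin.
by case: ltgtP ab => // -> _; rewrite subrr.
Qed.

Lemma J_pos h e a b : intg h -> (forall x, I x -> 0 <= h x) -> 0 <= a -> a <= b -> b <= 1 ->
  0 <= e -> (forall x, a <= x <= b -> e <= h x) -> e * (b - a) <= J h.
Proof.
move=> hi h0 a0 ab b1 e0 he.
have [ii ji] := @J_itv true false _ _ a0 ab b1.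
rewrite -ji -JZ//; apply: J_le => //; first exact: intgZ.
move=> x Ix; rewrite in_itv/=; have [/he|_] := boolP (a <= x <= b); first by rewrite mulr1.
by rewrite mulr0 h0.
Qed.

Definition lip01 L f := forall x y, I x -> I y -> `|f x - f y| <= L * `|x - y|.

Lemma I01_0 : I 0. Proof. by rewrite /I01 /= lexx ler01. Qed.
Lemma I01_1 : I 1. Proof. by rewrite /I01 /= lexx ler01. Qed.

(** Composition with the clamp extends a Lipschitz function on the interval to a continuous one on
    the line, which gives access to measurability and to the intermediate value theorem. *)
Definition clamp01 x : R := Num.max 0 (Num.min x 1).

Lemma clamp01_I x : I (clamp01 x).
Proof.
rewrite /I01 /= /clamp01 le_max lexx /= ge_max ler01 /=.
by rewrite ge_min lexx orbT.
Qed.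

Lemma clamp01_id x : I x -> clamp01 x = x.
Proof.
by rewrite /I01 /clamp01 /= => /andP[x0 x1]; rewrite (min_idPl _)// (max_idPr _).
Qed.

Lemma clamp01_lip x y : `|clamp01 x - clamp01 y| <= `|x - y|.
Proof.
rewrite /clamp01 /Num.max /Num.min.
by repeat case: ifPn; rewrite -?leNgt => *; rewrite ?ler_norml ?ler_normr; try lra;
  apply/andP; split; try lra; rewrite lerNl ler_normr; lra.
Qed.

Lemma lip_ge0 L f : lip01 L f -> 0 <= L.
Proof.
move=> /(_ 0 1 I01_0 I01_1); rewrite sub0r normrN normr1 mulr1.
exact: le_trans.
Qed.

Lemma lip_ext L f g : (forall x, I x -> f x = g x) -> lip01 L f -> lip01 L g.
Proof. by move=> fg fl x y Ix Iy; rewrite -!fg// fl. Qed.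

Lemma lip_clamp_cont L f : lip01 L f -> continuous (f \o clamp01).
Proof.
move=> fl x; have L0 := lip_ge0 fl; apply/cvgrPdist_le => e e0; near=> y => /=.
apply: (le_trans (fl _ _ (clamp01_I _) (clamp01_I _))).
apply: (le_trans (ler_wpM2l L0 (clamp01_lip _ _))).
have : `|x - y| <= e / (L + 1).
  near: y; apply: cvgr_dist_le; first exact: cvg_id.
  by rewrite divr_gt0// ltr_wpDl.
rewrite ler_pdivlMr; last by rewrite ltr_wpDl.
apply: le_trans; rewrite mulrC ler_wpM2l ?lerDl//.
Unshelve. all: by end_near. Qed.

Lemma lip_meas L f : lip01 L f -> measurable_fun I f.
Proof.
move=> fl; have mf := continuous_measurable_fun (lip_clamp_cont fl).
apply: (eq_measurable_fun (f \o clamp01)).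
  by move=> x /set_mem Ix /=; rewrite clamp01_id.
exact: measurable_funS mf.
Qed.

Lemma lip_bnd L f x : lip01 L f -> I x -> `|f x| <= `|f 0| + L.
Proof.
move=> fl Ix; rewrite -[f x](subrK (f 0)) addrC (le_trans (ler_normD _ _))// lerD2l.
apply: (le_trans (fl _ _ Ix I01_0)); rewrite -[leRHS]mulr1 ler_wpM2l ?(lip_ge0 fl)//.
by move: Ix; rewrite /I01 /= subr0 => /andP[x0 x1]; rewrite ger0_norm.
Qed.

Lemma lip_L2 L f : lip01 L f -> L2 f.
Proof. by move=> fl; exact: (L2_bnd (lip_meas fl) (fun x => lip_bnd fl)). Qed.

Lemma lip_near L f x e : lip01 L f -> I x -> 0 < e ->
  exists a b, [/\ 0 <= a, a < b, b <= 1 & forall y, a <= y <= b -> I y /\ `|f y - f x| <= e].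
Proof.
move=> fl Ix e0; have L0 := lip_ge0 fl.
(* An interval of length at most [1 / 2] fits inside the unit interval on one side of [x]. *)
pose s := Num.min (e / (L + 1)) (1 / 2).
have s0 : 0 < s by rewrite lt_min divr_gt0//= ?ltr_wpDl// divr_gt0.
have s1 : s <= 1 / 2 by rewrite ge_min lexx orbT.
have Ls : L * s <= e.
  have : s <= e / (L + 1) by rewrite ge_min lexx.
  rewrite ler_pdivlMr ?ltr_wpDl// => h; apply: le_trans h.
  by rewrite mulrC ler_wpM2l ?lerDl// ltW.
move: (Ix); rewrite /I01 /= => /andP[x0 x1].
have [xs|xs] := leP x (1 / 2).
  exists x, (x + s); split => //; [by rewrite ltrDl|lra|move=> y /andP[y1 y2]].
  have Iy : I y by rewrite /I01 /=; apply/andP; split; lra.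
  split => //; apply: (le_trans (fl _ _ Iy Ix)); rewrite ger0_norm ?subr_ge0//.
  by apply: le_trans Ls; rewrite ler_wpM2l//; lra.
exists (x - s), x; split => //; [lra|by rewrite ltrBlDr ltrDl|move=> y /andP[y1 y2]].
have Iy : I y by rewrite /I01 /=; apply/andP; split; lra.
split => //; apply: (le_trans (fl _ _ Iy Ix)); rewrite distrC ger0_norm ?subr_ge0//.
by apply: le_trans Ls; rewrite ler_wpM2l//; lra.
Qed.

Lemma lip_J_gt0 L h x : lip01 L h -> (forall y, I y -> 0 <= h y) -> I x -> 0 < h x -> 0 < J h.
Proof.
move=> hl h0 Ix hx; have hx2 : 0 < h x / 2 by rewrite divr_gt0.
have [a [b [a0 ab b1 H]]] := lip_near hl Ix hx2.
apply: (@lt_le_trans _ _ (h x / 2 * (b - a))); first by rewrite mulr_gt0// subr_gt0.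
apply: J_pos => //; [exact: L2_intg (lip_L2 hl)|exact: ltW|exact: ltW|].
by move=> y /H[_]; rewrite ler_norml => /andP[]; lra.
Qed.

Lemma lipM L M f g B C : lip01 L f -> lip01 M g -> (forall x, I x -> `|f x| <= B) ->
  (forall x, I x -> `|g x| <= C) -> lip01 (L * C + B * M) (fun x => f x * g x).
Proof.
move=> fl gl fB gC x y Ix Iy.
have -> : f x * g x - f y * g y = (f x - f y) * g x + f y * (g x - g y) by ring.
apply: (le_trans (ler_normD _ _)); rewrite !normrM mulrDl; apply: lerD.
  by rewrite mulrAC ler_pM// ?fl// gC.
by rewrite -mulrA ler_pM ?fB ?gl.
Qed.

Lemma lipD L M f g : lip01 L f -> lip01 M g -> lip01 (L + M) (fun x => f x + g x).
Proof.
move=> fl gl x y Ix Iy; rewrite opprD addrACA mulrDl.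
by apply: (le_trans (ler_normD _ _)); rewrite lerD ?fl ?gl.
Qed.

Lemma lipZ L c f : lip01 L f -> lip01 (`|c| * L) (fun x => c * f x).
Proof. by move=> fl x y Ix Iy; rewrite -mulrBr normrM -mulrA ler_wpM2l ?fl. Qed.

Lemma lip_cst c : lip01 0 (fun=> c).
Proof. by move=> x y _ _; rewrite subrr normr0 mul0r. Qed.

Lemma lipB L M f g : lip01 L f -> lip01 M g -> lip01 (L + M) (fun x => f x - g x).
Proof.
move=> fl gl x y Ix Iy.
have -> : f x - g x - (f y - g y) = (f x - f y) - (g x - g y) by ring.
by rewrite mulrDl; apply: (le_trans (ler_normB _ _)); rewrite lerD ?fl ?gl.
Qed.

(** Lipschitz regularity upgrades vanishing in norm to vanishing at every point; this is why
    eigenfunctions are traded for Lipschitz representatives. *)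
Lemma lip_norm0 L f x : lip01 L f -> L2norm f = 0 -> I x -> f x = 0.
Proof.
move=> fl f0 Ix; apply/eqP/negP => /negP fx.
have := lip_J_gt0 (lipM fl fl (fun y => lip_bnd fl) (fun y => lip_bnd fl)) _ Ix.
have J0 : J (fun y => f y * f y) = 0 by rewrite -[LHS]/(inner f f) -L2norm2 f0 expr0n.
rewrite J0 ltxx => H; suff : false by []; apply: H.
  by move=> y _; rewrite -expr2 sqr_ge0.
by rewrite -expr2 exprn_even_gt0.
Qed.

End Inner.

(** * Step functions and the operators *)

Section Cells.
Variable R : realType.
Implicit Types (f g h : R -> R) (x y c : R).
Local Notation I := (@I01 R).
Variable N : nat.
Implicit Types (k : 'I_N) (v u : 'rV[R]_N).

Definition cell k x : R := (in_cell k x)%:R.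

Let N0 k : (0 < N%:R :> R).
Proof. by rewrite ltr0n (leq_ltn_trans _ (ltn_ord k)). Qed.

Lemma cell_bounds k x : in_cell k x -> k%:R / N%:R <= x /\ x <= k.+1%:R / N%:R.
Proof.
rewrite /in_cell; case: eqP => [->|_] /andP[a b]; first by rewrite mul0r.
by split => //; exact: ltW.
Qed.

Lemma cell_I k x : in_cell k x -> I x.
Proof.
move=> /cell_bounds[a b]; apply/andP; split.
  by apply: le_trans a; rewrite divr_ge0.
by apply: (le_trans b); rewrite ler_pdivrMr ?(N0 k)// mul1r ler_nat ltn_ord.
Qed.

Lemma vtx_I k : I (vtx R k).
Proof.
by apply/andP; split; [rewrite divr_ge0|rewrite ler_pdivrMr ?(N0 k)// mul1r ler_nat ltn_ord].
Qed.

Lemma cell_vtx k x : in_cell k x -> `|x - vtx R k| <= N%:R^-1.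
Proof.
move=> /cell_bounds[a b]; rewrite distrC /vtx ger0_norm ?subr_ge0//.
rewrite lerBlDr -lerBlDl; apply: le_trans a.
by rewrite -[X in _ - X]mul1r -mulrBl -[X in (_ - X) / _]/(1%:R) -natrB// subn1.
Qed.

Lemma cell_uniq k j x : in_cell k x -> in_cell j x -> k = j.
Proof.
have aux (a b : 'I_N) : (a < b)%N -> in_cell a x -> in_cell b x -> False.
  move=> ab /cell_bounds[_ xa]; rewrite /in_cell -if_neg -lt0n (leq_ltn_trans _ ab)//.
  move=> /andP[bx _]; have := lt_le_trans bx xa.
  by rewrite ltr_pM2r ?invr_gt0 ?(N0 k)// ltr_nat ltnS leqNgt ab.
move=> kx jx; apply/val_inj; case: (ltngtP k j) => // H; exfalso; by [exact: aux H kx jx|exact: aux H jx kx].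
Qed.

Lemma cell_ex x : (0 < N)%N -> I x -> exists k, in_cell k x.
Proof.
move=> Npos /andP[x0 x1]; have NR : 0 < N%:R :> R by rewrite ltr0n.
have ex : exists n, x <= n.+1%:R / N%:R.
  by exists N.-1; rewrite prednK// divff ?gt_eqF.
case: (ex_minnP ex) => n xn nmin.
have nN : (n < N)%N.
  by rewrite -(prednK Npos) ltnS; apply: nmin; rewrite prednK// divff ?gt_eqF.
exists (Ordinal nN); rewrite /in_cell /=; case: eqP => [n0|/eqP n0].
  by rewrite x0 /=; move: xn; rewrite n0.
rewrite xn andbT ltNge; apply/negP => H.
have := nmin n.-1; rewrite prednK ?lt0n// => /(_ H).
by rewrite -{1}(prednK (n:=n)) ?lt0n// ltnn.
Qed.

Lemma stepfun_cell v k x : in_cell k x -> stepfun v x = v 0 k.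
Proof.
move=> kx; rewrite /stepfun (bigD1 k)//= kx mulr1 big1 ?addr0// => j jk.
case: (boolP (in_cell j x)) => [jx|]; last by rewrite mulr0.
by move: jk; rewrite (cell_uniq kx jx) eqxx.
Qed.

Lemma cell_J k : intg (cell k) /\ J (cell k) = N%:R^-1.
Proof.
have kN : k.+1%:R / N%:R <= 1 :> R by rewrite ler_pdivrMr ?(N0 k)// mul1r ler_nat.
have E : N%:R^-1 = k.+1%:R / N%:R - k%:R / N%:R :> R.
  by rewrite -mulrBl -natrB// subSnn mul1r.
have k1 : k%:R / N%:R <= k.+1%:R / N%:R :> R by rewrite ler_pM2r ?invr_gt0 ?(N0 k)// ler_nat.
have k0 : 0 <= k%:R / N%:R :> R by rewrite divr_ge0.
rewrite E /cell; case: (eqVneq (k : nat) 0%N) => [k00|k00].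
  have -> : (fun x : R => (in_cell k x)%:R : R) =
     (fun x => (x \in `[(k%:R / N%:R), (k.+1%:R / N%:R)])%:R).
    by apply/funext => x; rewrite /in_cell k00 /= in_itv /= mul0r.
  exact: J_itv.
have -> : (fun x : R => (in_cell k x)%:R : R) =
     (fun x => (x \in `](k%:R / N%:R), (k.+1%:R / N%:R)])%:R).
  by apply/funext => x; rewrite /in_cell (negPf k00) in_itv.
exact: J_itv.
Qed.

Lemma cell_meas k : measurable_fun I (cell k).
Proof. by apply: intg_meas; have [] := cell_J k. Qed.

Lemma cell_norm k x : `|cell k x| <= 1.
Proof. by rewrite /cell; case: in_cell; rewrite ?normr1 ?normr0. Qed.

Lemma cell_L2 k : L2 (cell k).
Proof. by apply: (L2_bnd (cell_meas k)) => x _; exact: cell_norm. Qed.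

Lemma L2_sum (T : Type) (s : seq T) (F : T -> R -> R) :
  (forall i, L2 (F i)) -> L2 (fun x => \sum_(i <- s) F i x).
Proof.
move=> Fi; elim: s => [|i s IH].
  by apply: L2_ext (L2_cst 0) => x _; rewrite big_nil.
by apply: L2_ext (L2D (Fi i) IH) => x _; rewrite big_cons.
Qed.

Lemma stepfun_L2 v : L2 (stepfun v).
Proof. by apply: L2_sum => k; apply: L2_ext (L2Z (v 0 k) (cell_L2 k)) => x _. Qed.

Lemma inner_stepfun v g : L2 g -> inner (stepfun v) g = \sum_k v 0 k * J (fun x => cell k x * g x).
Proof.
move=> gL.
transitivity (J (fun x => \sum_k v 0 k * (cell k x * g x))).
  by apply: J_ext => x _; rewrite /stepfun mulr_suml; apply: eq_bigr => k _; rewrite mulrA.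
rewrite J_sum; last by move=> k; apply: intgZ; exact: L2_intgM (cell_L2 k) gL.
by apply: eq_bigr => k _; rewrite JZ//; exact: L2_intgM (cell_L2 k) gL.
Qed.

Lemma J_stepfun v : J (stepfun v) = N%:R^-1 * \sum_k v 0 k.
Proof.
rewrite -inner1 inner_stepfun; last exact: L2_cst.
rewrite mulr_sumr; apply: eq_bigr => k _; rewrite mulrC; congr (_ * _).
by have [_ <-] := cell_J k; apply: J_ext => x _; rewrite mulr1.
Qed.

Lemma inner_stepfun2 v u : inner (stepfun v) (stepfun u) = N%:R^-1 * \sum_k v 0 k * u 0 k.
Proof.
rewrite inner_stepfun; last exact: stepfun_L2.
rewrite mulr_sumr; apply: eq_bigr => k _.
have -> : J (fun x => cell k x * stepfun u x) = J (fun x => u 0 k * cell k x).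
  apply: J_ext => x _; rewrite /cell; case: (boolP (in_cell k x)) => [kx|_].
    by rewrite (stepfun_cell _ kx) mulrC.
  by rewrite mul0r mulr0.
by have [ki kJ] := cell_J k; rewrite JZ// kJ; ring.
Qed.
End Cells.

(* A class, so that [K] is found from [w]. *)
Class lip_kernel (R : realType) (w : R -> R -> R) (K : R) := LipKernel {
  kernel_sym : forall x y, I01 x -> I01 y -> w x y = w y x;
  kernel_01 : forall x y, I01 x -> I01 y -> 0 <= w x y <= 1;
  kernel_lip : forall x x' y y', I01 x -> I01 x' -> I01 y -> I01 y' ->
    `|w x y - w x' y'| <= K * (`|x - x'| + `|y - y'|) }.

(** * The integral operator with kernel w and the graphon Laplacian *)

Section Operator.
Variable R : realType.
Implicit Types (f g h : R -> R) (x y c : R).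
Local Notation I := (@I01 R).
Context (w : R -> R -> R) {K : R} {wK : lip_kernel w K}.

Let w_sym := @kernel_sym _ _ _ wK.
Let w_01 := @kernel_01 _ _ _ wK.
Let w_lip := @kernel_lip _ _ _ wK.

Definition W f x : R := J (fun y => w x y * f y).

Lemma wK0 : 0 <= K.
Proof.
have := w_lip (I01_0 R) (I01_1 R) (I01_0 R) (I01_0 R).
by rewrite subrr normr0 addr0 sub0r normrN normr1 mulr1; exact: le_trans.
Qed.

Lemma w_lipr x : I x -> lip01 K (w x).
Proof.
move=> Ix y y' Iy Iy'; have := w_lip Ix Ix Iy Iy'.
by rewrite subrr normr0 add0r.
Qed.

Lemma w_lipl x x' y : I x -> I x' -> I y -> `|w x y - w x' y| <= K * `|x - x'|.
Proof. by move=> Ix Ix' Iy; have := w_lip Ix Ix' Iy Iy; rewrite subrr normr0 addr0. Qed.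

Lemma w_norm x y : I x -> I y -> `|w x y| <= 1.
Proof. by move=> Ix Iy; have /andP[a b] := w_01 Ix Iy; rewrite ger0_norm. Qed.

Lemma w_meas x : I x -> measurable_fun I (w x).
Proof. by move=> Ix; exact: lip_meas (w_lipr Ix). Qed.

Lemma w_L2 x : I x -> L2 (w x).
Proof. by move=> Ix; exact: lip_L2 (w_lipr Ix). Qed.

Lemma wf_intg f x : L2 f -> I x -> intg (fun y => w x y * f y).
Proof. by move=> fL Ix; apply: L2_intgM => //; exact: w_L2. Qed.

Lemma W_lip f : L2 f -> lip01 (K * L2norm f) (W f).
Proof.
move=> fL x x' Ix Ix'; rewrite /W -JB; [|exact: wf_intg..].
have fi := L2_intg fL.
apply: (@le_trans _ _ (J (fun y => (K * `|x - x'|) * `|f y|))).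
  apply: (le_trans (J_norm _)); first by apply: intgB; exact: wf_intg.
  apply: J_le; [by apply: intg_norm; apply: intgB; exact: wf_intg|
    by apply: intgZ; exact: intg_norm|].
  move=> y Iy; rewrite -mulrBl normrM ler_wpM2r//; exact: w_lipl.
rewrite JZ; last exact: intg_norm.
by rewrite mulrAC ler_wpM2r// ler_wpM2l ?wK0 ?J_abs_le.
Qed.

Lemma W_bnd f x : L2 f -> I x -> `|W f x| <= L2norm f.
Proof.
move=> fL Ix; apply: le_trans (J_abs_le fL); apply: (le_trans (J_norm (wf_intg fL Ix))).
apply: J_le; [exact: intg_norm (wf_intg fL Ix)|exact: intg_norm (L2_intg fL)|].
by move=> y Iy; rewrite normrM ler_piMl ?w_norm.
Qed.

Lemma W_L2 f : L2 f -> L2 (W f).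
Proof. by move=> fL; exact: lip_L2 (W_lip fL). Qed.

Lemma WD f g x : L2 f -> L2 g -> I x -> W (fun y => f y + g y) x = W f x + W g x.
Proof.
move=> fL gL Ix; rewrite /W -JD; [|exact: wf_intg..].
by apply: J_ext => y _; rewrite mulrDr.
Qed.

Lemma WZ c f x : L2 f -> I x -> W (fun y => c * f y) x = c * W f x.
Proof.
move=> fL Ix; rewrite /W -JZ; last exact: wf_intg.
by apply: J_ext => y _; rewrite mulrCA.
Qed.

Lemma WB f g x : L2 f -> L2 g -> I x -> W (fun y => f y - g y) x = W f x - W g x.
Proof.
move=> fL gL Ix; rewrite /W -JB; [|exact: wf_intg..].
by apply: J_ext => y _; rewrite mulrBr.
Qed.

Lemma W_norm f : L2 f -> L2norm (W f) <= L2norm f.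
Proof.
move=> fL; apply: L2norm_bnd; [exact: W_L2|exact: L2norm_ge0|].
by move=> x Ix; exact: W_bnd.
Qed.

Lemma degree_01 x : I x -> 0 <= degree w x <= 1.
Proof.
move=> Ix; apply/andP; split; first by apply: J_ge0 => y Iy; have /andP[] := w_01 Ix Iy.
rewrite -[leRHS](J_cst 1); apply: J_le; [exact: L2_intg (w_L2 Ix)|exact: intg_cst|].
by move=> y Iy; have /andP[] := w_01 Ix Iy.
Qed.

Lemma degree_W x : degree w x = W (fun=> 1) x.
Proof. by apply: J_ext => y _; rewrite mulr1. Qed.

Lemma degree_lip : lip01 K (degree w).
Proof.
have := W_lip (L2_cst 1); rewrite L2norm_cst normr1 mulr1.
by apply: lip_ext => x _; rewrite degree_W.
Qed.

Lemma degree_norm x : I x -> `|degree w x| <= 1.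
Proof. by move=> Ix; have /andP[a b] := degree_01 Ix; rewrite ger0_norm. Qed.

Lemma LopE f x : L2 f -> I x -> Lop w f x = degree w x * f x - W f x.
Proof.
move=> fL Ix; rewrite [degree w x * _]mulrC -JZ; last exact: L2_intg (w_L2 Ix).
rewrite -JB; [|by apply: intgZ; exact: L2_intg (w_L2 Ix)|exact: wf_intg].
by apply: J_ext => y _; ring.
Qed.

Lemma degf_L2 f : L2 f -> L2 (fun x => degree w x * f x).
Proof. by apply: L2Mb; [exact: lip_meas degree_lip|exact: degree_norm]. Qed.

Lemma Lop_L2 f : L2 f -> L2 (Lop w f).
Proof.
move=> fL; apply: L2_ext (L2B (degf_L2 fL) (W_L2 fL)) => x Ix.
by rewrite LopE.
Qed.

Lemma LopD f g x : L2 f -> L2 g -> I x ->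
  Lop w (fun y => f y + g y) x = Lop w f x + Lop w g x.
Proof. by move=> fL gL Ix; rewrite !LopE ?WD//; [ring|exact: L2D]. Qed.

Lemma LopZ c f x : L2 f -> I x -> Lop w (fun y => c * f y) x = c * Lop w f x.
Proof. by move=> fL Ix; rewrite !LopE ?WZ//; [ring|exact: L2Z]. Qed.

Lemma LopB f g x : L2 f -> L2 g -> I x ->
  Lop w (fun y => f y - g y) x = Lop w f x - Lop w g x.
Proof. by move=> fL gL Ix; rewrite !LopE ?WB//; [ring|exact: L2B]. Qed.

Lemma Lop_cst c x : Lop w (fun=> c) x = 0.
Proof. by rewrite -[RHS](J_cst 0); apply: J_ext => y _; rewrite subrr mulr0. Qed.

Lemma Lop_lip L f : lip01 L f -> lip01 (K * (`|f 0| + L) + 1 * L + K * L2norm f) (Lop w f).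
Proof.
move=> fl; apply: (@lip_ext _ _ (fun x => degree w x * f x - W f x)).
  by move=> x Ix; rewrite LopE//; exact: lip_L2 fl.
apply: lipB; last exact: W_lip (lip_L2 fl).
exact: (lipM degree_lip fl degree_norm (fun x => lip_bnd fl)).
Qed.

Lemma Lop_norm f : L2 f -> L2norm (Lop w f) <= 2 * L2norm f.
Proof.
move=> fL; rewrite (@L2norm_ext _ _ (fun x => degree w x * f x - W f x)); last by move=> x Ix; rewrite LopE.
apply: (le_trans (L2normB (degf_L2 fL) (W_L2 fL))); rewrite mulr_natl mulr2n; apply: lerD; last exact: W_norm.
apply: L2norm_mono => //; first exact: degf_L2.
by move=> x Ix; rewrite normrM ler_piMl// degree_norm.
Qed.

(** Within a pair of cells each argument of [w] moves by at most [1 / N], whence the factor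
    [2 * K / N]. *)
Lemma W_step (N : nat) f x (i : 'I_N) : L2 f -> in_cell i x ->
  `|W f x - \sum_(j < N) w (vtx R i) (vtx R j) * J (fun y => cell j y * f y)| <= 2 * K / N%:R * L2norm f.
Proof.
move=> fL ix; have Ix := cell_I ix; have fi := L2_intg fL.

have cf (j : 'I_N) : intg (fun y => cell j y * f y) by exact: L2_intgM (cell_L2 _ j) fL.
have -> : \sum_(j < N) w (vtx R i) (vtx R j) * J (fun y => cell j y * f y) =
   J (fun y => \sum_(j < N) w (vtx R i) (vtx R j) * (cell j y * f y)).
  by rewrite J_sum => [|j]; [apply: eq_bigr => j _; rewrite JZ|exact: intgZ].
have si : intg (fun y => \sum_(j < N) w (vtx R i) (vtx R j) * (cell j y * f y)).
  by apply: intg_sum => j; exact: intgZ.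
rewrite /W -JB//; last exact: wf_intg.
apply: (@le_trans _ _ (J (fun y => 2 * K / N%:R * `|f y|))); last first.
  rewrite JZ; last exact: intg_norm.
  by rewrite ler_wpM2l ?J_abs_le// mulr_ge0// mulr_ge0// wK0.
apply: (le_trans (J_norm _)); first by apply: intgB => //; exact: wf_intg.
apply: J_le; [by apply: intg_norm; apply: intgB => //; exact: wf_intg|by apply: intgZ; exact: intg_norm|].
move=> y Iy.
have [j jy] : exists j : 'I_N, in_cell j y.
  by apply: cell_ex => //; exact: leq_ltn_trans (ltn_ord i).
have -> : \sum_(j < N) w (vtx R i) (vtx R j) * (cell j y * f y) = w (vtx R i) (vtx R j) * f y.
  rewrite (bigD1 j)//= /cell jy mul1r big1 ?addr0// => l lj.
  case: (boolP (in_cell l y)) => [ly|]; last by rewrite mul0r mulr0.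
  by move: lj; rewrite (cell_uniq jy ly) eqxx.
rewrite -mulrBl normrM ler_wpM2r//.
apply: (le_trans (w_lip Ix (vtx_I R i) Iy (vtx_I R j))).
rewrite (mulrC 2) -!mulrA ler_wpM2l ?wK0// mulr_natl mulr2n lerD// cell_vtx//.
Qed.

(* Approximating [w] uniformly by step kernels replaces Fubini by a finite sum. *)
Lemma W_sym f g : L2 f -> L2 g -> inner (W f) g = inner f (W g).
Proof.
move=> fL gL; rewrite [RHS]innerC.
apply/eqP; rewrite -subr_eq0 -normr_le0; apply/ler_addgt0Pr => e e0; rewrite add0r.
pose c := 4 * K * L2norm f * L2norm g.
have c0 : 0 <= c by rewrite !mulr_ge0 ?L2norm_ge0 ?wK0.
pose N := (Num.truncn (c / e)).+1.
have NR : 0 < N%:R :> R by rewrite ltr0n.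
have cN : c / N%:R <= e.
  by rewrite ler_pdivrMr// mulrC -ler_pdivrMr// ltW// truncnS_gt.
apply: le_trans cN.
pose F f := stepfun (\row_(i < N) \sum_(j < N) w (vtx R i) (vtx R j) * J (fun y => cell j y * f y)).
have Fsym : inner (F f) g = inner (F g) f.
  rewrite !inner_stepfun//.
  under eq_bigr do rewrite mxE mulr_suml.
  under [RHS]eq_bigr do rewrite mxE mulr_suml.
  rewrite exchange_big /=; apply: eq_bigr => i _; apply: eq_bigr => j _.
  by rewrite [in RHS]w_sym; [ring|exact: vtx_I..].
have Fd h : L2 h -> L2norm (fun x => W h x - F h x) <= 2 * K / N%:R * L2norm h.
  move=> hL; apply: L2norm_bnd.
  - by apply: L2B; [exact: W_L2|exact: stepfun_L2].
  - by rewrite !mulr_ge0 ?L2norm_ge0 ?wK0.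
  - move=> x Ix; have [i ix] := @cell_ex R N x isT Ix.
    rewrite /F (stepfun_cell _ ix) mxE; exact: W_step.
have -> : inner (W f) g - inner (W g) f =
  inner (fun x => W f x - F f x) g - inner (fun x => W g x - F g x) f.
  rewrite !innerBl ?Fsym//; try by [exact: W_L2|exact: stepfun_L2].
  ring.
have WF h : L2 h -> L2 (fun x => W h x - F h x).
  by move=> hL; apply: L2B; [exact: W_L2|exact: stepfun_L2].
apply: (le_trans (ler_normB _ _)).
apply: (@le_trans _ _ (2 * K / N%:R * L2norm f * L2norm g + 2 * K / N%:R * L2norm g * L2norm f)).
  apply: lerD; (apply: (le_trans (inner_CS _ _)) => //; [exact: WF|]);
  by rewrite ler_wpM2r ?L2norm_ge0 ?Fd.
by rewrite le_eqVlt; apply/orP; left; apply/eqP; rewrite /c; field; rewrite gt_eqF.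
Qed.

Lemma Lop_sym f g : L2 f -> L2 g -> inner (Lop w f) g = inner f (Lop w g).
Proof.
move=> fL gL.
rewrite (@inner_ext _ _ (fun x => degree w x * f x - W f x) g g)//; last by move=> x Ix; rewrite LopE.
rewrite (@inner_ext _ f f _ (fun x => degree w x * g x - W g x))//; last by move=> x Ix; rewrite LopE.
rewrite innerBl ?innerBr ?W_sym//; [|by [exact: degf_L2|exact: W_L2]..].
by congr (_ - _); apply: J_ext => x _; rewrite mulrCA mulrA.
Qed.

Lemma J_Lop f : L2 f -> J (Lop w f) = 0.
Proof.
move=> fL; rewrite -inner1 Lop_sym//; last exact: L2_cst.
by rewrite -[RHS](J_cst 0); apply: J_ext => x _; rewrite Lop_cst mulr0.
Qed.
End Operator.

(** * Compactness and the resolvent *)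

Section Compactness.
Variable R : realType.
Implicit Types (f g : R -> R) (x y c : R).
Local Notation I := (@I01 R).

Lemma ultra_limit (U : set_system nat) (u : nat -> R) B : UltraFilter U ->
  (forall n, `|u n| <= B) -> exists l, forall e, 0 < e -> U [set n | `|u n - l| <= e].
Proof.
move=> UU uB; have PU : ProperFilter U by exact: ultra_proper.
have PF : ProperFilter (fmap u U) by exact: fmap_proper_filter.
have [] := @segment_compact R (- B) B (fmap u U) PF.
  rewrite /fmap /=; apply: filterE => n /=.
  by rewrite in_itv /= -ler_norml.
move=> l [_ cl]; exists l => e e0.
have [//|/= Un] := in_ultra_setVsetC [set n | `|u n - l| <= e] UU.
exfalso; have := cl (u @` (~` [set n | `|u n - l| <= e])) (ball l e).
have /[swap]/[apply] : fmap u U (u @` (~` [set n | `|u n - l| <= e])).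
  by rewrite /fmap /=; apply: filterS Un => n nn; exists n.
move=> /(_ (nbhsx_ballx _ _ e0)) [_ [[n nn <-]]].
rewrite /ball /= distrC => ne; apply: nn => /=; exact: ltW.
Qed.

Lemma grid_point (M : nat) x : (0 < M)%N -> I x ->
  exists i : nat, [/\ (i <= M)%N, I (i%:R / M%:R) & `|x - i%:R / M%:R| <= M%:R^-1].
Proof.
move=> M0 Ix; have [k kx] := cell_ex M0 Ix.
by exists k.+1; split; [exact: ltn_ord|exact: (vtx_I R k)|exact: (cell_vtx kx)].
Qed.

(** Arzela-Ascoli. An ultrafilter on the indices provides limits at all points simultaneously, in
    place of a diagonal extraction. It only allows finite intersections, so closeness is imposed on
    a finite grid and spread by the common Lipschitz constant. *)
Lemma equilip_cluster (h : nat -> R -> R) B L :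
  (forall n x, I x -> `|h n x| <= B) -> (forall n, lip01 L (h n)) ->
  exists g, lip01 L g /\
    forall e, 0 < e -> forall m, exists2 n, (m <= n)%N & forall x, I x -> `|h n x - g x| <= e.
Proof.
move=> hB hL.
have [U [UU ooU]] := ultraFilterLemma eventually_filter.
have PU : ProperFilter U by exact: ultra_proper.
have /choice[g gP] : forall x, exists l, I x -> forall e, 0 < e -> U [set n | `|h n x - l| <= e].
  move=> x; have [Ix|nIx] := pselect (I x); last by exists 0.
  by have [l H] := ultra_limit UU (fun n => hB n x Ix); exists l.
have gL : lip01 L g.
  move=> x y Ix Iy; apply/ler_addgt0Pr => e e0.
  have e2 : 0 < e / 2 by rewrite divr_gt0.
  have [n [/= n1 n2]] := filter_ex (filterI (gP x Ix _ e2) (gP y Iy _ e2)).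
  have -> : g x - g y = (h n x - h n y) - (h n x - g x) + (h n y - g y) by ring.
  apply: (le_trans (ler_normD _ _)); rewrite [e]splitr addrA; apply: lerD => //.
  by apply: (le_trans (ler_normB _ _)); apply: lerD => //; exact: hL.
exists g; split => // e e0 m.
have L0 := lip_ge0 gL.
have e3 : 0 < e / 3 by rewrite divr_gt0.
pose M := (Num.truncn (L / (e / 3))).+1.
have MR : 0 < M%:R :> R by rewrite ltr0n.
have LM : L * M%:R^-1 <= e / 3.
  by rewrite ler_pdivrMr// mulrC -ler_pdivrMr// ltW// truncnS_gt.
have grid (k : nat) : (k <= M.+1)%N ->
    U [set n | forall i, (i < k)%N -> I (i%:R / M%:R) -> `|h n (i%:R / M%:R) - g (i%:R / M%:R)| <= e / 3].
  elim: k => [_|k IH kM]; first by apply: filterE => n.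
  have := IH (ltnW kM); have [Ik|nIk] := pselect (I (k%:R / M%:R)).
    move=> H; apply: filterS (filterI H (gP _ Ik _ e3)) => n /= [n1 n2] i.
    by rewrite ltnS leq_eqVlt => /orP[/eqP->//|/n1].
  apply: filterS => n /= n1 i; rewrite ltnS leq_eqVlt => /orP[/eqP->//|/n1//].
have mU : U [set n | (m <= n)%N] by apply: ooU; exists m.
have [n [/= n1 n2]] := filter_ex (filterI (grid M.+1 (leqnn _)) mU).
exists n => // x Ix; have [i [iM Ii xi]] := @grid_point M x isT Ix.
set p := i%:R / M%:R in Ii xi.
have -> : h n x - g x = (h n x - h n p) + (h n p - g p) + (g p - g x) by ring.
have -> : e = e / 3 + e / 3 + e / 3 by field.
have xp : L * `|x - p| <= e / 3 by apply: le_trans LM; rewrite ler_wpM2l.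
apply: (le_trans (ler_normD _ _)); apply: lerD.
  apply: (le_trans (ler_normD _ _)); apply: lerD; last exact: n1.
  by apply: (le_trans (hL n _ _ Ix Ii)).
by apply: (le_trans (gL _ _ Ii Ix)); rewrite distrC.
Qed.

Lemma lipV L f k : 0 < k -> lip01 L f -> (forall x, I x -> k <= f x) ->
  lip01 (L / k ^+ 2) (fun x => (f x)^-1).
Proof.
move=> k0 fl fk x y Ix Iy.
have fx : 0 < f x by apply: lt_le_trans (fk _ Ix).
have fy : 0 < f y by apply: lt_le_trans (fk _ Iy).
have -> : (f x)^-1 - (f y)^-1 = (f y - f x) / (f x * f y) by field; rewrite !gt_eqF.
rewrite normrM normfV (ger0_norm (ltW (mulr_gt0 fx fy))) distrC mulrAC.
apply: ler_pM => //; [by rewrite invr_ge0 ltW// mulr_gt0|exact: fl|].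
by rewrite lef_pV2 ?posrE ?exprn_gt0 ?mulr_gt0// expr2 ler_pM ?fk// ltW.
Qed.

End Compactness.

(** * Compactness for approximate solutions below the range of the degree *)

Section Resolvent.
Variable R : realType.
Implicit Types (f g : R -> R) (x y c : R).
Local Notation I := (@I01 R).
Context (w : R -> R -> R) {K : R} {wK : lip_kernel w K}.
Variables (nu k : R).
Hypothesis k0 : 0 < k.
Hypothesis kd : forall x, I x -> k <= degree w x - nu.

Let r x := (degree w x - nu)^-1.
Let rL : lip01 ((K + 0) / k ^+ 2) r.
Proof. have H := lipB (degree_lip (wK := wK)) (lip_cst nu); exact: (lipV k0 H kd). Qed.

Let d0 x : I x -> 0 < degree w x - nu.
Proof. by move=> Ix; exact: lt_le_trans k0 (kd Ix). Qed.

Let r0 x : I x -> 0 <= r x.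
Proof. by move=> Ix; rewrite /r invr_ge0 ltW ?d0. Qed.

Let rk x : I x -> `|r x| <= k^-1.
Proof.
move=> Ix; rewrite ger0_norm ?r0// /r lef_pV2 ?posrE ?kd//; exact: d0.
Qed.

(* The functions [W (fs n)] are equi-Lipschitz, hence cluster uniformly, and
   [fs n] is recovered from [W (fs n)] by dividing by [degree w - nu >= k > 0]. *)
Lemma resolvent_cluster (fs : nat -> R -> R) g B :
  (forall n, L2 (fs n)) -> (forall n, L2norm (fs n) <= B) -> L2 g ->
  (forall e, 0 < e -> exists m, forall n, (m <= n)%N ->
     L2norm (fun x => Lop w (fs n) x - nu * fs n x - g x) <= e) ->
  exists f, [/\ L2 f, forall x, I x -> Lop w f x - nu * f x = g x &
    forall e, 0 < e -> forall m, exists2 n, (m <= n)%N & L2norm (fun x => fs n x - f x) <= e].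
Proof.
move=> fL fB gL res; have K0 := wK0 (wK := wK).
have B0 : 0 <= B by apply: le_trans (fB 0%N); exact: L2norm_ge0.
have [h [hL hc]] : exists h, lip01 (K * B) h /\
    forall e, 0 < e -> forall m, exists2 n, (m <= n)%N & forall x, I x -> `|W w (fs n) x - h x| <= e.
  apply: (@equilip_cluster R _ B) => [n x Ix|n x y Ix Iy].
    exact: le_trans (W_bnd (fL n) Ix) (fB n).
  by apply: (le_trans (W_lip (fL n) Ix Iy)); rewrite ler_wpM2r// ler_wpM2l.
pose f x := r x * (h x + g x).
have hL2 := lip_L2 hL.
have fL2 : L2 f by apply: (@L2Mb R _ _ k^-1); [exact: lip_meas rL|exact: rk|exact: L2D].
have resL n : L2 (fun x => Lop w (fs n) x - nu * fs n x - g x).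
  by apply: L2B => //; apply: L2B; [exact: Lop_L2|exact: L2Z].
have clus e : 0 < e -> forall m, exists n, [/\ (m <= n)%N,
    forall x, I x -> `|W w (fs n) x - h x| <= e & L2norm (fun x => fs n x - f x) <= e].
  move=> e0 m; pose e' := Num.min e (e * k / 2).
  have e'0 : 0 < e' by rewrite lt_min e0 divr_gt0// mulr_gt0.
  have [m' Hm'] := res _ e'0; have [n nm Hn] := hc _ e'0 (maxn m m').
  exists n; split; first by apply: leq_trans nm; exact: leq_maxl.
    by move=> x Ix; apply: (le_trans (Hn x Ix)); rewrite ge_min lexx.
  pose u x := (Lop w (fs n) x - nu * fs n x - g x) + (W w (fs n) x - h x).
  have uL : L2 u by apply: L2D => //; apply: L2B => //; exact: W_L2.
  have -> : L2norm (fun x => fs n x - f x) = L2norm (fun x => r x * u x).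
    apply: L2norm_ext => x Ix; rewrite /u /f LopE// /r; field.
    by rewrite gt_eqF ?d0.
  apply: (@le_trans _ _ (k^-1 * L2norm u)).
    rewrite -[k^-1]gtr0_norm ?invr_gt0// -L2normZ//; apply: L2norm_mono.
    - by apply: (@L2Mb R _ _ k^-1); [exact: lip_meas rL|exact: rk|].
    - exact: L2Z.
    - by move=> x Ix; rewrite !normrM ler_wpM2r// (le_trans (rk Ix))// ler_norm.
  rewrite mulrC ler_pdivrMr//.
  have -> : e * k = e * k / 2 + e * k / 2 by field.
  apply: (le_trans (L2normD _ _)); [exact: resL|by apply: L2B => //; exact: W_L2|].
  apply: lerD; first by apply: (le_trans (Hm' n (leq_trans (leq_maxr _ _) nm))); rewrite ge_min lexx orbT.
  apply: L2norm_bnd; [by apply: L2B => //; exact: W_L2|by rewrite divr_ge0// mulr_ge0 ?ltW|].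
  by move=> x Ix; apply: (le_trans (Hn x Ix)); rewrite ge_min lexx orbT.
exists f; split => //; last first.
  by move=> e e0 m; have [n [mn _ H]] := clus e e0 m; exists n.
move=> x Ix; rewrite LopE//.
have -> : W w f x = h x.
  apply/eqP; rewrite -subr_eq0 -normr_le0; apply/ler_addgt0Pr => e e0; rewrite add0r.
  have e2 : 0 < e / 2 by rewrite divr_gt0.
  have [n [_ H1 H2]] := clus _ e2 0%N.
  have -> : W w f x - h x = (W w (fs n) x - h x) - (W w (fs n) x - W w f x) by ring.
  apply: (le_trans (ler_normB _ _)); rewrite [e]splitr; apply: lerD; first exact: H1.
  rewrite -WB//; apply: le_trans H2; apply: W_bnd => //; exact: L2B.
by rewrite /f /r; field; rewrite gt_eqF ?d0.
Qed.

(** Dividing the eigenvalue equation by [degree w - nu] writes [f], almost everywhere, as [r] times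
    [W w f], which is Lipschitz. Since [W] ignores null sets, this representative satisfies the
    equation everywhere. *)
Lemma eigen_regular f : L2 f -> ae_eq01 (Lop w f) (fun x => nu * f x) ->
  exists f', [/\ exists L, lip01 L f', forall x, I x -> Lop w f' x = nu * f' x & ae_eq01 f f'].
Proof.
move=> fL fe; pose f' x := r x * W w f x.
have f'lip : exists L, lip01 L f'.
  by eexists; exact: lipM rL (W_lip fL) rk (fun x => W_bnd fL (x := x)).
have f'L : L2 f' by case: f'lip => L /lip_L2.
have ff' : ae_eq01 f f'.
  rewrite /ae_eq01; apply: filterS fe => x /= fe Ix; have := fe Ix; rewrite LopE// /f' /r => H.
  have -> : W w f x = (degree w x - nu) * f x by rewrite mulrBl -H; ring.
  by rewrite mulKf// gt_eqF// d0.
exists f'; split => // x Ix; rewrite LopE//.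
have -> : W w f' x = W w f x.
  apply: J_ae; [by apply: measM; [exact: w_meas|exact: L2_meas]..|].
  by rewrite /ae_eq01; apply: filterS ff' => y /= ff' Iy; rewrite ff'.
by rewrite /f' /r; field; rewrite gt_eqF ?d0.
Qed.
End Resolvent.

(** * Total variation and the Rayleigh quotient *)

Section Domination.
Variable R : realType.
Implicit Types (f g F G : R -> R) (x y c : R).
Local Notation I := (@I01 R).

(** Equivalently, [G + f] and [G - f] are both nondecreasing. Up to a constant, the least such [G]
    is the total variation of [f]. *)
Definition dominates G f := forall x y, I x -> I y -> x <= y -> `|f y - f x| <= G y - G x.
Definition nondecr f := forall x y, I x -> I y -> x <= y -> f x <= f y.

Lemma total_variation_dominated f G a b : 0 <= a -> a <= b -> b <= 1 -> dominates G f ->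
  (total_variation a b f <= (G b - G a)%:E)%E.
Proof.
move=> a0 ab b1 Gf.
have Iab x : a <= x -> x <= b -> I x by move=> ax xb; apply/andP; split; lra.
have ndG : {in `[a, b] &, nondecreasing_fun G}.
  move=> x y; rewrite !in_itv /= => /andP[ax xb] /andP[ay yb] xy.
  have := Gf x y (Iab _ ax xb) (Iab _ ay yb) xy.
  by move=> /(le_trans (normr_ge0 _)); rewrite subr_ge0.
apply: ge_ereal_sup => _ [_ [l abl <-] <-]; rewrite lee_fin.
rewrite -(nondecreasing_variation ndG abl) /variation big_nat_cond [leRHS]big_nat_cond.
apply: ler_sum => i; rewrite andbT => /andP[_ il] /=.
have Ii j : (j <= size l)%N -> I (nth b (a :: l) j).
  by move=> jl; apply: Iab; [exact: itv_partition_nth_ge abl|exact: itv_partition_nth_le abl].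
set p := nth b l i; set q := nth b (a :: l) i.
have Ip : I p by exact: (Ii i.+1).
have Iq : I q by apply: Ii; exact: ltnW.
have [qp|pq] := leP q p; first by apply: (le_trans (Gf q p Iq Ip qp)); exact: ler_norm.
rewrite distrC (distrC (G p)); apply: le_trans (ler_norm _); exact: Gf (ltW pq).
Qed.

(** [F] is the total variation over [[0, x]]; it is finite and [L]-Lipschitz because [L * x] already
    dominates [f]. *)
Lemma least_dominating L f : lip01 L f ->
  exists F, [/\ lip01 L F, dominates F f & forall G, dominates G f ->
    forall x y, I x -> I y -> x <= y -> F y - F x <= G y - G x].
Proof.
move=> fl; pose F x := fine (total_variation 0 x f).
have Ldom : dominates (fun x => L * x) f.
  move=> x y Ix Iy xy; apply: (le_trans (fl _ _ Iy Ix)).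
  by rewrite ger0_norm ?subr_ge0// mulrBr.
have fin x y : I x -> I y -> x <= y -> total_variation x y f \is a fin_num.
  move=> /andP[x0 x1] /andP[y0 y1] xy; rewrite ge0_fin_numE; last exact: total_variation_ge0.
  by apply: le_lt_trans (total_variation_dominated x0 xy y1 Ldom) _; rewrite ltry.
have FB x y : I x -> I y -> x <= y -> F y - F x = fine (total_variation x y f).
  move=> Ix Iy xy; have /andP[x0 x1] := Ix.
  rewrite /F (total_variationD f x0 xy) fineD ?fin//; [by rewrite addrAC subrr add0r|exact: I01_0].
have Fmin G : dominates G f -> forall x y, I x -> I y -> x <= y -> F y - F x <= G y - G x.
  move=> Gf x y Ix Iy xy; rewrite FB// -lee_fin fineK ?fin//.
  by move/andP: Ix => [x0 _]; move/andP: Iy => [_ y1]; exact: total_variation_dominated.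
have Fdom : dominates F f.
  by move=> x y Ix Iy xy; rewrite FB// -lee_fin fineK ?fin//; exact: total_variation_ge.
exists F; split => // x y Ix Iy.
wlog xy : x y Ix Iy / x <= y.
  by move=> H; case: (leP x y) => [/H|/ltW/H]; [exact|rewrite distrC (distrC y)]; exact.
rewrite distrC ger0_norm; last first.
  by apply: le_trans (Fdom _ _ Ix Iy xy).
by apply: (le_trans (Fmin _ Ldom _ _ Ix Iy xy)); rewrite -mulrBr distrC ger0_norm ?subr_ge0.
Qed.

(** Chebyshev's inequality. As [f] has mean zero, [p] may be shifted by its value at a zero of [f];
    both factors then have the same sign at every point. *)
Lemma nondecr_inner_ge0 L M f p : lip01 L f -> lip01 M p -> J f = 0 -> nondecr f -> nondecr p ->
  0 <= inner p f.
Proof.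
move=> fl pl Jf fnd pnd.
have fL := lip_L2 fl; have pL := lip_L2 pl.
have I0 := I01_0 R; have I1 := I01_1 R.
have fc : {within `[0, 1], continuous f}.
  have := continuous_subspaceT (lip_clamp_cont fl).
  move=> /(_ `[0, 1]%classic); apply: subspace_eq_continuous.
  by move=> x /set_mem; rewrite -I01E => Ix; rewrite /from_subspace /= clamp01_id.
have f0 : f 0 <= 0.
  rewrite -[leLHS](J_cst (f 0)) -[leRHS]Jf; apply: J_le; [exact: intg_cst|exact: L2_intg|].
  by move=> x Ix; apply: fnd => //; case/andP: Ix.
have f1 : 0 <= f 1.
  rewrite -[leRHS](J_cst (f 1)) -[leLHS]Jf; apply: J_le; [exact: L2_intg|exact: intg_cst|].
  by move=> x Ix; apply: fnd => //; case/andP: Ix.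
have [||c ci fc0] := @IVT R f 0 1 0 _ fc; first by rewrite ler01.
  by rewrite ge_min f0 /= le_max f1 orbT.
have Ic : I c by move: ci; rewrite in_itv.
have -> : inner p f = inner (fun x => p x - p c) f.
  rewrite innerBl//; last exact: L2_cst.
  suff -> : inner (fun=> p c) f = 0 by rewrite subr0.
  by rewrite -[LHS]/(J (fun x => p c * f x)) JZ ?Jf ?mulr0//; exact: L2_intg.
apply: J_ge0 => x Ix; have [xc|cx] := leP x c.
  have h1 := pnd _ _ Ix Ic xc; have h2 := fnd _ _ Ix Ic xc.
  by rewrite mulr_le0 ?subr_le0// -[leRHS]fc0.
have h1 := pnd _ _ Ic Ix (ltW cx); have h2 := fnd _ _ Ic Ix (ltW cx).
by rewrite mulr_ge0 ?subr_ge0// -[leLHS]fc0.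
Qed.

End Domination.

(** * The Rayleigh quotient and its minimizers *)

Section Rayleigh.
Variable R : realType.
Implicit Types (f g F G : R -> R) (x y c : R).
Local Notation I := (@I01 R).
Context (w : R -> R -> R) {K : R} {wK : lip_kernel w K}.
Hypothesis w_A4 : A4 w.
Let degree_01 := @degree_01 R w K wK.

Definition mu2 : R := inf [set inner (Lop w f) f | f in @Hset R].
Definition qform f g : R := inner (Lop w f) g - mu2 * inner f g.

Lemma Lop_form_bnd f : L2 f -> `|inner (Lop w f) f| <= 2 * inner f f.
Proof.
move=> fL; apply: (le_trans (inner_CS (Lop_L2 fL) fL)).
by rewrite -L2norm2 expr2 mulrA ler_wpM2r ?L2norm_ge0// Lop_norm.
Qed.

Lemma HsetP f : Hset f <-> [/\ L2 f, J f = 0 & inner f f = 1].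
Proof.
have E : inner f f = Rintegral (@leb R) I (fun x => f x ^+ 2).
  by apply: J_ext => x _; rewrite expr2.
by rewrite E; split => [[a [b c]]|[a b c]].
Qed.

Lemma Hset_lbound : has_lbound [set inner (Lop w f) f | f in @Hset R].
Proof.
exists (- 2) => _ [f /HsetP[fL _ f1] <-].
by have := Lop_form_bnd fL; rewrite f1 mulr1 ler_norml => /andP[].
Qed.

Lemma Hset_inf : has_inf [set inner (Lop w f) f | f in @Hset R].
Proof.
split; last exact: Hset_lbound.
(* The witness that the set is nonempty is [1] on the left half and [- 1] on the right half. *)
pose v : 'rV[R]_2 := \row_i (if i == 0 :> 'I_2 then 1 else - 1).
exists (inner (Lop w (stepfun v)) (stepfun v)); exists (stepfun v) => //.
apply/HsetP; split; first exact: stepfun_L2.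
  by rewrite J_stepfun !big_ord_recl big_ord0 !mxE /= addr0 subrr mulr0.
rewrite inner_stepfun2 !big_ord_recl big_ord0 !mxE /=; by field.
Qed.

Lemma mu2_le f : L2 f -> J f = 0 -> mu2 * inner f f <= inner (Lop w f) f.
Proof.
move=> fL Jf; have := inner_ge0 f; rewrite le_eqVlt => /predU1P[f0|f0].
  by have := Lop_form_bnd fL; rewrite -f0 !mulr0 normr_le0 => /eqP ->.
pose c := (L2norm f)^-1.
have nf : L2norm f != 0 by rewrite -sqrf_eq0 L2norm2 gt_eqF.
have c2 : c ^+ 2 = (inner f f)^-1 by rewrite exprVn L2norm2.
have cfL := L2Z c fL.
have : mu2 <= inner (Lop w (fun x => c * f x)) (fun x => c * f x).
  apply: ge_inf; [exact: Hset_lbound|exists (fun x => c * f x) => //].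
  apply/HsetP; split => //; first by rewrite JZ ?Jf ?mulr0//; exact: L2_intg.
  by rewrite innerZl ?innerZr// mulrA -expr2 c2 mulVf// gt_eqF.
rewrite (@inner_ext _ _ (fun x => c * Lop w f x) _ (fun x => c * f x))//; last by move=> x Ix; rewrite LopZ.
rewrite innerZl ?innerZr//; try exact: Lop_L2.
by rewrite mulrA -expr2 c2 mulrC ler_pdivlMr.
Qed.

Lemma deg_gap : exists2 k, 0 < k & forall x, I x -> k <= degree w x - mu2.
Proof.
exists (inf [set degree w x | x in I] - mu2); first by rewrite subr_gt0.
move=> x Ix; rewrite lerD2r; apply: ge_inf; last by exists x.
by exists 0 => _ [y Iy <-]; have /andP[] := degree_01 Iy.
Qed.

Lemma mu2_lt1 : mu2 < 1.
Proof.
have [k k0 H] := deg_gap; have := H 0 (I01_0 R).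
by have /andP[] := degree_01 (I01_0 R); lra.
Qed.

Lemma qformDl f g h : L2 f -> L2 g -> L2 h -> qform (fun x => f x + g x) h = qform f h + qform g h.
Proof.
move=> fL gL hL; rewrite /qform innerDl//.
rewrite (@inner_ext _ _ (fun x => Lop w f x + Lop w g x) h h)//; last by move=> x Ix; rewrite LopD.
by rewrite innerDl//; [ring|exact: Lop_L2..].
Qed.

Lemma qformZl c f g : L2 f -> L2 g -> qform (fun x => c * f x) g = c * qform f g.
Proof.
move=> fL gL; rewrite /qform innerZl//.
rewrite (@inner_ext _ _ (fun x => c * Lop w f x) g g)//; last by move=> x Ix; rewrite LopZ.
by rewrite innerZl//; [ring|exact: Lop_L2].
Qed.

Lemma qformC f g : L2 f -> L2 g -> qform f g = qform g f.
Proof. by move=> fL gL; rewrite /qform Lop_sym// [in LHS]innerC [inner f g]innerC. Qed.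

Lemma qform_ge0 f : L2 f -> J f = 0 -> 0 <= qform f f.
Proof. by move=> fL Jf; rewrite subr_ge0 mu2_le. Qed.

Definition resid f : R -> R := fun x => Lop w f x - mu2 * f x.

Lemma resid_L2 f : L2 f -> L2 (resid f).
Proof. by move=> fL; apply: L2B; [exact: Lop_L2|exact: L2Z]. Qed.

Lemma qform_resid f g : L2 f -> L2 g -> qform f g = inner (resid f) g.
Proof. by move=> fL gL; rewrite innerBl ?innerZl//; [exact: Lop_L2|exact: L2Z]. Qed.

Lemma J_resid f : L2 f -> J f = 0 -> J (resid f) = 0.
Proof.
move=> fL Jf; rewrite JB ?JZ ?Jf ?J_Lop ?mulr0 ?subr0//; [exact: L2_intg|exact: L2_intg (Lop_L2 _)|].
by apply: intgZ; exact: L2_intg.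
Qed.

Lemma J_lin c f g : L2 f -> L2 g -> J f = 0 -> J g = 0 -> J (fun x => f x + c * g x) = 0.
Proof.
move=> fL gL Jf Jg; rewrite JD ?JZ ?Jf ?Jg ?mulr0 ?addr0//; try exact: L2_intg.
by apply: intgZ; exact: L2_intg.
Qed.

(** Cauchy-Schwarz for the semidefinite [qform], applied to [f] and its own residual. It turns a
    near-minimizer of the Rayleigh quotient into an approximate eigenfunction, which is what
    [resolvent_cluster] takes. *)
Lemma resid_le f : L2 f -> J f = 0 ->
  inner (resid f) (resid f) <= (2 + `|mu2|) * qform f f.
Proof.
move=> fL Jf; set g := resid f; have gL : L2 g by exact: resid_L2.
have Jg : J g = 0 by exact: J_resid.
have : qform f g ^+ 2 <= qform f f * qform g g.
  apply: quad_disc => t; have tgL := L2Z t gL; have ftL := L2D fL tgL.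
  have := qform_ge0 ftL (J_lin t fL gL Jf Jg).
  rewrite qformDl// (qformC fL ftL) (qformC tgL ftL) qformDl// qformDl// qformZl// (qformC fL tgL).
  rewrite qformZl// qformZl// (qformC gL tgL) qformZl// (qformC gL fL).
  by congr (_ <= _); ring.
rewrite qform_resid// -/g.
have gg : qform g g <= (2 + `|mu2|) * inner g g.
  rewrite /qform mulrDl; apply: lerD.
    by apply: le_trans (Lop_form_bnd gL); exact: ler_norm.
  by rewrite -mulNr ler_wpM2r ?inner_ge0// -normrN ler_norm.
have := inner_ge0 g; rewrite le_eqVlt => /predU1P[<- _|g0 H].
  by rewrite mulr_ge0 ?qform_ge0// addr_ge0.
rewrite -(ler_pM2r g0) -expr2; apply: (le_trans H).
by rewrite [leRHS]mulrAC [leRHS]mulrC ler_wpM2l ?qform_ge0.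
Qed.

(** The equation holds at every point, so that values at the endpoints [0] and [1] can be used. *)
Definition eigenlip nu f := (exists L, lip01 L f) /\ forall x, I x -> Lop w f x = nu * f x.
Definition ground f := eigenlip mu2 f /\ J f = 0.

Lemma ground_L2 f : ground f -> L2 f.
Proof. by move=> [[[L /lip_L2]]]. Qed.

Lemma qform0_ground L f : lip01 L f -> J f = 0 -> qform f f <= 0 -> ground f.
Proof.
move=> fl Jf q0; split => //; split; first by exists L.
have fL := lip_L2 fl.
have rl : lip01 (K * (`|f 0| + L) + 1 * L + K * L2norm f + `|mu2| * L) (resid f).
  by apply: lipB; [exact: Lop_lip|exact: lipZ].
move=> x Ix; apply/eqP; rewrite -subr_eq0; apply/eqP.
apply: (lip_norm0 rl _ Ix); apply/eqP; rewrite -sqrf_eq0 L2norm2 eq_le inner_ge0 andbT.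
by apply: (le_trans (resid_le fL Jf)); rewrite mulr_ge0_le0// addr_ge0.
Qed.

(** Serves twice: for a minimizing sequence in [ground_ex], and in [spectral_gap] for a sequence
    orthogonal to a ground state. *)
Lemma minimizing_cluster (fs : nat -> R -> R) :
  (forall n, L2 (fs n)) -> (forall n, J (fs n) = 0) -> (forall n, L2norm (fs n) = 1) ->
  (forall e, 0 < e -> exists m, forall n, (m <= n)%N -> qform (fs n) (fs n) <= e) ->
  exists f, [/\ ground f, L2norm f = 1 &
    forall e, 0 < e -> forall m, exists2 n, (m <= n)%N & L2norm (fun x => fs n x - f x) <= e].
Proof.
move=> fL fJ f1 fq; have [k k0 kd] := deg_gap.
have c0 : 0 < 2 + `|mu2| by rewrite ltr_wpDr.
have [||f [f_L2 fe fc]] := resolvent_cluster k0 kd (fs := fs) (B := 1) fL _ (L2_cst 0).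
- by move=> n; rewrite f1.
- move=> e e0; have e2 : 0 < e ^+ 2 / (2 + `|mu2|) by rewrite divr_gt0// exprn_gt0.
  have [m Hm] := fq _ e2; exists m => n mn; apply: L2norm_le; first exact: ltW.
  rewrite (@inner_ext _ _ (resid (fs n)) _ (resid (fs n))); try by move=> x _; rewrite subr0.
  apply: (le_trans (resid_le (fL n) (fJ n))).
  by rewrite mulrC -ler_pdivlMr// Hm.
have [f' [f'lip f'e ff']] : exists f', [/\ exists L, lip01 L f', forall x, I x -> Lop w f' x = mu2 * f' x & ae_eq01 f f'].
  apply: (eigen_regular k0 kd) => //; rewrite /ae_eq01.
  apply: (filterS (P := fun x => True)); last exact: filterT.
  by move=> x _ Ix; have := fe x Ix; lra.
have f'L : L2 f' by case: f'lip => L /lip_L2.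
have f'norm g : L2 g -> inner f g = inner f' g by move=> gL; exact: inner_ae.
have f'c : forall e, 0 < e -> forall m, exists2 n, (m <= n)%N & L2norm (fun x => fs n x - f' x) <= e.
  move=> e e0 m; have [n mn H] := fc e e0 m; exists n => //.
  rewrite /L2norm; suff -> : inner (fun x => fs n x - f' x) (fun x => fs n x - f' x) =
    inner (fun x => fs n x - f x) (fun x => fs n x - f x) by [].
  rewrite !innerBl ?innerBr//; try exact: L2B.
  by rewrite !(innerC (fs n)) -!f'norm// (innerC f f') -f'norm.
exists f'; split => //.
  split => //; apply/eqP; rewrite -normr_le0; apply/ler_addgt0Pr => e e0; rewrite add0r.
  have [n _ H] := f'c e e0 0%N; rewrite -normrN -sub0r -(fJ n) -JB; [|exact: L2_intg..].
  by apply: le_trans H; apply: J_le_norm; exact: L2B.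
apply/eqP; rewrite -subr_eq0 -normr_le0; apply/ler_addgt0Pr => e e0; rewrite add0r.
have [n _ H] := f'c e e0 0%N; apply: le_trans H; rewrite ler_norml; apply/andP; split.
  have : L2norm (fs n) <= L2norm (fun x => fs n x - f' x) + L2norm f'.
    rewrite (@L2norm_ext _ (fs n) (fun x => (fs n x - f' x) + f' x)); last by move=> x _; rewrite subrK.
    by apply: L2normD => //; exact: L2B.
  by rewrite f1; lra.
have : L2norm f' <= L2norm (fs n) + L2norm (fun x => fs n x - f' x).
  rewrite {1}(@L2norm_ext _ f' (fun x => fs n x - (fs n x - f' x))); last by move=> x _; ring.
  by apply: L2normB => //; exact: L2B.
by rewrite f1; lra.
Qed.

Lemma inv_nat_le (e : R) : 0 < e -> exists m, forall n, (m <= n)%N -> n.+1%:R^-1 <= e.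
Proof.
move=> e0; exists (Num.truncn e^-1) => n mn.
rewrite -[leRHS]invrK lef_pV2 ?posrE ?invr_gt0//.
by apply/ltW; apply: lt_le_trans (truncnS_gt _) _; rewrite ler_nat.
Qed.

Lemma ground_ex : exists f, ground f /\ L2norm f = 1.
Proof.
have /choice[fs fsP] : forall n : nat, exists f, Hset f /\ inner (Lop w f) f < mu2 + n.+1%:R^-1.
  move=> n; have n0 : 0 < n.+1%:R^-1 :> R by rewrite invr_gt0.
  by have [_ [f Hf <-] lt] := inf_adherent n0 Hset_inf; exists f.
have fsH n : [/\ L2 (fs n), J (fs n) = 0 & inner (fs n) (fs n) = 1].
  by have [/HsetP] := fsP n.
have [||||f [fg f1 _]] := @minimizing_cluster fs; last by exists f.
- by move=> n; case: (fsH n).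
- by move=> n; case: (fsH n).
- by move=> n; case: (fsH n) => _ _; rewrite /L2norm => ->; rewrite sqrtr1.
move=> e e0; have [m Hm] := inv_nat_le e0; exists m => n mn.
have [_ _ i1] := fsH n; have [_ lt] := fsP n.
by rewrite /qform i1 mulr1 lerBlDl (le_trans (ltW lt))// lerD2l Hm.
Qed.

End Rayleigh.

(** * Simplicity of the ground eigenvalue *)

Section Simplicity.
Variable R : realType.
Implicit Types (f g u F G : R -> R) (x y c : R).
Local Notation I := (@I01 R).
Context (w : R -> R -> R) {K : R} {wK : lip_kernel w K}.
Hypothesis w_rob : robinsonian w.
Hypothesis w_A2 : A2 w.
Hypothesis w_A4 : A4 w.
Local Notation mu := (mu2 w).
Let degree_01 := @degree_01 R w K wK.
Let kernel_sym := @kernel_sym R w K wK.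
Let kernel_01 := @kernel_01 R w K wK.
Let w_lipr := @w_lipr R w K wK.
Let w_L2 := @w_L2 R w K wK.
Let w_norm := @w_norm R w K wK.
Let mu2_lt1 := @mu2_lt1 R w K wK w_A4.
Let deg_gap := @deg_gap R w K wK w_A4.
Let ground_ex := @ground_ex R w K wK w_A4.

Lemma rob_left x x' y : I x -> I x' -> I y -> x <= x' -> y < x -> w x' y <= w x y.
Proof.
move=> Ix Ix' Iy; rewrite le_eqVlt => /predU1P[->//|xx'] yx.
rewrite (kernel_sym Ix' Iy) (kernel_sym Ix Iy).
by apply: (proj2 (w_rob Iy Ix Ix')); rewrite yx.
Qed.

Lemma rob_right x x' y : I x -> I x' -> I y -> x <= x' -> x' < y -> w x y <= w x' y.
Proof.
move=> Ix Ix' Iy; rewrite le_eqVlt => /predU1P[->//|xx'] yx.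
rewrite (kernel_sym Ix' Iy) (kernel_sym Ix Iy).
by apply: (proj1 (w_rob Iy Ix Ix')); rewrite xx'.
Qed.

(** For [y] outside [[x, x']] the Robinsonian property gives the two factors opposite signs. For [y]
    inside, the kernel increment is at most [1] and [u y >= u x]. *)
Lemma drift_le u x x' y : nondecr u -> I x -> I x' -> I y -> x <= x' ->
  (w x' y - w x y) * (u x' - u y) <= u x' - u x.
Proof.
move=> und Ix Ix' Iy xx'.
have uxx : 0 <= u x' - u x by rewrite subr_ge0 und.
have [yx|xy] := ltP y x.
  apply: le_trans uxx; rewrite mulr_le0_ge0 ?subr_le0 ?rob_left// subr_ge0 und// ltW//.
  exact: lt_le_trans xx'.
have [x'y|yx'] := ltP x' y.
  apply: le_trans uxx; rewrite mulr_ge0_le0 ?subr_le0 ?subr_ge0 ?rob_right//.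
  by rewrite und// ltW.
have uy : 0 <= u x' - u y by rewrite subr_ge0 und.
apply: (@le_trans _ _ (1 * (u x' - u y))).
  rewrite ler_wpM2r//.
  have /andP[] := kernel_01 Ix Iy; have /andP[] := kernel_01 Ix' Iy; lra.
by rewrite mul1r lerD2l lerN2 und.
Qed.

Lemma Lop_increment u x x' : L2 u -> I x -> I x' ->
  Lop w u x' - Lop w u x = degree w x * (u x' - u x) + J (fun y => (w x' y - w x y) * (u x' - u y)).
Proof.
move=> uL Ix Ix'; rewrite !LopE//.
have wi x0 : I x0 -> intg (w x0) by move=> I0; exact: L2_intg (w_L2 I0).
have -> : J (fun y => (w x' y - w x y) * (u x' - u y)) =
   J (fun y => (u x' * w x' y - w x' y * u y) - (u x' * w x y - w x y * u y)).
  by apply: J_ext => y _; ring.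
rewrite JB; [|by apply: intgB; [exact: intgZ (wi _ _)|exact: wf_intg]..].
rewrite !JB; [|by [exact: intgZ (wi _ _)|exact: wf_intg]..].
rewrite !JZ; [|by [exact: wi]..].
by rewrite /degree /W /J; ring.
Qed.

Lemma drift_intg u x x' : L2 u -> I x -> I x' -> intg (fun y => (w x' y - w x y) * (u x' - u y)).
Proof.
move=> uL Ix Ix'; apply: L2_intgM; first by apply: L2B; exact: w_L2.
by apply: L2B => //; exact: L2_cst.
Qed.

(** Origin of the constant [2]: one unit bounds [degree w x], the other comes from [drift_le]. *)
Lemma Lop_increment_le u x x' : L2 u -> nondecr u -> I x -> I x' -> x <= x' ->
  Lop w u x' - Lop w u x <= 2 * (u x' - u x).
Proof.
move=> uL und Ix Ix' xx'; rewrite Lop_increment//.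
have uxx : 0 <= u x' - u x by rewrite subr_ge0 und.
rewrite mulr_natl mulr2n; apply: lerD.
  by have /andP[d0 d1] := degree_01 Ix; rewrite ler_piMl.
rewrite -[leRHS]J_cst; apply: J_le; [exact: drift_intg|exact: intg_cst|].
by move=> y Iy; exact: drift_le.
Qed.

(* [2 F - Lop w F] dominates [(2 - mu) f] by [Lop_increment_le] applied to [F + f]
   and [F - f]; minimality of the total variation [F] makes [mu F - Lop w F]
   nondecreasing, and Chebyshev's inequality bounds the Rayleigh quotient of [F]. *)
Lemma ground_total_variation f : ground w f -> exists F, [/\ ground w F, dominates F f &
  forall G, dominates G f -> forall x y, I x -> I y -> x <= y -> F y - F x <= G y - G x].
Proof.
move=> fg; have fL := ground_L2 fg; case: fg => -[[L fl] fe] fJ.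
have [F0 [F0l F0d F0m]] := least_dominating fl.
have F0L := lip_L2 F0l.
have [F [Fl FJ Fd Fm]] : exists F, [/\ lip01 (L + 0) F, J F = 0, dominates F f &
    forall G, dominates G f -> forall x y, I x -> I y -> x <= y -> F y - F x <= G y - G x].
  exists (fun x => F0 x - J F0); split.
  - by apply: lipB => //; exact: lip_cst.
  - by rewrite JB ?J_cst ?subrr//; [exact: L2_intg|exact: intg_cst].
  - by move=> x y Ix Iy xy; have := F0d x y Ix Iy xy; rewrite opprB addrA subrK.
  - by move=> G Gf x y Ix Iy xy; have := F0m G Gf x y Ix Iy xy; lra.
have FL : L2 F := lip_L2 Fl.
exists F; split => //; apply: (qform0_ground Fl FJ).
have mu1 := mu2_lt1; have mu20 : 0 < 2 - mu by lra.
have nd1 : nondecr (fun x => F x + f x).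
  by move=> x y Ix Iy xy; have := Fd x y Ix Iy xy; rewrite ler_norml => /andP[]; lra.
have nd2 : nondecr (fun x => F x - f x).
  by move=> x y Ix Iy xy; have := Fd x y Ix Iy xy; rewrite ler_norml => /andP[]; lra.
have Gd : dominates (fun x => (2 - mu)^-1 * (2 * F x - Lop w F x)) f.
  move=> x y Ix Iy xy; rewrite -mulrBr mulrC ler_pdivlMr//.
  have := Lop_increment_le (L2D FL fL) nd1 Ix Iy xy.
  have := Lop_increment_le (L2B FL fL) nd2 Ix Iy xy.
  rewrite !LopB ?LopD// !fe//.
  rewrite -[X in `|_| * X]gtr0_norm// -normrM ler_norml => h1 h2.
  by apply/andP; split; lra.
pose p x := mu * F x - Lop w F x.
have pnd : nondecr p.
  move=> x y Ix Iy xy; have := Fm _ Gd x y Ix Iy xy.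
  rewrite -mulrBr mulrC ler_pdivlMr// /p; lra.
have pl : lip01 (`|mu| * (L + 0) + (K * (`|F 0| + (L + 0)) + 1 * (L + 0) + K * L2norm F)) p.
  by apply: lipB; [exact: lipZ|exact: Lop_lip].
have Fnd : nondecr F.
  by move=> x y Ix Iy xy; have := Fd x y Ix Iy xy => /(le_trans (normr_ge0 _)); lra.
have := nondecr_inner_ge0 Fl pl FJ Fnd pnd.
rewrite innerBl ?innerZl//; [|exact: L2Z|exact: Lop_L2].
by rewrite /qform; lra.
Qed.

(** To the right of [a] this does not increase in [x], by the Robinsonian property, so its negative
    can serve as a nondecreasing comparison function. *)
Definition corner a x := J (fun y => (y <= a)%R%:R * w x y).

Lemma corner_intg a x : I x -> intg (fun y => (y <= a)%R%:R * w x y).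
Proof.
move=> Ix; apply: (@intg_bnd _ _ 1).
  apply: measM; last exact: w_meas.
  have -> : (fun y : R => (y <= a)%R%:R : R) = (\1_`]-oo, a] : R -> R).
    by apply/funext => y; rewrite indicE mem_setE in_itv.
  by apply: measurable_indic; exact: measurable_itv.
move=> y Iy; rewrite normrM; case: (y <= a); rewrite ?normr1 ?normr0 ?mul1r ?mul0r//.
exact: w_norm.
Qed.

(* Keeping only the part [y <= al] of the drift integral gives a lower bound
   whose shape [- corner al] does not depend on [u]: a single function is thus
   dominated by two eigenfunctions at once. *)
Lemma ground_growth u al be m x x' : ground w u -> nondecr u -> I al -> I be -> al < be ->
  m <= u be - u al -> I x -> I x' -> be <= x -> x <= x' ->
  m * (corner al x - corner al x') <= (2 - mu) * (u x' - u x).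
Proof.
move=> ug und Ial Ibe ab mu_ Ix Ix' bx xx'; have uL := ground_L2 ug.
case: ug => -[_ ue] _.
have uxx : 0 <= u x' - u x by rewrite subr_ge0 und.
have := Lop_increment uL Ix Ix'; rewrite !ue// => E.
have : J (fun y => (w x' y - w x y) * (u x' - u y)) <=
   J (fun y => (u x' - u x) + m * ((y <= al)%R%:R * w x' y - (y <= al)%R%:R * w x y)).
  apply: J_le; first exact: drift_intg.
    apply: intgD; first exact: intg_cst.
    by apply: intgZ; apply: intgB; exact: corner_intg.
  move=> y Iy; have [ya|ay] := leP y al; last by rewrite !mul0r subrr mulr0 addr0 drift_le.
  rewrite !mul1r; have H : w x' y - w x y <= 0.
    by rewrite subr_le0 rob_left//; apply: le_lt_trans ya _; apply: lt_le_trans bx.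
  have H2 : m <= u x' - u y.
    apply: (le_trans mu_); apply: lerB; first exact: und (le_trans bx xx').
    exact: und.
  have : (w x' y - w x y) * (u x' - u y) <= m * (w x' y - w x y).
    by rewrite mulrC -subr_ge0 -mulrBl mulr_le0// subr_le0.
  lra.
rewrite JD; [|exact: intg_cst|by apply: intgZ; apply: intgB; exact: corner_intg].
rewrite J_cst JZ; last by apply: intgB; exact: corner_intg.
rewrite JB; [|exact: corner_intg..].
rewrite -/(corner _ _) -/(corner _ _).
have /andP[d0 d1] := degree_01 Ix.
have : degree w x * (u x' - u x) <= u x' - u x by rewrite ler_piMl.
lra.
Qed.

(** (A2) at the endpoint [1] is the source of strictness. If [w 1 y = w be y], monotonicity makes
    [w t y] constant for [t] in [[be, 1]], and its one-sided derivative at [1] is zero. *)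
Lemma w_strict_at1 al be : I be -> 0 < al -> al < be -> be < 1 ->
  exists y, [/\ 0 < y, y < al, I y & w 1 y < w be y].
Proof.
move=> Ibe al0 ab b1; have I1 := I01_1 R.
(* The interval has positive measure, so the exceptional null set of (A2) cannot contain it. *)
have /= [y [y0 ya Iy]] : exists y, [/\ 0 < y, y < al, I y &
    exists l, l != 0 /\ has_deriv01 (fun t => w t y) 1 l].
  apply: contrapT => H; have := w_A2 I1.
  move=> [A [mA A0 NA]].
  have sA : `]0, al[ `<=` A.
    move=> y /=; rewrite in_itv /= => /andP[y0 ya]; apply: NA => /= Hy; apply: H.
    have Iy : I y by apply/andP; split; [exact: ltW|move/andP: Ibe => [_ ?]; lra].
    by exists y; split => //; exact: Hy.
  have : (@lebesgue_measure R `]0%R, al[ <= @lebesgue_measure R A)%E.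
    by apply: le_measure => //; rewrite inE//; exact: measurable_itv.
  rewrite lebesgue_measure_itv /= lte_fin al0 sube0 [X in (_ <= X)%E]A0 lee_fin.
  by rewrite leNgt al0.
move=> [l [l0 lH]]; exists y; split => //.
have ybe : y < be by apply: lt_trans ab.
have le1 t : I t -> be <= t -> w 1 y <= w t y /\ w t y <= w be y.
  move=> It bt; split; apply: rob_left => //; first by case/andP: It.
  exact: lt_le_trans bt.
rewrite lt_neqAle (le1 be Ibe (lexx _)).1 andbT; apply/negP => /eqP wE.
have wc t : I t -> be <= t -> w t y = w 1 y.
  move=> It bt; have [h1 h2] := le1 t It bt; apply/eqP; rewrite eq_le h1 andbT.
  by rewrite wE.
move/cvgrPdist_lt : lH => /(_ `|l|); rewrite normr_gt0 l0 => /(_ isT).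
rewrite /within /= => -[d /= d0 dH].
(* A step to the left, short enough for [1 + h] to stay in [[be, 1]] and in the neighbourhood given
   by the derivative. *)
pose h := - Num.min (d / 2) (1 - be).
have hpos : 0 < Num.min (d / 2) (1 - be) by rewrite lt_min divr_gt0//= subr_gt0.
have h1 : Num.min (d / 2) (1 - be) <= d / 2 by rewrite ge_min lexx.
have h2 : Num.min (d / 2) (1 - be) <= 1 - be by rewrite ge_min lexx orbT.
have be0 : 0 <= be by case/andP: Ibe.
have := dH h; rewrite /ball /= sub0r opprK gtr0_norm//.
have -> : Num.min (d / 2) (1 - be) < d by lra.
have I1h : I (1 + h) by apply/andP; rewrite /h; split; lra.
move=> /(_ isT); rewrite (wc (1 + h))//; last by rewrite /h; lra.
rewrite subrr mulr0 subr0 ltxx => H; suff : false by [].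
by apply: H; split => //; rewrite /h oppr_eq0 gt_eqF.
Qed.

Lemma corner_strict al be : I be -> 0 < al -> al < be -> be < 1 -> corner al 1 < corner al be.
Proof.
move=> Ibe al0 ab b1; have I1 := I01_1 R.
have [y0 [y0p y0a Iy0 wy0]] := w_strict_at1 Ibe al0 ab b1.
rewrite -subr_gt0 -JB; [|exact: corner_intg..].
pose e := (w be y0 - w 1 y0) / 2.
have e0 : 0 < e by rewrite divr_gt0// subr_gt0.
have hl : lip01 (K + K) (fun y => w be y - w 1 y) by apply: lipB; exact: w_lipr.
have [a [b [a0 ab' b1' H]]] := lip_near hl Iy0 e0.
have K0 := wK0 (wK := wK).
(* On [[y0, y0 + s]] the difference keeps at least half of its value at [y0], and the interval stays
   to the left of [al]. *)
pose s := Num.min (al - y0) (Num.min y0 (e / (K + K + 1))).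
have s0 : 0 < s.
  rewrite !lt_min subr_gt0 y0a y0p divr_gt0//; lra.
have s1 : s <= al - y0 by rewrite ge_min lexx.
have s2 : s <= y0 by rewrite !ge_min lexx orbT.
have s3 : (K + K) * s <= e.
  have : s <= e / (K + K + 1) by rewrite !ge_min lexx !orbT.
  rewrite ler_pdivlMr; last lra.
  by apply: le_trans; rewrite mulrC ler_wpM2l ?ltW//; lra.
have al1 : al <= 1 by lra.
apply: (@lt_le_trans _ _ (e * (y0 + s - y0))).
  by rewrite mulr_gt0//; lra.
apply: J_pos; [by apply: intgB; exact: corner_intg| |lra|lra|lra|exact: ltW|].
  move=> y Iy; rewrite -mulrBr; have [ya|_] := leP y al; rewrite ?mul0r// mul1r subr_ge0.
  by apply: rob_left => //; [exact: ltW|exact: le_lt_trans ab].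
move=> y /andP[y1 y2]; have -> : (y <= al)%R by lra.
have Iy : I y by apply/andP; split; lra.
rewrite !mul1r; have := hl y y0 Iy Iy0.
have : `|y - y0| <= s by rewrite ger0_norm; lra.
move=> /(ler_wpM2l (addr_ge0 K0 K0)) h1 h2.
have : `|w be y - w 1 y - (w be y0 - w 1 y0)| <= e by lra.
by rewrite ler_norml /e => /andP[]; lra.
Qed.

(** Moves the growth of [u] from the endpoints to an interior pair, since [corner_strict] requires
    [0 < al] and [be < 1]. *)
Lemma nondecr_inside L u : lip01 L u -> u 0 < u 1 ->
  exists2 s, 0 < s & forall t, 0 < t -> t <= s -> t < 1 / 2 /\ u t < u (1 - t).
Proof.
move=> ul u01; have L0 := lip_ge0 ul.
have d0 : 0 < u 1 - u 0 by rewrite subr_gt0.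
have L1 : 0 < 3 * (L + 1) by lra.
(* With this bound each end value moves by less than a third of [u 1 - u 0]. *)
exists (Num.min (1 / 3) ((u 1 - u 0) / (3 * (L + 1)))).
  by rewrite lt_min divr_gt0//= divr_gt0.
move=> t t0; rewrite le_min => /andP[t1 t2]; split; first lra.
have It : I t by apply/andP; split; lra.
have I1t : I (1 - t) by apply/andP; split; lra.
have := ul t 0 It (I01_0 R); have := ul (1 - t) 1 I1t (I01_1 R).
have -> : 1 - t - 1 = - t by ring.
rewrite normrN subr0 (gtr0_norm t0) !ler_norml => /andP[h1 _] /andP[_ h2].
have : L * t * 3 < u 1 - u 0.
  move: t2; rewrite ler_pdivlMr// => H; apply: lt_le_trans H.
  have -> : t * (3 * (L + 1)) = L * t * 3 + t * 3 by ring.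
  by rewrite ltrDl mulr_gt0.
lra.
Qed.

(* Otherwise [F + f] and [F - f] are both nonconstant and dominate a common
   nonconstant [z], so [F - z] dominates [f] and contradicts minimality of [F]. *)
Lemma ground_monotone f : ground w f -> nondecr f \/ nondecr (fun x => - f x).
Proof.
move=> fg; have [F [Fg Fd Fm]] := ground_total_variation fg.
have fL := ground_L2 fg; have FL := ground_L2 Fg.
have gr (s : R) : ground w (fun x => F x + s * f x).
  case: (fg) => -[[L fl] fe] fJ; case: (Fg) => -[[M Fl] Fe] FJ; split.
    split; first by eexists; exact: lipD Fl (lipZ s fl).
    by move=> x Ix; rewrite LopD ?LopZ ?fe ?Fe//; [ring|exact: L2Z].
  exact: J_lin.
have nd1 : nondecr (fun x => F x + 1 * f x).
  by move=> x y Ix Iy xy; have := Fd x y Ix Iy xy; rewrite ler_norml => /andP[]; lra.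
have nd2 : nondecr (fun x => F x + (-1) * f x).
  by move=> x y Ix Iy xy; have := Fd x y Ix Iy xy; rewrite ler_norml => /andP[]; lra.
have I0 := I01_0 R; have I1 := I01_1 R.
set u1 := fun x => _ in nd1; set u2 := fun x => _ in nd2.
have u1g : ground w u1 := gr 1; have u2g : ground w u2 := gr (-1).
have [e1|n1] := eqVneq (u1 0) (u1 1).
  right => x y Ix Iy xy.
  have := nd1 0 x I0 Ix; have := nd1 x y Ix Iy xy; have := nd1 y 1 Iy I1.
  have /andP[x0 x1] := Ix; have /andP[y0 y1] := Iy.
  move=> /(_ y1) h1 h2 /(_ x0) h3.
  have : u1 x = u1 y by lra.
  by have := Fd x y Ix Iy xy => /(le_trans (normr_ge0 _)); rewrite /u1; lra.
have [e2|n2] := eqVneq (u2 0) (u2 1).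
  left => x y Ix Iy xy.
  have := nd2 0 x I0 Ix; have := nd2 x y Ix Iy xy; have := nd2 y 1 Iy I1.
  have /andP[x0 x1] := Ix; have /andP[y0 y1] := Iy.
  move=> /(_ y1) h1 h2 /(_ x0) h3.
  have : u2 x = u2 y by lra.
  by have := Fd x y Ix Iy xy => /(le_trans (normr_ge0 _)); rewrite /u2; lra.
exfalso.
have u1l : u1 0 < u1 1 by rewrite lt_neqAle n1 nd1.
have u2l : u2 0 < u2 1 by rewrite lt_neqAle n2 nd2.
case: (u1g) => -[[L1 l1] _] _; case: (u2g) => -[[L2 l2] _] _.
have [s1 s10 H1] := nondecr_inside l1 u1l; have [s2 s20 H2] := nondecr_inside l2 u2l.
pose al := Num.min s1 s2; pose be := 1 - al.
have al0 : 0 < al by rewrite lt_min s10.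
have [al2 u1ab] : al < 1 / 2 /\ u1 al < u1 be by apply: H1; rewrite ?ge_min ?lexx.
have [_ u2ab] : al < 1 / 2 /\ u2 al < u2 be by apply: H2; rewrite ?ge_min ?lexx ?orbT.
have ab : al < be by rewrite /be; lra.
have Ial : I al by apply/andP; split; lra.
have Ibe : I be by apply/andP; rewrite /be; split; lra.
have be1 : be < 1 by rewrite /be; lra.
pose m := Num.min (u1 be - u1 al) (u2 be - u2 al).
have m0 : 0 < m by rewrite lt_min !subr_gt0 u1ab.
have mu20 : 0 < 2 - mu by have := mu2_lt1; lra.
(* [z] vanishes up to [be] and follows [- corner al] beyond it, with the factor that [ground_growth]
   supplies; [corner_strict] makes [z 1] positive. *)
pose z x := m / (2 - mu) * (corner al be - corner al (Num.max x be)).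
have zle u : ground w u -> nondecr u -> m <= u be - u al -> forall x y, I x -> I y -> x <= y ->
    z y - z x <= u y - u x.
  move=> ug und mu_ x y Ix Iy xy; rewrite /z -mulrBr mulrAC ler_pdivrMr//.
  rewrite [leRHS]mulrC.
  have mx t : I t -> I (Num.max t be) by move=> It; rewrite /Num.max; case: ifP.
  have E : corner al be - corner al (Num.max y be) - (corner al be - corner al (Num.max x be)) =
     corner al (Num.max x be) - corner al (Num.max y be) by ring.
  rewrite E; apply: (@le_trans _ _ ((2 - mu) * (u (Num.max y be) - u (Num.max x be)))).
    apply: (ground_growth (be := be)) => //; [exact: mx|exact: mx|by rewrite le_max lexx orbT|].
    by rewrite ge_max !le_max xy lexx orbT.
  rewrite ler_pM2l// /Num.max; case: ifP => yb; case: ifP => xb.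
  - by rewrite subrr subr_ge0 und.
  - by move: xb; rewrite (le_lt_trans xy yb).
  - by rewrite lerB// und// ltW.
  - by [].
have Gd : dominates (fun x => F x - z x) f.
  move=> x y Ix Iy xy.
  have := zle u1 u1g nd1 _ x y Ix Iy xy; rewrite ge_min lexx => /(_ isT).
  have := zle u2 u2g nd2 _ x y Ix Iy xy; rewrite ge_min lexx orbT => /(_ isT).
  by rewrite ler_norml /u1 /u2 => h1 h2; apply/andP; split; lra.
have := Fm _ Gd be 1 Ibe I1 (ltW be1).
have : 0 < z 1 - z be.
  have m1 : Num.max 1 be = 1 by rewrite (max_idPl _)// ltW.
  rewrite /z maxxx m1 -mulrBr mulr_gt0 ?divr_gt0//.
  have := corner_strict Ibe al0 ab be1; lra.
lra.
Qed.

Lemma nondecr_mean0_ends f : nondecr f -> f 0 = f 1 -> (exists L, lip01 L f) -> J f = 0 ->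
  forall x, I x -> f x = 0.
Proof.
move=> fnd f01 [L fl] fJ.
have fc x : I x -> f x = f 0.
  move=> Ix; have /andP[x0 x1] := Ix.
  by have := fnd 0 x (I01_0 R) Ix x0; have := fnd x 1 Ix (I01_1 R) x1; lra.
have : f 0 = 0 by rewrite -[LHS](J_cst (f 0)) -[RHS]fJ; apply: J_ext => x Ix; rewrite fc.
by move=> f00 x Ix; rewrite fc.
Qed.

Lemma ground_ends f : ground w f -> f 0 = f 1 -> forall x, I x -> f x = 0.
Proof.
move=> fg f01; case: (fg) => -[[L fl] _] fJ.
have [nd|nd] := ground_monotone fg.
  by apply: nondecr_mean0_ends => //; exists L.
move=> x Ix; apply/eqP; rewrite -oppr_eq0; apply/eqP.
apply: (nondecr_mean0_ends nd _ _ _ Ix); first by rewrite f01.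
  by exists L; move=> a b Ia Ib; rewrite -opprD normrN fl.
by rewrite JN ?fJ ?oppr0//; exact: L2_intg (ground_L2 fg).
Qed.

Lemma ground_lin a b f g : ground w f -> ground w g -> ground w (fun x => a * f x + b * g x).
Proof.
move=> fg gg; have fL := ground_L2 fg; have gL := ground_L2 gg.
case: fg => -[[L fl] fe] fJ; case: gg => -[[M gl] ge] gJ; split.
  split; first by eexists; exact: lipD (lipZ a fl) (lipZ b gl).
  by move=> x Ix; rewrite LopD ?LopZ ?fe ?ge//; [ring|exact: L2Z..].
by apply: J_lin => //; [exact: L2Z|rewrite JZ ?fJ ?mulr0//; exact: L2_intg].
Qed.

(** By [ground_ends], [g 1 - g 0] is a linear functional of [g] that is injective on ground
    states. *)
Lemma ground_simple f g : ground w f -> ground w g -> L2norm f = 1 ->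
  exists c, forall x, I x -> g x = c * f x.
Proof.
move=> fg gg f1.
have f01 : f 1 - f 0 != 0.
  apply/negP => /eqP H; have f0 : forall x, I x -> f x = 0 by apply: ground_ends => //; lra.
  move: f1; rewrite (L2norm_ext f0) L2norm_cst normr0 => /eqP.
  by rewrite eq_sym oner_eq0.
exists ((g 1 - g 0) / (f 1 - f 0)) => x Ix.
have := ground_ends (ground_lin (- (g 1 - g 0)) (f 1 - f 0) fg gg) _ Ix.
move=> H; have {}H : - (g 1 - g 0) * f x + (f 1 - f 0) * g x = 0 by apply: H; ring.
apply: (mulfI f01).
have -> : (f 1 - f 0) * ((g 1 - g 0) / (f 1 - f 0) * f x) = (g 1 - g 0) * f x by field.
lra.
Qed.

(** If [u] were constant on [[y, 1]], [ground_growth] would bound a positive multiple of the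
    decrease of [corner] by zero, against [corner_strict]. *)
Lemma ground_increasing_at1 u : ground w u -> nondecr u -> u 0 < u 1 -> forall y, I y -> y < 1 -> u y < u 1.
Proof.
move=> ug und u01 y Iy y1; rewrite lt_neqAle und ?ltW ?andbT//; last exact: I01_1.
apply/negP => /eqP uy1.
have [s s0 H] : exists2 s, 0 < s & forall t, 0 < t -> t <= s -> t < y /\ u t < u y.
  case: (ug) => -[[L ul] _] _; have [s s0 H] := nondecr_inside ul u01.
  have y0 : 0 < y.
    rewrite lt_neqAle; case/andP: Iy => -> _; rewrite andbT.
    by apply/eqP => y0; move: u01; rewrite -uy1 -y0 ltxx.
  exists (Num.min s (y / 2)); first by rewrite lt_min s0 divr_gt0.
  move=> t t0; rewrite le_min => /andP[ts ty]; have [h1 h2] := H t t0 ts.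
  split; first lra.
  rewrite uy1; apply: lt_le_trans h2 _; apply: und; [|exact: I01_1|lra].
  by apply/andP; split; lra.
have [sy usy] := H s s0 (lexx _).
have Is : I s by apply/andP; split; [exact: ltW|case/andP: Iy => _ ?; lra].
have us : 0 < u y - u s by rewrite subr_gt0.
have := ground_growth ug und Is Iy sy (lexx _) Iy (I01_1 R) (lexx _) (ltW y1).
rewrite uy1 subrr mulr0 pmulr_rle0 -?uy1//.
have := corner_strict Iy s0 sy y1; lra.
Qed.

(** The eigenvalue equation of a nondecreasing ground state [u] is read at [1]. There [u] is
    positive and exceeds all its earlier values, which first gives [mu >= 0]; then [degree w 1 > mu]
    shows that [w 1] is not zero to the left of [1], and the integral is strictly positive. *)
Lemma mu2_gt0 : 0 < mu.
Proof.
have [f0 [f0g f01]] := ground_ex.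
have [u [ug und u1]] : exists u, [/\ ground w u, nondecr u & L2norm u = 1].
  have [nd|nd] := ground_monotone f0g; first by exists f0.
  exists (fun x => - f0 x); split; [|exact: nd|].
    have := ground_lin (-1) 0 f0g f0g.
    have -> : (fun x => -1 * f0 x + 0 * f0 x) = (fun x => - f0 x).
      by apply/funext => x; rewrite mulN1r mul0r addr0.
    exact.
  by rewrite L2normN//; exact: ground_L2 f0g.
have I1 := I01_1 R; have I0 := I01_0 R; have uL := ground_L2 ug.
case: (ug) => -[[L ul] ue] uJ.
have u01 : u 0 < u 1.
  rewrite lt_neqAle und// andbT; apply/negP => /eqP H.
  have /L2norm_ext : forall x, I x -> u x = 0 by exact: ground_ends.
  by rewrite u1 L2norm_cst normr0 => /eqP; rewrite oner_eq0.
have inc := ground_increasing_at1 ug und u01.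
have u1pos : 0 < u 1.
  rewrite ltNge; apply/negP => u1n.
  have : 0 < J (fun y => u 1 - u y).
    apply: (@lip_J_gt0 _ (0 + L) _ 0) => //; first by apply: lipB => //; exact: lip_cst.
      by move=> y Iy; rewrite subr_ge0 und//; case/andP: Iy.
    by rewrite subr_gt0.
  by rewrite JB ?J_cst ?uJ; [lra|exact: intg_cst|exact: L2_intg].
have LE : mu * u 1 = J (fun y => w 1 y * (u 1 - u y)) by rewrite -ue.
have hl : exists M, lip01 M (fun y => w 1 y * (u 1 - u y)).
  eexists; apply: (lipM (w_lipr I1) (lipB (lip_cst (u 1)) ul) (B := 1) (C := `|u 1| + (`|u 0| + L))).
    by move=> y Iy; exact: w_norm.
  by move=> y Iy; apply: (le_trans (ler_normB _ _)); rewrite lerD2l; exact: lip_bnd ul Iy.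
have h0 y : I y -> 0 <= w 1 y * (u 1 - u y).
  move=> Iy; have /andP[w0 _] := kernel_01 I1 Iy.
  by rewrite mulr_ge0// subr_ge0 und//; case/andP: Iy.
have mu0 : 0 <= mu by rewrite -(pmulr_lge0 _ u1pos) LE J_ge0.
have [k k0 kd] := deg_gap.
have d1 : 0 < degree w 1 by have := kd 1 I1; lra.
have [y [Iy y1 wy]] : exists y, [/\ I y, y < 1 & 0 < w 1 y].
  apply: contrapT => H; move: d1; have -> : degree w 1 = J (fun=> 0); last by rewrite J_cst ltxx.
  have wz y : I y -> y < 1 -> w 1 y = 0.
    move=> Iy y1; apply/eqP; rewrite eq_le (andP (kernel_01 I1 Iy)).1 andbT leNgt.
    by apply/negP => wy; apply: H; exists y.
  have w11 : w 1 1 = 0.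
    have K0 := wK0 (wK := wK).
    apply/eqP; rewrite -normr_le0; apply/ler_addgt0Pr => e e0; rewrite add0r.
    pose s := Num.min (1 / 2) (e / (K + 1)).
    have s0 : 0 < s by rewrite lt_min !divr_gt0//; lra.
    have s1 : s <= 1 / 2 by rewrite ge_min lexx.
    have s2 : s <= e / (K + 1) by rewrite ge_min lexx orbT.
    have Is : I (1 - s) by apply/andP; split; lra.
    have := w_lipr I1 I1 Is; rewrite (wz _ Is) ?subr0; last lra.
    have -> : 1 - (1 - s) = s by ring.
    rewrite (gtr0_norm s0) => /le_trans; apply.
    move: s2; rewrite ler_pdivlMr; last lra.
    by apply: le_trans; rewrite mulrC ler_wpM2l ?ltW//; lra.
  apply: J_ext => y Iy; have [y1|] := ltP y 1; first exact: wz.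
  case/andP: (Iy) => _ y1 y1'; have -> : y = 1 by lra.
  exact: w11.
case: hl => M hl.
have : 0 < J (fun y => w 1 y * (u 1 - u y)).
  by apply: (lip_J_gt0 hl h0 Iy); rewrite mulr_gt0// subr_gt0 inc.
by rewrite -LE pmulr_lgt0.
Qed.

End Simplicity.

(** * Spectral gap *)

Section Spectrum.
Variable R : realType.
Implicit Types (f g u F G : R -> R) (x y c : R).
Local Notation I := (@I01 R).
Context (w : R -> R -> R) {K : R} {wK : lip_kernel w K}.
Hypothesis w_rob : robinsonian w.
Hypothesis w_A2 : A2 w.
Hypothesis w_A4 : A4 w.
Local Notation mu := (mu2 w).
Let deg_gap := @deg_gap R w K wK w_A4.
Let mu2_gt0 := @mu2_gt0 R w K wK w_rob w_A2 w_A4.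
Let ground_simple := @ground_simple R w K wK w_rob w_A2 w_A4.
Let ground_ex := @ground_ex R w K wK w_A4.
Let qform_ge0 := @qform_ge0 R w K wK.
Let mu2_le := @mu2_le R w K wK.
Let minimizing_cluster := @minimizing_cluster R w K wK w_A4.
Let eigen_regular := @eigen_regular R w K wK.
Let J_Lop := @J_Lop R w K wK.

Lemma ae01_of_I f g : (forall x, I x -> f x = g x) -> ae_eq01 f g.
Proof.
move=> fg; rewrite /ae_eq01; apply: (filterS (P := fun x => True)); last exact: filterT.
by move=> x _; exact: fg.
Qed.

Lemma le_of_forall_close (a : R) : (forall e, 0 < e -> `|a| <= e) -> a = 0.
Proof.
by move=> H; apply/eqP; rewrite -normr_le0; apply/ler_addgt0Pr => e e0; rewrite add0r H.
Qed.

Lemma inner_shift2 f h c : L2 f -> L2 h ->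
  inner (fun x => f x + c * h x) (fun x => f x + c * h x) =
  inner f f + 2 * c * inner h f + c ^+ 2 * inner h h.
Proof.
move=> fL hL; have cL := L2Z c hL; rewrite innerDl ?innerDr ?innerZl ?innerZr//; try exact: L2D.
by rewrite (innerC f h); ring.
Qed.

(** Without a gap, [minimizing_cluster] would produce a unit ground state orthogonal to [phi],
    contrary to [ground_simple]. *)
Lemma spectral_gap phi : ground w phi -> L2norm phi = 1 -> exists2 g, 0 < g &
  forall f, L2 f -> J f = 0 -> inner f phi = 0 -> g * inner f f <= qform w f f.
Proof.
move=> phig phi1; apply: contrapT => H.
have phiL := ground_L2 phig.
have /choice[fs fsP] : forall n : nat, exists f, [/\ L2 f, J f = 0, inner f phi = 0, inner f f = 1 &
    qform w f f <= n.+1%:R^-1].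
  move=> n; apply: contrapT => Hn; apply: H; exists n.+1%:R^-1; first by rewrite invr_gt0.
  move=> f fL fJ fphi; rewrite leNgt; apply/negP => lt; apply: Hn.
  have f0 : 0 < inner f f.
    rewrite lt_neqAle inner_ge0 andbT; apply/negP => /eqP f0.
    by have := qform_ge0 fL fJ; move: lt; rewrite -f0 mulr0; lra.
  have nf : L2norm f != 0 by rewrite -sqrf_eq0 L2norm2 gt_eqF.
  pose c := (L2norm f)^-1.
  have c2 : c ^+ 2 = (inner f f)^-1 by rewrite exprVn L2norm2.
  have cL := L2Z c fL.
  exists (fun x => c * f x); split => //.
  - by rewrite JZ ?fJ ?mulr0//; exact: L2_intg.
  - by rewrite innerZl// fphi mulr0.
  - by rewrite innerZl ?innerZr// mulrA -expr2 c2 mulVf// gt_eqF.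
  - rewrite qformZl// (qformC fL cL) qformZl// mulrA -expr2 c2 mulrC ler_pdivrMr//.
    exact: ltW.
have fL n : L2 (fs n) by case: (fsP n).
have [|||h [hg h1 hc]] := minimizing_cluster fL.
- by move=> n; case: (fsP n).
- by move=> n; case: (fsP n) => _ _ _; rewrite /L2norm => ->; rewrite sqrtr1.
- move=> e e0; have [m Hm] := inv_nat_le e0; exists m => n mn.
  by case: (fsP n) => _ _ _ _ /le_trans; apply; exact: Hm.
have hL := ground_L2 hg.
have [c hphi] := ground_simple phig hg phi1.
have hp0 : inner h phi = 0.
  apply: le_of_forall_close => e e0; have [n _ Hn] := hc e e0 0%N.
  have -> : inner h phi = - inner (fun x => fs n x - h x) phi.
    by rewrite innerBl//; case: (fsP n) => _ _ -> _ _; ring.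
  rewrite normrN; apply: (le_trans (inner_CS _ phiL)); first exact: L2B.
  by rewrite phi1 mulr1.
have c0 : c = 0.
  have : inner h phi = c * inner phi phi.
    by rewrite -innerZl//; apply: inner_ext.
  by rewrite hp0 -L2norm2 phi1 expr1n mulr1.
move: h1; rewrite (L2norm_ext (g := fun=> 0)); last by move=> x Ix; rewrite hphi// c0 mul0r.
by rewrite L2norm_cst normr0 => /eqP; rewrite eq_sym oner_eq0.
Qed.

(** * Solving the resolvent equation orthogonally to two eigenfunctions *)

Section Solve.
Variables (e1 e2 : R -> R) (n1 n2 nu k kap : R).
Hypotheses (e1L : L2 e1) (e2L : L2 e2).
Hypotheses (e1E : forall x, I x -> Lop w e1 x = n1 * e1 x) (e2E : forall x, I x -> Lop w e2 x = n2 * e2 x).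
Hypotheses (k0 : 0 < k) (kd : forall x, I x -> k <= degree w x - nu).
Let V f := [/\ L2 f, inner f e1 = 0 & inner f e2 = 0].
Hypotheses (kap0 : 0 < kap)
  (coercive : forall f, V f -> kap * inner f f <= inner (Lop w f) f - nu * inner f f).

Let B f : R -> R := fun x => Lop w f x - nu * f x.

Let BL f : L2 f -> L2 (B f).
Proof. by move=> fL; apply: L2B; [exact: Lop_L2|exact: L2Z]. Qed.

Let inner_Lop_eigen f e n : L2 f -> L2 e -> (forall x, I x -> Lop w e x = n * e x) ->
  inner (Lop w f) e = n * inner f e.
Proof. by move=> fL eL eE; rewrite Lop_sym// (inner_ext (f' := f) (g' := fun x => n * e x))// innerZr. Qed.

Let VB f : V f -> V (B f).
Proof.
move=> [fL f1 f2]; split; first exact: BL.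
  by rewrite innerBl ?innerZl ?(inner_Lop_eigen fL e1L e1E) ?f1 ?mulr0 ?subrr//; [exact: Lop_L2|exact: L2Z].
by rewrite innerBl ?innerZl ?(inner_Lop_eigen fL e2L e2E) ?f2 ?mulr0 ?subrr//; [exact: Lop_L2|exact: L2Z].
Qed.

Let Vlin f g c : V f -> V g -> V (fun x => f x + c * g x).
Proof.
move=> [fL f1 f2] [gL g1 g2]; have cL := L2Z c gL; split; first exact: L2D.
  by rewrite innerDl ?innerZl// f1 g1 mulr0 addr0.
by rewrite innerDl ?innerZl// f2 g2 mulr0 addr0.
Qed.

Let inner_B f : L2 f -> inner (B f) f = inner (Lop w f) f - nu * inner f f.
Proof. by move=> fL; rewrite innerBl ?innerZl//; [exact: Lop_L2|exact: L2Z]. Qed.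

Let Bnorm f : L2 f -> L2norm (B f) <= (2 + `|nu|) * L2norm f.
Proof.
move=> fL; apply: (le_trans (L2normB (Lop_L2 fL) (L2Z nu fL))).
by rewrite mulrDl L2normZ// lerD2r Lop_norm.
Qed.

(* Richardson iteration; its residuals vanish and its iterates stay bounded, so
   [resolvent_cluster] supplies the limit without completeness of L2. *)
Lemma solve_coercive g : V g -> exists2 f, L2 f & forall x, I x -> Lop w f x - nu * f x = g x.
Proof.
move=> Vg; have gL : L2 g by case: Vg.
(* [2 + |nu|] bounds the norm of [B]; adding [kap] keeps [q] nonnegative. The step [t] minimizes the
   contraction factor [1 - 2 t kap + t^2 M^2] of the squared residual, and [q] is that minimum. *)
pose M := 2 + `|nu| + kap; have M0 : 0 < M by rewrite /M ltr_wpDl// addr_ge0.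
pose t := kap / M ^+ 2; pose q := 1 - (kap / M) ^+ 2.
have kM0 : 0 < kap / M by rewrite divr_gt0.
have kM1 : kap / M <= 1 by rewrite ler_pdivrMr// mul1r /M lerDr addr_ge0.
have q0 : 0 <= q by rewrite /q subr_ge0 exprn_ile1// ltW.
have q1 : q < 1 by rewrite /q ltrBlDr ltrDl exprn_gt0.
pose res f : R -> R := fun x => g x - B f x.
pose step f : R -> R := fun x => f x + t * res f x.
pose s n := iter n step (fun=> 0).
have Vres f : V f -> V (res f).
  move=> Vf; have [BL' b1 b2] := VB Vf; case: Vg => _ g1 g2.
  by split; [exact: L2B|rewrite innerBl// b1 g1 subrr|rewrite innerBl// b2 g2 subrr].
have V0 : V (fun=> 0).
  by split; [exact: L2_cst|..]; rewrite -[RHS](J_cst 0); apply: J_ext => x _; rewrite mul0r.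
have Vs n : V (s n) by elim: n => [//|n IH]; apply: Vlin => //; exact: Vres.
have sL n : L2 (s n) by case: (Vs n).
have resL n : L2 (res (s n)) by case: (Vres _ (Vs n)).
have resS n x : I x -> res (s n.+1) x = res (s n) x + (- t) * B (res (s n)) x.
  move=> Ix; rewrite {1}/res /s iterS -/(s n) /step /B LopD//; last exact: L2Z.
  by rewrite LopZ// /res /B; ring.
pose rr n := inner (res (s n)) (res (s n)).
have rrS n : rr n.+1 <= q * rr n.
  have Vr := Vres _ (Vs n); set r := res (s n) in Vr *; have rL : L2 r by case: Vr.
  have BrL := BL rL; have tBrL := L2Z (- t) BrL.
  have -> : rr n.+1 = rr n - 2 * t * inner (B r) r + t ^+ 2 * inner (B r) (B r).
    rewrite /rr (inner_ext (resS n) (resS n)) -/r.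
    by rewrite inner_shift2//; ring.
  have h1 : kap * rr n <= inner (B r) r by rewrite inner_B// coercive.
  have h2 : inner (B r) (B r) <= M ^+ 2 * rr n.
    rewrite /rr -/r -!L2norm2 -exprMn lerXn2r ?nnegrE ?mulr_ge0 ?L2norm_ge0 ?(ltW M0)//.
    apply: (le_trans (Bnorm rL)); rewrite ler_wpM2r ?L2norm_ge0//.
    by rewrite /M lerDl ltW.
  have t0 : 0 <= t by rewrite /t divr_ge0 ?exprn_ge0 ?ltW.
  have h3 : t * (kap * rr n) <= t * inner (B r) r by rewrite ler_wpM2l.
  have h4 : t ^+ 2 * inner (B r) (B r) <= t ^+ 2 * (M ^+ 2 * rr n) by rewrite ler_wpM2l ?sqr_ge0.
  have tM : t ^+ 2 * (M ^+ 2 * rr n) = t * kap * rr n by rewrite /t; field; rewrite gt_eqF.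
  have -> : q * rr n = rr n - t * kap * rr n by rewrite /q /t; field; rewrite gt_eqF.
  lra.
have rrn n : rr n <= q ^+ n * rr 0%N.
  elim: n => [|n IH]; first by rewrite expr0 mul1r.
  by rewrite exprS -mulrA (le_trans (rrS n))// ler_wpM2l.
have rr0 : 0 <= rr 0%N by exact: inner_ge0.
have rr1 n : rr n <= rr 0%N.
  by apply: (le_trans (rrn n)); rewrite ler_piMl// exprn_ile1// ltW.
have [||f [fL fE _]] := @resolvent_cluster R w K wK nu k k0 kd s g
    (kap^-1 * (L2norm g + Num.sqrt (rr 0%N))) sL _ gL _.
- move=> n; rewrite ler_pdivlMl//.
  have h1 : L2norm (B (s n)) <= L2norm g + Num.sqrt (rr 0%N).
    rewrite (L2norm_ext (g := fun x => g x - res (s n) x)); last by move=> x _; rewrite /res; ring.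
    apply: (le_trans (L2normB gL (resL n))); rewrite lerD2l.
    by rewrite /L2norm ler_sqrt ?rr1 ?inner_ge0.
  apply: le_trans h1.
  have := L2norm_ge0 (s n); rewrite le_eqVlt => /predU1P[<-|s0].
    by rewrite mulr0 L2norm_ge0.
  rewrite -(ler_pM2r s0) -mulrA -expr2 L2norm2.
  apply: (le_trans (coercive (Vs n))); rewrite -inner_B//.
  by apply: (le_trans (ler_norm _)); exact: inner_CS (BL _) _.
- move=> e e0.
  have := @cvg_expr R q; rewrite ger0_norm// => /(_ q1) /cvgrPdist_le.
  move=> /(_ (e ^+ 2 / (rr 0%N + 1))) [|m _ Hm].
    by rewrite divr_gt0 ?exprn_gt0// ltr_wpDl.
  exists m => n mn; apply: L2norm_le; first exact: ltW.
  have -> : inner (fun x => Lop w (s n) x - nu * s n x - g x) (fun x => Lop w (s n) x - nu * s n x - g x) = rr n.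
    by apply: J_ext => x _; rewrite /res /B; ring.
  apply: (le_trans (rrn n)); have := Hm n mn.
  rewrite sub0r normrN ger0_norm ?exprn_ge0// ler_pdivlMr; last by rewrite ltr_wpDl.
  by apply: le_trans; rewrite ler_wpM2l ?exprn_ge0// lerDl.
by exists f.
Qed.
End Solve.

(** L is multiplication by [degree w] minus the compact [W w]. Keeping [nu] below the range of
    [degree w] makes the first part invertible; the gap then leaves [0] and [mu] as the only
    obstructions. *)
Lemma resolvent_below phi (g nu : R) : ground w phi -> L2norm phi = 1 -> 0 < g ->
  (forall f, L2 f -> J f = 0 -> inner f phi = 0 -> g * inner f f <= qform w f f) ->
  nu < mu + g -> (exists2 k, 0 < k & forall x, I x -> k <= degree w x - nu) ->
  nu != 0 -> nu != mu -> resolvent w nu.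
Proof.
move=> phig phi1 g0 gap nug [k k0 kd] nu0 numu.
have phiL := ground_L2 phig; case: (phig) => -[_ phiE] phiJ.
have phi2 : inner phi phi = 1 by rewrite -L2norm2 phi1 expr1n.
have coer f : [/\ L2 f, inner f (fun=> 1) = 0 & inner f phi = 0] ->
    (mu + g - nu) * inner f f <= inner (Lop w f) f - nu * inner f f.
  move=> [fL f1 f2]; rewrite inner1 in f1.
  by have := gap f fL f1 f2; rewrite /qform; lra.
have oneE x : I x -> Lop w (fun=> 1) x = 0 * 1 by rewrite Lop_cst mul0r.
have k2 : 0 < mu + g - nu by lra.
split.
(* The components of [h] along [1] and [phi] are inverted explicitly, by [- 1 / nu] and
   [1 / (mu - nu)]; [solve_coercive] handles the remainder [h']. *)
- move=> h hL; pose a := J h; pose b := inner h phi.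
  pose h' x := h x - (a + b * phi x).
  have pL : L2 (fun x => a + b * phi x) by apply: L2D; [exact: L2_cst|exact: L2Z].
  have h'V : [/\ L2 h', inner h' (fun=> 1) = 0 & inner h' phi = 0].
    split; first exact: L2B.
      rewrite inner1 JB; [|exact: L2_intg..].
      rewrite JD; [|exact: intg_cst|by apply: intgZ; exact: L2_intg].
      by rewrite J_cst JZ ?phiJ; [rewrite /a; ring|exact: L2_intg].
    rewrite innerBl// innerDl ?innerZl//; [|exact: L2_cst|exact: L2Z].
    have -> : inner (fun=> a) phi = 0.
      by rewrite -[LHS]/(J (fun x => a * phi x)) JZ ?phiJ ?mulr0//; exact: L2_intg.
    by rewrite phi2 /b; ring.
  have [f fL fE] := solve_coercive (L2_cst 1) phiL oneE phiE k0 kd k2 coer h'V.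
  pose v x := (mu - nu)^-1 * b * phi x + f x.
  have vL : L2 v by apply: L2D => //; exact: L2Z.
  exists (fun x => - a / nu + v x); split; first by apply: L2D => //; exact: L2_cst.
  apply: ae01_of_I => x Ix; rewrite LopD// ?Lop_cst; last exact: L2_cst.
  rewrite /v LopD ?LopZ ?phiE//; last exact: L2Z.
  have -> : Lop w f x = h' x + nu * f x by rewrite -fE//; ring.
  have mn : mu - nu != 0 by rewrite subr_eq0 eq_sym.
  by rewrite /h'; field; rewrite ?nu0 ?mn.
- move=> f fL fe.
  have fe' : ae_eq01 (Lop w f) (fun x => nu * f x).
    by rewrite /ae_eq01; apply: filterS fe => x /= H Ix; have := H Ix; lra.
  have key e n : L2 e -> (forall x, I x -> Lop w e x = n * e x) -> nu != n -> inner f e = 0.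
    move=> eL eE nun; have : inner (Lop w f) e = nu * inner f e.
      by rewrite -innerZl//; apply: inner_ae => //; [exact: Lop_L2|exact: L2Z].
    rewrite Lop_sym// (inner_ext (f' := f) (g' := fun x => n * e x))// innerZr//.
    move=> /eqP; rewrite -subr_eq0 -mulrBl mulf_eq0 subr_eq0 eq_sym (negPf nun) /=.
    by move=> /eqP.
  have f1 := key _ _ (L2_cst 1) oneE nu0; have f2 := key _ _ phiL phiE numu.
  have := coer f (And3 fL f1 f2).
  have -> : inner (Lop w f) f = nu * inner f f.
    by rewrite -innerZl//; apply: inner_ae => //; [exact: Lop_L2|exact: L2Z].
  rewrite subrr pmulr_rle0// => H; apply: L2norm_eq0_ae => //.
  by apply/eqP; rewrite -sqrf_eq0 L2norm2 eq_le H inner_ge0.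
Qed.

Lemma lambda2_mu2 lam : lambda2 w lam -> lam = mu.
Proof.
have mu0 := mu2_gt0.
have [phi [phig phi1]] := ground_ex; have [g g0 gap] := spectral_gap phig phi1.
have [k k0 kd] := deg_gap; have phiL := ground_L2 phig; case: (phig) => -[_ phiE] phiJ.
have phi2 : inner phi phi = 1 by rewrite -L2norm2 phi1 expr1n.
(* Below [mu + e0] both the gap and the distance to the range of [degree w] are available, so [0]
   and [mu] are the only spectral values there. *)
pose e0 := Num.min g k.
have e00 : 0 < e0 by rewrite lt_min g0.
have below nu : nu < mu + e0 -> ~ resolvent w nu -> nu = 0 \/ nu = mu.
  move=> nue nr; have [->|n0] := eqVneq nu 0; first by left.
  have [->|n1] := eqVneq nu mu; first by right.
  exfalso; apply: nr; apply: (resolvent_below phig phi1 g0 gap) => //.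
    by apply: (lt_le_trans nue); rewrite lerD2l ge_min lexx.
  exists (k - (nu - mu)).
    by have : e0 <= k by [rewrite ge_min lexx orbT]; lra.
  by move=> x Ix; have := kd x Ix; lra.
have not_ae0 f : inner f f = 1 -> L2 f -> ~ ae_eq01 f (fun=> 0).
  move=> f1 fL H; have : inner f f = inner (fun=> 0) f by apply: inner_ae => //; exact: L2_cst.
  have -> : inner (fun=> 0) f = 0 by rewrite -[RHS](J_cst 0); apply: J_ext => x _; rewrite mul0r.
  by rewrite f1 => /eqP; rewrite oner_eq0.
have eig_nores nu f : eigenfun w nu f -> ~ resolvent w nu.
  move=> [fL [nf fe]] [_ inj]; apply: nf; apply: inj => //.
  by rewrite /ae_eq01; apply: filterS fe => x /= H Ix; rewrite H// subrr.
have reg nu f : nu < mu + e0 -> L2 f -> ae_eq01 (Lop w f) (fun x => nu * f x) ->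
   exists f', eigenlip w nu f' /\ ae_eq01 f f'.
  move=> nue fL fe.
  have k'0 : 0 < k - (nu - mu).
    by have : e0 <= k by [rewrite ge_min lexx orbT]; lra.
  have kd' x : I x -> k - (nu - mu) <= degree w x - nu by move=> Ix; have := kd x Ix; lra.
  by have [f' [a b c]] := eigen_regular k'0 kd' fL fe; exists f'.
have D0 : discrete_eigenvalue w 0.
  split; last split.
  - exists (fun=> 1); split; first exact: L2_cst.
    split; first by apply: not_ae0; [rewrite inner1 J_cst|exact: L2_cst].
    by apply: ae01_of_I => x _; rewrite Lop_cst mul0r.
  - exists 1%N, (fun _ _ => 1); split; first by move=> _; exact: L2_cst.
    move=> f fL fe; have [|f' [[[L f'l] f'e] ff']] := reg 0 f _ fL fe; first by rewrite addr_gt0.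
    exists (fun=> J f').
    have f'L := lip_L2 f'l.
    have hl := lipB f'l (lip_cst (J f')).
    have hJ : J (fun x => f' x - J f') = 0 by rewrite JB ?J_cst ?subrr//; [exact: L2_intg|exact: intg_cst].
    have hL := lip_L2 hl.
    (* The centred part of a null function has zero Rayleigh quotient, which [mu > 0] forbids unless
       it vanishes. *)
    have h0 : inner (fun x => f' x - J f') (fun x => f' x - J f') = 0.
      apply/eqP; rewrite eq_le inner_ge0 andbT -(pmulr_rle0 _ mu0).
      apply: (le_trans (mu2_le hL hJ)).
      rewrite (inner_ext (f' := fun=> 0) (g' := fun x => f' x - J f'))//.
        by rewrite -[leRHS](J_cst 0) le_eqVlt; apply/orP; left; apply/eqP/J_ext => x _; rewrite mul0r.
      by move=> x Ix; rewrite LopB ?Lop_cst ?f'e//; [ring|exact: L2_cst].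
    have hn : L2norm (fun x => f' x - J f') = 0 by rewrite /L2norm h0 sqrtr0.
    rewrite /ae_eq01; apply: filterS ff' => x /= H Ix; rewrite H// big_ord_recl big_ord0 addr0 mulr1.
    by have := lip_norm0 hl hn Ix; lra.
  - exists mu; split => // nu nr; rewrite subr0 => lt.
    have nu1 : nu < mu + e0 by apply: (le_lt_trans (ler_norm _)); lra.
    have [//|E] := below _ nu1 nr; by move: lt; rewrite E gtr0_norm// ltxx.
have Dmu : discrete_eigenvalue w mu.
  split; last split.
  - exists phi; split => //; split; first exact: not_ae0.
    exact: ae01_of_I.
  - exists 1%N, (fun _ => phi); split => // f fL fe.
    have [|f' [f'eig ff']] := reg mu f _ fL fe; first lra.
    case: (f'eig) => -[L f'l] f'e; have f'L := lip_L2 f'l.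
    have f'J : J f' = 0.
      have : mu * J f' = 0.
        rewrite -JZ; last exact: L2_intg.
        by rewrite -(J_Lop f'L); apply: J_ext => x Ix; rewrite f'e.
      by move/eqP; rewrite mulf_eq0 gt_eqF//= => /eqP.
    have [c fc] := ground_simple phig (conj f'eig f'J) phi1.
    exists (fun=> c); rewrite /ae_eq01; apply: filterS ff' => x /= H Ix.
    by rewrite H// big_ord_recl big_ord0 addr0 fc.
  - exists (Num.min mu e0); split; first by rewrite lt_min mu0.
    move=> nu nr; rewrite lt_min => /andP[lt1 lt2].
    have nu1 : nu < mu + e0 by have := ler_norm (nu - mu); lra.
    have [E|//] := below _ nu1 nr; by move: lt1; rewrite E sub0r normrN gtr0_norm// ltxx.
move=> [Dlam [m' [Dm' [m'lt Hm']]]].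
(* Below [mu] the only candidate is [0], with no smaller eigenvalue left for [m']; above [mu], both
   [0] and [mu] would have to equal the unique smaller eigenvalue [m']. *)
have [lt|gt|//] := ltgtP lam mu.
  have [f fe] := Dlam.1; have [h he] := Dm'.1.
  have [E|E] : lam = 0 \/ lam = mu by apply: below (eig_nores _ _ fe); lra.
    have [E'|E'] : m' = 0 \/ m' = mu by apply: below (eig_nores _ _ he); lra.
      by move: m'lt; rewrite E E' ltxx.
    by move: m'lt; rewrite E E'; lra.
  by move: lt; rewrite E ltxx.
have E1 := Hm' _ Dmu gt; have E2 : 0 = m' by apply: Hm' => //; lra.
by move: mu0; rewrite E1 E2 ltxx.
Qed.

Lemma fiedler_ground phi : fiedler_function w phi -> L2norm phi = 1 ->
  L2 phi /\ exists phi', [/\ ground w phi', L2norm phi' = 1 & ae_eq01 phi phi'].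
Proof.
move=> [lam [/lambda2_mu2 -> [phiL [_ phie]]]] phi1; split => //.
have [k k0 kd] := deg_gap.
have [phi' [[L pl] p'e pp']] := eigen_regular k0 kd phiL phie.
have pL := lip_L2 pl.
exists phi'; split => //.
  split; first by split => //; exists L.
  have : mu * J phi' = 0.
    rewrite -JZ; last exact: L2_intg.
    by rewrite -(J_Lop pL); apply: J_ext => x Ix; rewrite p'e.
  by move/eqP; rewrite mulf_eq0 gt_eqF//= => /eqP.
rewrite -phi1 /L2norm; congr Num.sqrt.
by rewrite (inner_ae phiL pL phiL pp') (innerC phi') (inner_ae phiL pL pL pp').
Qed.

End Spectrum.

(** * Perturbation of the Fiedler vector *)

Section Dot.
Variables (R : realType) (N : nat).
Implicit Types (u v t : 'rV[R]_N) (S : 'M[R]_N).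

Definition dot u v : R := \sum_k u 0 k * v 0 k.
Definition rsum u : R := \sum_k u 0 k.

Lemma dotC u v : dot u v = dot v u.
Proof. by apply: eq_bigr => k _; rewrite mulrC. Qed.

Lemma dotDl u v t : dot (u + v) t = dot u t + dot v t.
Proof. by rewrite /dot -big_split; apply: eq_bigr => k _; rewrite mxE mulrDl. Qed.

Lemma dotZl (c : R) u v : dot (c *: u) v = c * dot u v.
Proof. by rewrite /dot mulr_sumr; apply: eq_bigr => k _; rewrite mxE mulrA. Qed.

Lemma dotNl u v : dot (- u) v = - dot u v.
Proof. by rewrite -scaleN1r dotZl mulN1r. Qed.

Lemma dotBl u v t : dot (u - v) t = dot u t - dot v t.
Proof. by rewrite dotDl dotNl. Qed.

Lemma dotDr u v t : dot t (u + v) = dot t u + dot t v.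
Proof. by rewrite dotC dotDl !(dotC t). Qed.

Lemma dotZr (c : R) u v : dot v (c *: u) = c * dot v u.
Proof. by rewrite dotC dotZl !(dotC v). Qed.

Lemma dot_ge0 u : 0 <= dot u u.
Proof. by apply: sumr_ge0 => k _; rewrite -expr2 sqr_ge0. Qed.

Lemma dot_eq0 u : dot u u = 0 -> u = 0.
Proof.
move=> /eqP; rewrite psumr_eq0 => [/allP H|k _]; last by rewrite -expr2 sqr_ge0.
apply/rowP => k; have := H k; rewrite mem_index_enum => /(_ isT) /=.
by rewrite mulf_eq0 orbb mxE => /eqP.
Qed.

Lemma dot_gt0 u : u != 0 -> 0 < dot u u.
Proof.
move=> u0; rewrite lt_neqAle dot_ge0 andbT eq_sym; apply: contra u0 => /eqP H.
by apply/eqP/dot_eq0.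
Qed.

Lemma dot_mulmx S u v : S^T = S -> dot (u *m S) v = dot u (v *m S).
Proof.
move=> Ssym; rewrite /dot.
under eq_bigr do rewrite mxE mulr_suml.
under [RHS]eq_bigr do rewrite mxE mulr_sumr.
rewrite exchange_big; apply: eq_bigr => i _; apply: eq_bigr => j _.
by rewrite -{1}Ssym mxE; ring.
Qed.

Lemma rsum_dot u : rsum u = dot u (const_mx 1).
Proof. by apply: eq_bigr => k _; rewrite mxE mulr1. Qed.

Lemma rsumZ (c : R) u : rsum (c *: u) = c * rsum u.
Proof. by rewrite !rsum_dot dotZl. Qed.

Lemma rsum_lin u v (c : R) : rsum (u + c *: v) = rsum u + c * rsum v.
Proof. by rewrite !rsum_dot dotDl dotZl. Qed.

Lemma quad_continuous S : continuous (fun u => dot (u *m S) u).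
Proof.
have E : (fun u => dot (u *m S) u) = (fun u : 'rV[R]_N => \sum_k \sum_j (u 0 j * S j k * u 0 k)).
  by apply/funext => u; apply: eq_bigr => k _; rewrite mxE mulr_suml.
rewrite E; apply: continuous_big => [|k _]; first exact: add_continuous.
apply: continuous_big => [|j _]; first exact: add_continuous.
move=> u; apply: (@continuousM R 'rV[R]_N (fun u => u 0 j * S j k) (fun u => u 0 k)).
  apply: (@continuousM R 'rV[R]_N (fun u => u 0 j) (fun=> S j k)); last exact: cst_continuous.
  exact: coord_continuous.
exact: coord_continuous.
Qed.

Lemma rsum_continuous : continuous rsum.
Proof.
apply: continuous_big => [|k _]; first exact: add_continuous.
exact: coord_continuous.
Qed.

(** The form attains its minimum on the compact unit sphere of the sum-zero hyperplane. The residual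
    [h] of the minimizer remains in this hyperplane because [S] is symmetric and annihilates
    constants. *)
Lemma rayleigh_eigenvector S t : S^T = S -> (const_mx 1 : 'rV[R]_N) *m S = 0 ->
  rsum t = 0 -> t != 0 ->
  exists u kap, [/\ u != 0, rsum u = 0, u *m S = kap *: u & kap * dot t t <= dot (t *m S) t].
Proof.
move=> Ssym S1 tt t0.
pose A : set 'rV[R]_N := [set u | dot u u = 1 /\ rsum u = 0].
have normA u : u != 0 -> rsum u = 0 -> A ((Num.sqrt (dot u u))^-1 *: u).
  move=> u0 ut; split; last by rewrite rsumZ ut mulr0.
  rewrite dotZl dotZr mulrA -expr2 exprVn sqr_sqrtr ?dot_ge0// mulVf// gt_eqF//.
  exact: dot_gt0.
have A0 : A !=set0 by eexists; exact: normA t0 tt.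
have Acl : closed A.
  have -> : A = (fun u => dot (u *m 1%:M) u) @^-1` [set x | x = 1] `&` rsum @^-1` [set x | x = 0].
    by apply/seteqP; split => u /=; rewrite mulmx1.
  apply: closedI; apply: preimage_closed.
  - by move=> u _; exact: quad_continuous.
  - exact: closed_eq.
  - by move=> u _; exact: rsum_continuous.
  - exact: closed_eq.
have Ac : compact A.
  apply: (subclosed_compact Acl (@rV_compact R N (fun=> `[(- 1), 1]%classic) _)).
    by move=> _; exact: segment_compact.
  move=> u [u1 _] k /=; rewrite in_itv /= -ler_norml.
  rewrite -(@ler_pXn2r _ 2)// ?nnegrE// expr1n real_normK ?num_real// -u1.
  rewrite /dot (bigD1 k)//= -expr2 lerDl.
  by apply: sumr_ge0 => i _; rewrite -expr2 sqr_ge0.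
have [u /set_mem [u1 ut] umin] := EVT_min_rV A0 Ac (continuous_subspaceT (@quad_continuous S)).
pose kap := dot (u *m S) u; pose p a b := dot (a *m S) b - kap * dot a b.
have u0 : u != 0.
  apply/negP => /eqP E; move: u1; rewrite E /dot big1 => [/esym/eqP|k _].
    by rewrite oner_eq0.
  by rewrite mxE mul0r.
have p0 a : rsum a = 0 -> 0 <= p a a.
  move=> at0; have [->|a0] := eqVneq a 0.
    by rewrite /p mul0mx -(scale0r (0 : 'rV[R]_N)) !dotZl mul0r mulr0 subrr.
  have := umin _ (mem_set (normA a a0 at0)).
  rewrite -scalemxAl dotZl dotZr mulrA -expr2 exprVn sqr_sqrtr ?dot_ge0//.
  by rewrite ler_pdivlMl ?dot_gt0// -/kap /p subr_ge0 mulrC.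
have puu : p u u = 0 by rewrite /p u1 mulr1 subrr.
have pC a b : p a b = p b a by rewrite /p dot_mulmx// (dotC a b) (dotC a).
have pDl a b c (s : R) : p (a + s *: b) c = p a c + s * p b c.
  by rewrite /p mulmxDl -scalemxAl !dotDl !dotZl; ring.
have tS a : rsum (a *m S) = 0.
  by rewrite rsum_dot dot_mulmx// S1 /dot big1// => k _; rewrite mxE mulr0.
pose h := u *m S - kap *: u.
have ht : rsum h = 0 by rewrite /h -scaleNr rsum_lin tS ut mulr0 addr0.
have ph : p u h = dot h h by rewrite /p {3}/h dotBl dotZl.
(* [p] is semidefinite on the hyperplane and [p u u = 0], so Cauchy-Schwarz forces [p u h = 0],
   which is the squared norm of [h]. *)
have h0 : h = 0.
  apply: dot_eq0; rewrite -ph; apply/eqP; rewrite -sqrf_eq0 eq_le sqr_ge0 andbT.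
  rewrite -(mul0r (p h h)) -puu; apply: quad_disc => s.
  have := p0 (u + s *: h); rewrite rsum_lin ut ht mulr0 addr0 => /(_ erefl).
  rewrite pDl (pC u) (pC h) !pDl (pC h u).
  by congr (_ <= _); ring.
exists u, kap; split => //.
  by apply/eqP; rewrite -subr_eq0 -/h h0.
by have := p0 t tt; rewrite /p subr_ge0.
Qed.

(** Excludes a double lowest eigenvalue of the graph Laplacian: by dimension, its eigenspace would
    meet the sum-zero hyperplane. *)
Lemma rank2_rsum0 (E : 'M[R]_N) : (2 <= \rank E)%N ->
  exists u, [/\ (u <= E)%MS, u != 0 & rsum u = 0].
Proof.
move=> rE; pose o : 'cV[R]_N := const_mx 1.
have ro : (\rank (kermx o) >= N - 1)%N.
  by rewrite mxrank_ker leq_sub2l// rank_leq_col.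
have : (E :&: kermx o)%MS != 0.
  rewrite -mxrank_eq0 -lt0n.
  have := mxrank_sum_cap E (kermx o); have := rank_leq_col (E + kermx o)%MS.
  have : (0 < N)%N by apply: leq_trans (rank_leq_col E); apply: leq_trans rE.
  move: rE ro; move: (\rank _) (\rank _) (\rank _) (\rank _) => a b c d.
  by clear; lia.
move=> /rowV0Pn[u]; rewrite sub_capmx => /andP[uE /sub_kermxP uo] u0.
exists u; split => //; have := congr1 (fun M : 'M[R]_1 => M 0 0) uo.
by rewrite !mxE => H; rewrite -[RHS]H; apply: eq_bigr => k _; rewrite mxE mulr1.
Qed.

End Dot.

Section StepfunDot.
Variables (R : realType) (N : nat).
Implicit Types (u v : 'rV[R]_N) (c x : R).

Lemma inner_stepfun_dot u v : inner (stepfun u) (stepfun v) = N%:R^-1 * dot u v.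
Proof. by rewrite inner_stepfun2. Qed.

Lemma stepfunZ c u x : stepfun (c *: u) x = c * stepfun u x.
Proof. by rewrite /stepfun mulr_sumr; apply: eq_bigr => k _; rewrite mxE mulrA. Qed.

Lemma stepfunB u v x : stepfun (u - v) x = stepfun u x - stepfun v x.
Proof.
rewrite /stepfun -sumrB; apply: eq_bigr => k _.
by rewrite !mxE mulrBl.
Qed.

Lemma laplacian_sym (A : 'M[bool]_N) : simple_adj A -> (laplacian R A)^T = laplacian R A.
Proof.
move=> /andP[/forallP As _]; apply/matrixP => i j; rewrite !mxE.
have /forallP/(_ j)/eqP -> := As i.
by rewrite eq_sym; case: eqVneq => [->//|]; rewrite !mul0r.
Qed.

Lemma laplacian_ones (A : 'M[bool]_N) : simple_adj A -> (const_mx 1 : 'rV[R]_N) *m laplacian R A = 0.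
Proof.
move=> /andP[/forallP As _]; apply/rowP => j; rewrite !mxE.
under eq_bigr do rewrite !mxE mul1r.
rewrite sumrB (bigD1 j)//= eqxx mul1r [X in _ + X - _]big1 => [|i ij]; last by rewrite (negPf ij) mul0r.
rewrite addr0; apply/eqP; rewrite subr_eq0; apply/eqP; apply: eq_bigr => i _.
by rewrite mxE; have /forallP/(_ i)/eqP -> := As j.
Qed.

End StepfunDot.

(** * Transfer of the gap from the graphon to the graph Laplacian *)

Section Perturbation.
Variable R : realType.
Implicit Types (f : R -> R) (c : R).
Local Notation I := (@I01 R).
Context (w : R -> R -> R) {K : R} {wK : lip_kernel w K}.
Local Notation mu := (mu2 w).
Hypothesis mu0 : 0 < mu.
Variables (phi : R -> R) (g L : R).
Hypotheses (phig : ground w phi) (phi1 : L2norm phi = 1) (phil : lip01 L phi).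
Hypothesis g0 : 0 < g.
Hypothesis gap : forall f, L2 f -> J f = 0 -> inner f phi = 0 -> g * inner f f <= qform w f f.

Variables (N : nat) (A : 'M[bool]_N) (x theta : R).
Hypotheses (A_adj : simple_adj A) (N0 : (0 < N)%N) (x0 : 0 < x) (theta0 : 0 <= theta).
Implicit Types (v t : 'rV[R]_N).

(** Normalized so that its step function approximates [Lop w]; multiplied by [N * rho], it is the
    mean of the random Laplacian. *)
Definition sampled_laplacian v : 'rV[R]_N :=
  \row_i (N%:R^-1 * \sum_(j < N) w (vtx R i) (vtx R j) * (v 0 i - v 0 j)).

Local Notation S := (laplacian R A).
Hypothesis close : forall v, dot (v *m S - x *: sampled_laplacian v) (v *m S - x *: sampled_laplacian v) <=
  (x * theta) ^+ 2 * dot v v.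

Let K0 : 0 <= K := wK0 (wK := wK).
Let NR : 0 < N%:R :> R. Proof. by rewrite ltr0n. Qed.

(** Random fluctuation plus discretization error; the latter counts [2 * K / N] once for [degree w]
    and once for [W w]. *)
Definition delta : R := theta + 4 * K / N%:R.

Let delta0 : 0 <= delta.
Proof. by rewrite /delta addr_ge0// divr_ge0// mulr_ge0. Qed.

Lemma Lop_sampled v : L2norm (fun y => Lop w (stepfun v) y - stepfun (sampled_laplacian v) y) <=
  4 * K / N%:R * L2norm (stepfun v).
Proof.
set psi := stepfun v; have psiL : L2 psi by exact: stepfun_L2.
pose c := 2 * K / N%:R; have c0 : 0 <= c by rewrite /c divr_ge0// mulr_ge0.
have -> : 4 * K / N%:R * L2norm psi = c * L2norm psi + c * L2norm psi by rewrite /c; field; rewrite gt_eqF.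
have apL := L2_abs psiL.
have hL : L2 (fun y => c * `|psi y| + c * L2norm psi).
  by apply: L2D; [exact: L2Z|exact: L2_cst].
have fL : L2 (fun y => Lop w psi y - stepfun (sampled_laplacian v) y).
  by apply: L2B; [exact: Lop_L2|exact: stepfun_L2].
apply: (le_trans (L2norm_mono fL hL _)) => [y Iy|].
  have [i iy] := cell_ex N0 Iy.
  rewrite [leRHS]ger0_norm; last by rewrite addr_ge0// mulr_ge0// L2norm_ge0.
  rewrite LopE// (stepfun_cell _ iy) mxE.
  have W1 := W_step (wK := wK) (L2_cst 1) iy; have W2 := W_step (wK := wK) psiL iy.
  rewrite L2norm_cst normr1 mulr1 -degree_W in W1.
  have E1 : \sum_(j < N) w (vtx R i) (vtx R j) * J (fun y => cell j y * 1) =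
      N%:R^-1 * \sum_(j < N) w (vtx R i) (vtx R j).
    rewrite mulr_sumr; apply: eq_bigr => j _; rewrite mulrC; congr (_ * _).
    by have [_ <-] := cell_J R j; apply: J_ext => z _; rewrite mulr1.
  have E2 : \sum_(j < N) w (vtx R i) (vtx R j) * J (fun y => cell j y * psi y) =
      N%:R^-1 * \sum_(j < N) w (vtx R i) (vtx R j) * v 0 j.
    rewrite mulr_sumr; apply: eq_bigr => j _.
    have -> : J (fun y => cell j y * psi y) = v 0 j * N%:R^-1.
      have [ci cj] := cell_J R j; rewrite -cj -JZ//; apply: J_ext => z _.
      rewrite /cell; case: (boolP (in_cell j z)) => [jz|_]; last by rewrite mul0r mulr0.
      by rewrite /psi (stepfun_cell _ jz) mulrC.
    by ring.
  rewrite E1 in W1; rewrite E2 in W2.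
  set s1 := N%:R^-1 * _ in W1; set s2 := N%:R^-1 * _ in W2.
  have -> : N%:R^-1 * \sum_(j < N) w (vtx R i) (vtx R j) * (v 0 i - v 0 j) = s1 * psi y - s2.
    rewrite /psi (stepfun_cell _ iy) /s1 /s2 -mulrA -mulrBr; congr (_ * _).
    by rewrite mulr_suml -sumrB; apply: eq_bigr => j _; rewrite mulrBr.
  have -> : degree w y * psi y - W w psi y - (s1 * psi y - s2) =
     (degree w y - s1) * psi y - (W w psi y - s2) by ring.
  apply: (le_trans (ler_normB _ _)); apply: lerD; last exact: W2.
  by rewrite normrM ler_wpM2r.
apply: (le_trans (L2normD (L2Z c apL) (L2_cst (c * L2norm psi)))).
rewrite L2normZ// L2norm_cst (ger0_norm c0) (ger0_norm (mulr_ge0 c0 (L2norm_ge0 psi))).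
rewrite lerD2r ler_wpM2l//; apply: L2norm_mono => // y _; by rewrite normr_id.
Qed.

Lemma graph_close v :
  L2norm (fun y => Lop w (stepfun v) y - stepfun (x^-1 *: (v *m S)) y) <= delta * L2norm (stepfun v).
Proof.
set u := v *m S - x *: sampled_laplacian v.
have E y : Lop w (stepfun v) y - stepfun (x^-1 *: (v *m S)) y =
  (Lop w (stepfun v) y - stepfun (sampled_laplacian v) y) - x^-1 * stepfun u y.
  rewrite /u stepfunB !stepfunZ; field; rewrite gt_eqF//.
rewrite (L2norm_ext (fun y _ => E y)).
have uL := stepfun_L2 u.
apply: (le_trans (L2normB _ (L2Z _ uL))).
  by apply: L2B; [apply: Lop_L2|]; exact: stepfun_L2.
rewrite /delta mulrDl addrC; apply: lerD; last exact: Lop_sampled.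
rewrite L2normZ// gtr0_norm ?invr_gt0// ler_pdivrMl// mulrA.
apply: L2norm_le; first by rewrite mulr_ge0 ?L2norm_ge0// mulr_ge0// ltW.
rewrite exprMn L2norm2 !inner_stepfun_dot mulrCA ler_wpM2l ?close//.
Qed.

Lemma graph_form_close v t : `|inner (Lop w (stepfun v)) (stepfun t) - x^-1 * (N%:R^-1 * dot (v *m S) t)| <=
  delta * L2norm (stepfun v) * L2norm (stepfun t).
Proof.
have vL := stepfun_L2 v; have tL := stepfun_L2 t; have LL := Lop_L2 (wK := wK) vL.
have -> : x^-1 * (N%:R^-1 * dot (v *m S) t) = inner (stepfun (x^-1 *: (v *m S))) (stepfun t).
  by rewrite inner_stepfun_dot dotZl; ring.
have sL := stepfun_L2 (x^-1 *: (v *m S)).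
rewrite -innerBl//; apply: (le_trans (inner_CS (L2B LL sL) tL)).
by rewrite ler_wpM2r ?L2norm_ge0// graph_close.
Qed.

Hypothesis delta_mu : delta < mu.

Lemma stepfun_norm_gt0 v : v != 0 -> 0 < inner (stepfun v) (stepfun v).
Proof. by move=> v0; rewrite inner_stepfun_dot mulr_gt0 ?invr_gt0// dot_gt0. Qed.

Lemma J_stepfun_rsum v : rsum v = 0 -> J (stepfun v) = 0.
Proof. by move=> tv; rewrite J_stepfun -[\sum_k _]/(rsum v) tv mulr0. Qed.

(** As [delta < mu], the bound is positive: no nonzero sum-zero vector lies in the kernel of the
    graph Laplacian. *)
Lemma eigenvalue_lower v lam : v != 0 -> rsum v = 0 -> v *m S = lam *: v -> mu - delta <= lam / x.
Proof.
move=> v0 tv ve; have n0 := stepfun_norm_gt0 v0.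
have := graph_form_close v v; rewrite ve dotZl -!mulrA -expr2 L2norm2.
have -> : x^-1 * (N%:R^-1 * (lam * dot v v)) = lam / x * inner (stepfun v) (stepfun v).
  by rewrite inner_stepfun_dot; ring.
have := mu2_le (wK := wK) (stepfun_L2 v) (J_stepfun_rsum tv).
rewrite ler_norml => h1 /andP[_ h2].
by rewrite -(ler_pM2r n0) mulrBl; lra.
Qed.

(** A double lowest eigenvalue would be at most [0], yet [rank2_rsum0] and [eigenvalue_lower] make
    it positive. In the other case a negative eigenvalue is excluded in the same way, so the single
    eigenvalue below [lam] is [0]. *)
Lemma second_eigenvector lam v : v != 0 -> v *m S = lam *: v -> second_eigenvalue S lam ->
  [/\ rsum v = 0, 0 < lam & forall m, eigenvalue S m -> 0 < m -> lam <= m].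
Proof.
have Ssym := laplacian_sym R A_adj; have S1 := laplacian_ones R A_adj.
have ones0 : (const_mx 1 : 'rV[R]_N) != 0.
  apply/negP => /eqP/rowP/(_ (Ordinal N0)); rewrite !mxE => /eqP.
  by rewrite oner_eq0.
have tot u (m : R) : u *m S = m *: u -> m != 0 -> rsum u = 0.
  move=> ue m0; apply: (mulfI m0); rewrite -rsumZ -ue mulr0 rsum_dot dot_mulmx//.
  by rewrite S1 /dot big1// => k _; rewrite mxE mulr0.
have pos u (m : R) : u != 0 -> rsum u = 0 -> u *m S = m *: u -> 0 < m.
  move=> u0 ut ue; have H := eigenvalue_lower u0 ut ue.
  have : 0 < m / x by apply: lt_le_trans H; rewrite subr_gt0.
  by rewrite pmulr_lgt0 ?invr_gt0.
have ev0 : eigenvalue S 0 by apply/eigenvalueP; exists (const_mx 1); rewrite ?scale0r.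
move=> v0 ve [_ [[r2 lmin]|[m [em [mlam [_ muniq]]]]]].
  have l0 := lmin 0 ev0; have [u [uE u0 ut]] := rank2_rsum0 r2.
  by move/eigenspaceP : uE => ue; have := pos _ _ u0 ut ue; lra.
have lam0 : lam != 0.
  apply/negP => /eqP l0; move/eigenvalueP: em => [u ue u0].
  have m0 : m != 0 by rewrite lt_eqF// -l0.
  by have := pos _ _ u0 (tot _ _ ue m0) ue; rewrite l0 in mlam; lra.
have vt := tot _ _ ve lam0; have lpos := pos _ _ v0 vt ve.
split => // m' em' m'0; rewrite leNgt; apply/negP => lt.
by have := muniq _ em' lt; have := muniq _ ev0 lpos; lra.
Qed.

Hypothesis LN : 4 * L <= N%:R.
Let L0 : 0 <= L := lip_ge0 phil.

(** The test vector is [phi] sampled at the vertices and recentred. Since [phi] is in the kernel of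
    [qform], the form of [s] equals that of the error [s - phi], so this error enters only
    quadratically. *)
Lemma eigenvalue_upper : exists m, [/\ eigenvalue S m, 0 < m &
  m / x <= mu + delta + 4 * (2 + mu) * (2 * L / N%:R) ^+ 2].
Proof.
have [mu0' LN' dm] := And3 mu0 LN delta_mu.
have Ssym := laplacian_sym R A_adj; have S1 := laplacian_ones R A_adj.
have phiL := ground_L2 phig; case: (phig) => -[_ phie] phiJ.
pose p : 'rV[R]_N := \row_k phi (vtx R k).
pose mean := N%:R^-1 * rsum p.
pose t : 'rV[R]_N := p - const_mx mean.
pose s := stepfun t.
have d0 : 0 <= L / N%:R by rewrite divr_ge0.
have pd y : I y -> `|stepfun p y - phi y| <= L / N%:R.
  move=> Iy; have [k ky] := cell_ex N0 Iy; rewrite (stepfun_cell _ ky) mxE.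
  apply: (le_trans (phil (vtx_I R k) Iy)).
  by rewrite distrC ler_wpM2l// cell_vtx.
have pL := stepfun_L2 p.
have meanE : mean = J (fun y => stepfun p y - phi y).
  by rewrite JB ?phiJ ?subr0; [rewrite J_stepfun|exact: L2_intg..].
have meanL : `|mean| <= L / N%:R by rewrite meanE; apply: J_bnd pd; apply: L2_intg; exact: L2B.
have tE y : I y -> s y = stepfun p y - mean.
  move=> Iy; have [k ky] := cell_ex N0 Iy.
  by rewrite /s stepfunB (stepfun_cell (const_mx _) ky) mxE.
have tt : rsum t = 0.
  rewrite /t -scaleN1r rsum_lin /mean /rsum; under [X in _ + _ * X]eq_bigr do rewrite mxE.
  rewrite sumr_const card_ord -[N%:R^-1 * _ *+ N]mulr_natl mulVKf ?gt_eqF//; ring.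
pose e y := s y - phi y.
have sL : L2 s by exact: stepfun_L2.
have eL : L2 e by exact: L2B.
have Js : J s = 0 by exact: J_stepfun_rsum.
have Je : J e = 0 by rewrite JB ?Js ?phiJ ?subrr//; exact: L2_intg.
have eb : L2norm e <= 2 * L / N%:R.
  apply: L2norm_bnd => //; first by rewrite -mulrA mulr_ge0.
  move=> y Iy; rewrite /e tE//.
  have -> : stepfun p y - mean - phi y = (stepfun p y - phi y) - mean by ring.
  apply: (le_trans (ler_normB _ _)).
  by have -> : 2 * L / N%:R = L / N%:R + L / N%:R by [ring]; rewrite lerD ?pd.
have e2 : inner e e <= (2 * L / N%:R) ^+ 2.
  by rewrite -L2norm2 lerXn2r ?nnegrE ?L2norm_ge0// -mulrA mulr_ge0.
(* The condition [4 * L <= N] gives [s] norm at least [1 / 2]; dividing by [inner s s >= 1 / 4] is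
   the origin of the factor [4] in the statement. *)
have eh : 2 * L / N%:R <= 1 / 2 by rewrite ler_pdivrMr//; lra.
have snorm : 1 / 2 <= L2norm s.
  have : L2norm phi <= L2norm s + L2norm e.
    rewrite {1}(@L2norm_ext _ phi (fun y => s y - e y)); last by move=> y _; rewrite /e; ring.
    exact: L2normB.
  by rewrite phi1; lra.
have s2 : 1 / 4 <= inner s s.
  rewrite -L2norm2; have : (1 / 2) ^+ 2 <= L2norm s ^+ 2 by rewrite lerXn2r ?nnegrE ?L2norm_ge0.
  by rewrite !expr2; lra.
have qs : qform w s s = qform w e e.
  have r0 h : L2 h -> qform w phi h = 0.
    move=> hL; rewrite qform_resid// -[RHS](J_cst 0); apply: J_ext => y Iy.
    by rewrite /resid phie// subrr mul0r.
  have E y : I y -> s y = e y + phi y by rewrite /e subrK.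
  have sE : s = (fun y => e y + phi y) by apply/funext => y; rewrite /e subrK.
  rewrite sE qformDl//; last by rewrite -sE.
  rewrite r0 ?addr0; last by rewrite -sE.
  rewrite qformC//; last by rewrite -sE.
  by rewrite qformDl// r0// addr0.
have qe : qform w e e <= (2 + mu) * (2 * L / N%:R) ^+ 2.
  apply: (@le_trans _ _ ((2 + mu) * inner e e)); last by rewrite ler_wpM2l// addr_ge0// ltW.
  rewrite /qform mulrDl; apply: lerD.
    by apply: le_trans (Lop_form_bnd (wK := wK) eL); exact: ler_norm.
  have h1 : 0 <= mu * inner e e by rewrite mulr_ge0 ?inner_ge0// ltW.
  lra.
have t0 : t != 0.
  apply/negP => /eqP t0; have : inner s s = 0.
    by rewrite /s inner_stepfun_dot t0 /dot big1 ?mulr0// => k _; rewrite mxE mul0r.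
  by move: s2 => /[swap] ->; lra.
have [u [m [u0 ut ue mle]]] := rayleigh_eigenvector Ssym S1 tt t0.
exists m; split.
- by apply/eigenvalueP; exists u.
- have H := eigenvalue_lower u0 ut ue.
  have : 0 < m / x by apply: lt_le_trans H; rewrite subr_gt0.
  by rewrite pmulr_lgt0 ?invr_gt0.
have ss0 : 0 < inner s s by lra.
rewrite -(ler_pM2r ss0).
have h1 : m / x * inner s s <= x^-1 * (N%:R^-1 * dot (t *m S) t).
  rewrite /s inner_stepfun_dot.
  have -> : m / x * (N%:R^-1 * dot t t) = x^-1 * (N%:R^-1 * (m * dot t t)) by ring.
  have xi : 0 <= x^-1 by rewrite invr_ge0 ltW.
  have Ni : 0 <= N%:R^-1 :> R by rewrite invr_ge0 ltW.
  by rewrite ler_wpM2l// ler_wpM2l.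
have h2 := graph_form_close t t; rewrite -/s -mulrA -expr2 L2norm2 ler_norml in h2.
have h3 : inner (Lop w s) s = mu * inner s s + qform w s s by rewrite /qform; ring.
have h4 : (2 + mu) * (2 * L / N%:R) ^+ 2 <= 4 * (2 + mu) * (2 * L / N%:R) ^+ 2 * inner s s.
  have h5 : 0 <= (2 + mu) * (2 * L / N%:R) ^+ 2 by rewrite mulr_ge0 ?sqr_ge0// addr_ge0// ltW.
  have h6 := ler_wpM2l h5 s2.
  have -> : 4 * (2 + mu) * (2 * L / N%:R) ^+ 2 * inner s s =
    4 * ((2 + mu) * (2 * L / N%:R) ^+ 2 * inner s s) by ring.
  lra.
case/andP: h2 => h2 _; rewrite h3 qs in h2.
rewrite [leRHS]mulrDl mulrDl.
lra.
Qed.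

(** Davis-Kahan: the part [r] of [psi] orthogonal to [phi] has, up to sampling, a small residual,
    and the gap bounds [r] by this residual over [g]. The residual collects [delta] from the
    operators and [delta + beta] from the eigenvalues. *)
Lemma fiedler_close v : fiedler_vector A v -> L2norm (stepfun v) = 1 -> 0 <= inner phi (stepfun v) ->
  L2norm (fun y => stepfun v y - phi y) <=
    2 / g * (2 * delta + 4 * (2 + mu) * (2 * L / N%:R) ^+ 2).
Proof.
have [mu0' d0] := conj mu0 delta0.
move=> [v0 [lam [sec ve]]] n1 pos.
set beta := 4 * (2 + mu) * _ ^+ 2.
have beta0 : 0 <= beta by rewrite /beta !mulr_ge0 ?sqr_ge0// addr_ge0// ltW.
have phiL := ground_L2 phig; case: (phig) => -[_ phie] phiJ.
have [vt lam0 lmin] := second_eigenvector v0 ve sec.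
have [m [em m0 mup]] := eigenvalue_upper.
have lup : lam / x <= mu + delta + beta.
  by apply: le_trans mup; rewrite ler_pM2r ?invr_gt0// lmin.
have llow := eigenvalue_lower v0 vt ve.
have ld : `|lam / x - mu| <= delta + beta by rewrite ler_norml; apply/andP; split; lra.
set psi := stepfun v; have psiL : L2 psi by exact: stepfun_L2.
have psiJ : J psi = 0 by exact: J_stepfun_rsum.
have resb : L2norm (resid w psi) <= 2 * delta + beta.
  have E y : resid w psi y = (Lop w psi y - stepfun (x^-1 *: (v *m S)) y) + (lam / x - mu) * psi y.
    by rewrite /resid ve !stepfunZ -/psi; ring.
  rewrite (L2norm_ext (fun y _ => E y)).
  apply: (le_trans (L2normD _ (L2Z _ psiL))).
    by apply: L2B; [exact: Lop_L2|exact: stepfun_L2].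
  have -> : 2 * delta + beta = delta + (delta + beta) by ring.
  apply: lerD; first by have := graph_close v; rewrite n1 mulr1.
  by rewrite L2normZ// n1 mulr1.
pose a := inner phi psi.
pose r y := psi y + (- a) * phi y.
have aL := L2Z (- a) phiL.
have rL : L2 r by exact: L2D.
have rJ : J r = 0 by exact: J_lin.
have phi2 : inner phi phi = 1 by rewrite -L2norm2 phi1 expr1n.
have psi2 : inner psi psi = 1 by rewrite -L2norm2 n1 expr1n.
have rphi : inner r phi = 0.
  by rewrite innerDl// innerZl// phi2 innerC -/a; ring.
have resE y : I y -> resid w r y = resid w psi y.
  by move=> Iy; rewrite /resid /r LopD// LopZ// phie//; ring.
have h1 : g * inner r r <= L2norm (resid w psi) * L2norm r.
  apply: (le_trans (gap rL rJ rphi)); rewrite qform_resid//.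
  rewrite (inner_ext (f' := resid w psi) (g' := r))//.
  by apply: (le_trans (ler_norm _)); apply: inner_CS => //; exact: resid_L2.
have rb : L2norm r <= g^-1 * (2 * delta + beta).
  rewrite ler_pdivlMl//; apply: le_trans resb.
  have := L2norm_ge0 r; rewrite le_eqVlt => /predU1P[<-|r0].
    by rewrite mulr0 L2norm_ge0.
  by rewrite -(ler_pM2r r0) -mulrA -expr2 L2norm2.
have rr : inner r r = 1 - a ^+ 2.
  rewrite inner_shift2// psi2 phi2 -/a; ring.
have rr0 := inner_ge0 r.
have a1 : a <= 1.
  rewrite -(@ler_pXn2r _ 2)// ?nnegrE// expr1n; lra.
(* The sign normalization [a >= 0] enters here: the squared distance is [2 - 2 a], that of [r] is
   [1 - a^2], and [4 (1 - a^2) - (2 - 2 a)] factors as [(1 - a) (2 + 4 a)]. *)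
have main : L2norm (fun y => psi y - phi y) <= 2 * L2norm r.
  apply: L2norm_le; first by rewrite mulr_ge0// L2norm_ge0.
  rewrite exprMn L2norm2 rr.
  rewrite (inner_ext (f' := fun y => psi y + (-1) * phi y) (g' := fun y => psi y + (-1) * phi y)); [|by move=> *; ring..].
  rewrite inner_shift2// psi2 phi2 -/a.
  rewrite -subr_ge0.
  have -> : 2 ^+ 2 * (1 - a ^+ 2) - (1 + 2 * -1 * a + (-1) ^+ 2 * 1) = (1 - a) * (2 + 4 * a) :> R by ring.
  by rewrite mulr_ge0//; have := pos; rewrite -/a; lra.
apply: (le_trans main); rewrite -mulrA ler_wpM2l//.
Qed.
End Perturbation.

(** * Moments of the random Laplacian *)

Section GraphExpectation.
Variables (R : realType) (w : R -> R -> R) (tau : R) (N : nat).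
Local Notation T := ('I_N * 'I_N)%type.
Implicit Types (A : 'M[bool]_N) (e : T) (s : seq T) (i j l : 'I_N).
Local Notation p e := (edge_prob w tau e.1 e.2).

Definition upper e : bool := (e.1 < e.2)%N.

Definition expect (F : 'M[bool]_N -> R) : R := \sum_A graph_weight w tau A * F A.

Lemma expect_ext F G : (forall A, simple_adj A -> F A = G A) -> expect F = expect G.
Proof.
move=> FG; apply: eq_bigr => A _; rewrite /graph_weight.
by case: ifP => [/FG->//|_]; rewrite !mul0r.
Qed.

Lemma expectB F G : expect (fun A => F A - G A) = expect F - expect G.
Proof. by rewrite /expect -sumrB; apply: eq_bigr => A _; rewrite mulrBr. Qed.

Lemma expectZ c F : expect (fun A => c * F A) = c * expect F.
Proof. by rewrite /expect mulr_sumr; apply: eq_bigr => A _; rewrite mulrCA. Qed.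

Lemma expect_sum (I : Type) (r : seq I) (P : pred I) (F : I -> 'M[bool]_N -> R) :
  expect (fun A => \sum_(k <- r | P k) F k A) = \sum_(k <- r | P k) expect (F k).
Proof.
rewrite /expect exchange_big; apply: eq_bigr => A _.
by rewrite mulr_sumr.
Qed.

Let ffun_of A : {ffun T -> bool} := [ffun e => upper e && A e.1 e.2].
Let mx_of (f : {ffun T -> bool}) : 'M[bool]_N :=
  \matrix_(i, j) if (i < j)%N then f (i, j) else if (j < i)%N then f (j, i) else false.

Let mx_ofK A : simple_adj A -> mx_of (ffun_of A) = A.
Proof.
move=> /andP[/forallP As /forallP Ad]; apply/matrixP => i j; rewrite mxE !ffunE /upper /=.
case: (ltngtP i j) => //= ij; first by have /forallP/(_ j)/eqP -> := As i.
by have -> : i = j by [exact: val_inj]; rewrite (negPf (Ad j)).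
Qed.

Let mx_of_simple f : simple_adj (mx_of f).
Proof.
apply/andP; split; last by apply/forallP => i; rewrite mxE ltnn.
by apply/forallP => i; apply/forallP => j; rewrite !mxE; case: ltngtP.
Qed.

Lemma graph_weight_prod A : simple_adj A ->
  graph_weight w tau A = \prod_(e | upper e) (if A e.1 e.2 then p e else 1 - p e).
Proof. by move=> As; rewrite /graph_weight As pair_big_dep. Qed.

Lemma expect_prod (g : T -> bool -> R) :
  expect (fun A => \prod_(e | upper e) g e (A e.1 e.2)) =
  \prod_(e | upper e) (p e * g e true + (1 - p e) * g e false).
Proof.
(* Off the upper triangle [h] weighs [false] by [1] and [true] by [0], which cancels the boolean
   functions that encode no graph. *)
pose h e b := if upper e then (if b then p e else 1 - p e) * g e b else (~~ b)%:R.
transitivity (\prod_(e : T) \sum_(b : bool) h e b); last first.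
  rewrite [RHS]big_mkcond; apply: eq_bigr => e _; rewrite big_bool /h.
  by case: ifP => // _; rewrite /= add0r.
rewrite bigA_distr_bigA /=.
transitivity (\sum_(A | simple_adj A) \prod_(e | upper e) ((if A e.1 e.2 then p e else 1 - p e) * g e (A e.1 e.2))).
  rewrite [RHS]big_mkcond; apply: eq_bigr => A _; case: ifP => As.
    by rewrite graph_weight_prod// -big_split.
  by rewrite /graph_weight As mul0r.
rewrite (reindex_onto mx_of ffun_of) => [|A]; last exact: mx_ofK.
rewrite big_mkcond; apply: eq_bigr => f _; rewrite mx_of_simple /=.
case: eqP => [ff|/eqP ff].
  rewrite big_mkcond; apply: eq_bigr => e _; rewrite /h /upper.
  case: ifP => eu; first by rewrite !mxE eu -surjective_pairing.
  by rewrite -ff ffunE /upper eu.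
have [e fe] : exists e, ffun_of (mx_of f) e != f e.
  by apply/existsP; move: ff; apply: contraR; rewrite negb_exists => /forallP H;
     apply/eqP/ffunP => e; apply/eqP; have := H e; rewrite negbK.
rewrite (bigD1 e)//= {1}/h; move: fe; rewrite !ffunE !mxE /upper.
case: ifP => _ /=; first by rewrite -surjective_pairing eqxx.
by case: (f e) => //= _; rewrite mul0r.
Qed.

Lemma expect1 : expect (fun=> 1) = 1.
Proof.
have := expect_prod (fun _ _ => 1).
have -> : (fun A => \prod_(e : T | upper e) 1) = (fun=> 1 : R).
  by apply/funext => A; rewrite big1.
by move=> ->; rewrite big1// => e _; rewrite !mulr1 addrC subrK.
Qed.

Definition edge_dev e A : R := (A e.1 e.2)%:R - p e.
Definition edge_devs s A : R := \prod_(e <- s) edge_dev e A.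

Lemma edge_devs_count s A : all upper s ->
  edge_devs s A = \prod_(e | upper e) edge_dev e A ^+ count_mem e s.
Proof.
elim: s => [_|e s IH /= /andP[eu su]].
  by rewrite /edge_devs big_nil big1.
rewrite /edge_devs big_cons -/(edge_devs s A) IH// (bigD1 e)//= [RHS](bigD1 e)//= eqxx exprS mulrA.
by congr (_ * _); apply: eq_bigr => f /andP[_ fe]; rewrite eq_sym (negPf fe).
Qed.

Lemma expect_devs s : all upper s -> expect (edge_devs s) =
  \prod_(e | upper e) (p e * (1 - p e) ^+ count_mem e s + (1 - p e) * (- p e) ^+ count_mem e s).
Proof.
move=> su; have := expect_prod (fun e b => (b%:R - p e) ^+ count_mem e s).
have -> : expect (fun A => \prod_(e | upper e) ((A e.1 e.2)%:R - p e) ^+ count_mem e s) = expect (edge_devs s).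
  by apply: expect_ext => A _; rewrite edge_devs_count.
by move=> ->; apply: eq_bigr => e _; rewrite sub0r.
Qed.

Variables (r y : R).
Hypothesis p01 : forall e, upper e -> 0 <= p e <= 1.
Hypothesis pr : forall e, upper e -> p e <= r.
Hypothesis y1 : 1 <= y.
Hypothesis yr : r = y ^+ 2 * N%:R^-1.

(* A product of centred edge variables has zero mean unless every edge occurs at
   least twice; since [r = y ^ 2 / N] and [y >= 1], this is encoded by charging
   [y] per step and [1 / N] per distinct edge, so that the [N] choices of a new
   neighbour cost a factor [1] in [edge_choices]. *)
Definition edge_cost (m : nat) : R := y ^+ m * (if (0 < m)%N then N%:R^-1 else 1).
Definition walk_cost s : R := \prod_(e : T) edge_cost (count_mem e s).

Let y0 : 0 <= y. Proof. exact: le_trans ler01 y1. Qed.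
Let Ni0 : 0 <= N%:R^-1 :> R. Proof. by rewrite invr_ge0. Qed.

Lemma edge_cost_ge0 m : 0 <= edge_cost m.
Proof. by rewrite /edge_cost mulr_ge0 ?exprn_ge0//; case: ifP. Qed.

Lemma walk_cost_ge0 s : 0 <= walk_cost s.
Proof. by apply: prodr_ge0 => e _; exact: edge_cost_ge0. Qed.

(** For [m = 1] the centred mean vanishes; for [m >= 2] the moment is at most [q <= r = y ^+ 2 / N],
    and [y >= 1] allows the larger power of [y]. *)
Lemma centered_moment_le (q : R) m : 0 <= q <= 1 -> q <= r ->
  `|q * (1 - q) ^+ m + (1 - q) * (- q) ^+ m| <= edge_cost m.
Proof.
move=> /andP[q0 q1] qr; rewrite /edge_cost; case: m => [|[|m]].
- rewrite !expr0 !mulr1 addrC subrK normr1//.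
- rewrite !expr1 mulrN (mulrC q) subrr normr0 mulr_ge0//.
have q1' : 0 <= 1 - q by rewrite subr_ge0.
have q1'' : 1 - q <= 1 by rewrite lerBlDr lerDl.
apply: (@le_trans _ _ r); last first.
  rewrite yr /= ler_wpM2r// -[m.+2]addn2 exprD ler_peMl ?exprn_ege1//.
  by rewrite exprn_ge0.
apply: le_trans qr; apply: (le_trans (ler_normD _ _)).
rewrite [X in X + _ <= _]normrM [X in _ + X <= _]normrM !normrX normrN (ger0_norm q0) (ger0_norm q1').
have a1 : (1 - q) ^+ m.+2 <= 1 - q.
  by rewrite exprS ler_piMr// exprn_ile1.
have a2 : q ^+ m.+2 <= q by rewrite exprS ler_piMr// exprn_ile1.
have b1 : q * (1 - q) ^+ m.+2 <= q * (1 - q) by rewrite ler_wpM2l.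
have b2 : (1 - q) * q ^+ m.+2 <= (1 - q) * (q * q).
  rewrite ler_wpM2l// exprS ler_wpM2l// exprS ler_piMr// exprn_ile1//.
have b3 : (1 - q) * (q * q) <= q * q by rewrite ler_piMl// mulr_ge0.
apply: (le_trans (lerD b1 (le_trans b2 b3))).
by rewrite le_eqVlt; apply/orP; left; apply/eqP; ring.
Qed.

Lemma expect_devs_le s : all upper s -> `|expect (edge_devs s)| <= walk_cost s.
Proof.
move=> su; rewrite expect_devs// normr_prod big_mkcond.
apply: ler_prod => e _; case: ifP => [eu|eu].
  by rewrite normr_ge0 centered_moment_le ?p01 ?pr.
rewrite ler01 /=; have -> : count_mem e s = 0%N; last by rewrite /edge_cost expr0 mul1r.
apply/eqP; rewrite -leqn0 leqNgt -has_count; apply/negP => /hasP[f fs /eqP fe].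
by move/allP: su => /(_ f fs); rewrite fe eu.
Qed.

Lemma walk_cost_cons e s : walk_cost (e :: s) = y * walk_cost s * (if e \in s then 1 else N%:R^-1).
Proof.
rewrite /walk_cost (bigD1 e)//= [X in y * X](bigD1 e)//= eqxx.
have -> : \prod_(i | i != e) edge_cost ((e == i) + count_mem i s) =
   \prod_(i | i != e) edge_cost (count_mem i s).
  by apply: eq_bigr => i ie; rewrite eq_sym (negPf ie).
rewrite /edge_cost /= exprS -has_pred1 has_count.
by case: ifP => _; ring.
Qed.

Definition edge i l : T := if (i < l)%N then (i, l) else (l, i).

Lemma edge_upper i l : i != l -> upper (edge i l).
Proof. by rewrite /edge /upper neq_ltn; case: ltngtP. Qed.

Lemma edge_inj i : {in [pred l | l != i] &, injective (edge i)}.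
Proof.
move=> l l' /=; rewrite !inE /edge => /negP il /negP il'.
case: ifP => _; case: ifP => _ [] // E1 E2.
- by case: il'; rewrite E1.
- by case: il; rewrite E1.
Qed.

(** At most [size s] neighbours reuse a listed edge, as [edge i] is injective; at most [N] others
    contribute [1 / N] each. *)
Lemma edge_choices i s :
  \sum_(l | l != i) (if edge i l \in s then 1 else N%:R^-1 : R) <= (size s).+1%:R.
Proof.
apply: (@le_trans _ _ (\sum_(l | l != i) ((edge i l \in s)%:R + N%:R^-1))).
  by apply: ler_sum => l _; case: ifP => _; rewrite /= ?lerDl ?add0r.
rewrite big_split /= -natr1; apply: lerD; last first.
  apply: (@le_trans _ _ (\sum_(l < N) N%:R^-1)).
    by rewrite [leRHS](bigID (fun l => l != i)) /= lerDl sumr_ge0.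
  rewrite sumr_const card_ord -[_ *+ _]mulr_natl.
  by have [->|n0] := eqVneq N 0%N; rewrite ?mul0r// mulfV// pnatr_eq0.
rewrite -natr_sum ler_nat.
have -> : (\sum_(l | l != i) (edge i l \in s) = size [seq edge i l | l <- enum 'I_N & (l != i) && (edge i l \in s)])%N.
  rewrite size_map size_filter -sum1_count big_enum_cond /= [RHS]big_mkcondr /=.
  by apply: eq_bigr => l _; case: (_ \in _).
apply: uniq_leq_size.
  rewrite map_inj_in_uniq => [|l l']; first by apply: filter_uniq; exact: enum_uniq.
  rewrite !mem_filter => /andP[/andP[il _] _] /andP[/andP[il' _] _].
  exact: edge_inj.
by move=> e /mapP[l]; rewrite mem_filter => /andP[/andP[_ es] _] ->.
Qed.

(** The matrix Q of the overview, written edge by edge; [laplacian_dev] identifies it with the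
    deviation of the Laplacian. *)
Definition dev_mx A : 'M[R]_N :=
  \matrix_(i, j) ((i == j)%:R * (\sum_(l | l != i) edge_dev (edge i l) A) -
                  (i != j)%:R * edge_dev (edge i j) A).

(** Read as one step of a walk: an edge from [i] to [l] is recorded, and the walk either stays at
    [i] or moves to [l]. *)
Lemma dev_mx_mul A m (B : 'M[R]_(N, m)) (i : 'I_N) (j : 'I_m) :
  (dev_mx A *m B) i j = \sum_(l | l != i) edge_dev (edge i l) A * (B i j - B l j).
Proof.
rewrite mxE; under eq_bigr do rewrite mxE mulrBl.
rewrite sumrB (bigD1 i)//= eqxx mul1r [X in _ + X - _]big1 => [|l li]; last first.
  by rewrite eq_sym (negPf li) mul0r mul0r.
rewrite addr0 [X in _ - X](bigD1 i)//= eqxx !mul0r add0r mulr_suml -sumrB.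
by apply: eq_bigr => l li; rewrite eq_sym li mul1r mulrBr.
Qed.

(** The induction carries the list [s] of recorded edges. Each step contributes [2] for staying or
    moving, [y] for the recorded edge, and a number of effective choices bounded by the current
    length through [edge_choices]. *)
Lemma walk_bound L : forall s i, all upper s ->
  \sum_j `|expect (fun A => edge_devs s A * (dev_mx A ^+ L) i j)| <=
  walk_cost s * ((2 * y) ^+ L * (size s + L)%:R ^+ L).
Proof.
elim: L => [|L IH] s i su.
  rewrite !expr0 !mulr1 (bigD1 i)//= big1 => [|j ji].
    rewrite addr0; apply: le_trans (expect_devs_le su).
    rewrite le_eqVlt; apply/orP; left; apply/eqP; congr `|_|.
    by apply: expect_ext => A _; rewrite expr0 mxE eqxx mulr1.
  rewrite -[RHS](@normr0 R R); congr `|_|; rewrite -[RHS](mul0r (expect (fun=> 1))) -expectZ.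
  by apply: expect_ext => A _; rewrite expr0 mxE eq_sym (negPf ji) mulr0 mul0r.
pose b l := walk_cost (edge i l :: s) * ((2 * y) ^+ L * (size s + L.+1)%:R ^+ L).
have bE l i' : l != i -> \sum_j `|expect (fun A => edge_devs (edge i l :: s) A * (dev_mx A ^+ L) i' j)| <= b l.
  move=> li; have := IH (edge i l :: s) i'; rewrite /= su edge_upper 1?eq_sym// => /(_ isT).
  by rewrite addSnnS.
apply: (@le_trans _ _ (\sum_j \sum_(l | l != i)
    (`|expect (fun A => edge_devs (edge i l :: s) A * (dev_mx A ^+ L) i j)| +
     `|expect (fun A => edge_devs (edge i l :: s) A * (dev_mx A ^+ L) l j)|))).
  apply: ler_sum => j _.
  have -> : expect (fun A => edge_devs s A * (dev_mx A ^+ L.+1) i j) =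
     \sum_(l | l != i) (expect (fun A => edge_devs (edge i l :: s) A * (dev_mx A ^+ L) i j) -
                         expect (fun A => edge_devs (edge i l :: s) A * (dev_mx A ^+ L) l j)).
    under [RHS]eq_bigr do rewrite -expectB; rewrite -expect_sum; apply: expect_ext => A _.
    rewrite exprS dev_mx_mul mulr_sumr; apply: eq_bigr => l _.
    by rewrite /edge_devs big_cons; ring.
  apply: (le_trans (ler_norm_sum _ _ _)); apply: ler_sum => l _; exact: ler_normB.
rewrite exchange_big /=.
apply: (@le_trans _ _ (\sum_(l | l != i) (b l + b l))).
  by apply: ler_sum => l li; rewrite big_split; apply: lerD; exact: bE.
have -> : \sum_(l | l != i) (b l + b l) =
    walk_cost s * ((2 * y) ^+ L.+1 * (size s + L.+1)%:R ^+ L) *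
    \sum_(l | l != i) (if edge i l \in s then 1 else N%:R^-1).
  rewrite mulr_sumr; apply: eq_bigr => l _; rewrite /b walk_cost_cons exprS.
  by case: ifP => _; ring.
rewrite [(size s + L.+1)%:R ^+ L.+1]exprSr !mulrA ler_wpM2l//.
  by rewrite !mulr_ge0 ?walk_cost_ge0 ?exprn_ge0 ?mulr_ge0.
by apply: (le_trans (edge_choices i s)); rewrite ler_nat addnS ltnS leq_addr.
Qed.

Lemma expect_trace L : expect (fun A => \tr (dev_mx A ^+ L)) <= N%:R * (2 * y * L%:R) ^+ L.
Proof.
rewrite /mxtrace expect_sum.
apply: (@le_trans _ _ (\sum_(i < N) (2 * y * L%:R) ^+ L)); last first.
  by rewrite sumr_const card_ord [leRHS]mulr_natl.
apply: ler_sum => i _; have := walk_bound L i (isT : all upper [::]).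
have -> : walk_cost [::] = 1.
  by rewrite /walk_cost big1// => e _; rewrite /edge_cost expr0 mul1r.
rewrite mul1r add0n -exprMn; apply: le_trans.
rewrite (bigD1 i)//=; apply: (@le_trans _ _ `|expect (fun A => edge_devs [::] A * (dev_mx A ^+ L) i i)|).
  apply: le_trans (ler_norm _); rewrite le_eqVlt; apply/orP; left; apply/eqP.
  by apply: expect_ext => A _; rewrite /edge_devs big_nil mul1r.
by rewrite lerDl sumr_ge0.
Qed.

Lemma graph_weight_ge0 A : 0 <= graph_weight w tau A.
Proof.
rewrite /graph_weight; case: ifP => // _; apply: prodr_ge0 => i _; apply: prodr_ge0 => j ij.
by have /andP[a b] := @p01 (i, j) ij; case: ifP => _; rewrite ?subr_ge0.
Qed.

Lemma graph_prob_markov (F : 'M[bool]_N -> R) (E : 'M[bool]_N -> Prop) c : 0 < c ->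
  (forall A, simple_adj A -> 0 <= F A) -> (forall A, simple_adj A -> F A <= c -> E A) ->
  1 - expect F / c <= graph_prob w tau E.
Proof.
move=> c0 F0 FE.
have -> : 1 - expect F / c = expect (fun A => 1 - c^-1 * F A).
  by rewrite expectB expect1 expectZ mulrC.
apply: ler_sum => A _; have := graph_weight_ge0 A; case As : (simple_adj A); last first.
  by rewrite /graph_weight As !mul0r.
move=> g0; rewrite ler_wpM2l//; case: (leP (F A) c) => Fc.
  have -> : `[< E A >] by apply/asboolP; exact: FE.
  by rewrite /= lerBlDr lerDl mulr_ge0 ?invr_ge0 ?F0// ltW.
apply: (@le_trans _ _ 0) => //; rewrite subr_le0 ler_pdivlMl// mulr1; exact: ltW.
Qed.

End GraphExpectation.

(** * Operator norm from the trace of a high power *)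

Section OperatorNorm.
Variables (R : realType) (N : nat).
Implicit Types (u v : 'rV[R]_N) (Q M : 'M[R]_N).

Lemma dot_CS u v : dot u v ^+ 2 <= dot u u * dot v v.
Proof.
apply: quad_disc => t; have := dot_ge0 (u + t *: v).
rewrite dotDl !dotDr !dotZl !dotZr (dotC v u).
by congr (_ <= _); ring.
Qed.

Lemma expmx_sym Q n : Q^T = Q -> (Q ^+ n)^T = Q ^+ n.
Proof.
move=> Qs; elim: n => [|n IH]; first by rewrite expr0 trmx1.
by rewrite {1}exprS [LHS]trmx_mul IH Qs exprSr.
Qed.

(** The operator norm is at most the Hilbert-Schmidt norm, whose square is this trace for symmetric
    [M]. *)
Lemma dot_mulmx_trace M v : M^T = M -> dot (v *m M) (v *m M) <= \tr (M *m M) * dot v v.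
Proof.
move=> Ms; rewrite /mxtrace mulr_suml; apply: ler_sum => j _.
have -> : (M *m M) j j = dot (col j M)^T (col j M)^T.
  rewrite mxE; apply: eq_bigr => i _; rewrite !mxE; congr (_ * _).
  by rewrite -{1}Ms mxE.
have -> : (v *m M) 0 j = dot v (col j M)^T by rewrite mxE; apply: eq_bigr => i _; rewrite !mxE.
by rewrite -expr2 mulrC dot_CS.
Qed.

Lemma trace_even_power_ge0 Q k : Q^T = Q -> 0 <= \tr (Q ^+ (2 * k)).
Proof.
move=> Qs; rewrite mul2n -addnn exprD; apply: sumr_ge0 => i _.
have -> : (Q ^+ k * Q ^+ k) i i = \sum_j (Q ^+ k) i j ^+ 2.
  rewrite [LHS]mxE; apply: eq_bigr => j _; rewrite expr2; congr (_ * _).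
  by rewrite -{1}(expmx_sym k Qs) mxE.
by apply: sumr_ge0 => j _; rewrite sqr_ge0.
Qed.

(* |v Q^j|^2 is log-convex in j, so a bound on a high power controls Q itself. *)
Lemma operator_norm_trace Q k t : Q^T = Q -> (0 < k)%N -> 0 <= t -> \tr (Q ^+ (2 * k)) <= t ^+ (2 * k) ->
  forall v, dot (v *m Q) (v *m Q) <= t ^+ 2 * dot v v.
Proof.
move=> Qs k0 t0 tr v; pose a j := dot (v *m Q ^+ j) (v *m Q ^+ j).
have a0 j : 0 <= a j by exact: dot_ge0.
have powS j : v *m Q ^+ j.+1 = v *m Q ^+ j *m Q by rewrite exprSr mulmxA.
have cs j : a j.+1 ^+ 2 <= a j * a j.+2.
  have -> : a j.+1 = dot (v *m Q ^+ j) (v *m Q ^+ j.+2).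
    by rewrite /a (powS j.+1) -(dot_mulmx _ _ Qs) -powS.
  exact: dot_CS.
have ratio j : a j * a 1%N <= a 0%N * a j.+1.
  elim: j => [//|j IH].
  have := a0 j.+1; rewrite le_eqVlt => /predU1P[<-|aj].
    by rewrite mul0r mulr_ge0.
  rewrite -(ler_pM2r aj).
  have -> : a j.+1 * a 1%N * a j.+1 = a j.+1 ^+ 2 * a 1%N by ring.
  apply: (@le_trans _ _ (a j * a j.+2 * a 1%N)); first by rewrite ler_wpM2r.
  have -> : a j * a j.+2 * a 1%N = a j.+2 * (a j * a 1%N) by ring.
  have -> : a 0%N * a j.+2 * a j.+1 = a j.+2 * (a 0%N * a j.+1) by ring.
  by rewrite ler_wpM2l.
have power j : a 1%N ^+ j.+1 <= a 0%N ^+ j * a j.+1.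
  elim: j => [|j IH]; first by rewrite expr1 expr0 mul1r.
  rewrite exprSr; apply: (@le_trans _ _ (a 0%N ^+ j * a j.+1 * a 1%N)); first by rewrite ler_wpM2r.
  by rewrite exprSr -!mulrA ler_wpM2l ?exprn_ge0.
have a0E : a 0%N = dot v v by rewrite /a expr0 mulmx1.
have a1E : a 1%N = dot (v *m Q) (v *m Q) by rewrite /a expr1.
rewrite -a0E -a1E; have [z|nz] := eqVneq (a 0%N) 0.
  have v0 : v = 0 by apply: dot_eq0; rewrite -a0E.
  by rewrite a1E z mulr0 v0 mul0mx /dot big1// => i _; rewrite mxE mul0r.
have ap : 0 < a 0%N by rewrite lt_neqAle eq_sym nz a0.
have ak : a k <= t ^+ (2 * k) * a 0%N.
  rewrite a0E; apply: (le_trans (dot_mulmx_trace v (expmx_sym k Qs))).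
  apply: ler_wpM2r; first exact: dot_ge0.
  by move: tr; rewrite mul2n -addnn exprD.
rewrite -(@ler_pXn2r _ k)// ?nnegrE ?mulr_ge0 ?exprn_ge0//.
rewrite -(prednK k0); apply: (le_trans (power _)); rewrite prednK//.
apply: (@le_trans _ _ (a 0%N ^+ k.-1 * (t ^+ (2 * k) * a 0%N))).
  by rewrite ler_wpM2l ?exprn_ge0.
rewrite exprMn -exprM -{4}(prednK k0) exprSr.
by rewrite le_eqVlt; apply/orP; left; apply/eqP; ring.
Qed.

End OperatorNorm.

(** * Proof of the theorem *)

Section Asymptotics.
Variable R : realType.
Implicit Types (x z sig gam : R).

Lemma expR_ge_power z m : (0 < m)%N -> 0 <= z -> (z / m%:R) ^+ m <= expR z.
Proof.
move=> m0 z0; have mR : 0 < m%:R :> R by rewrite ltr0n.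
have -> : expR z = expR (z / m%:R) ^+ m.
  by rewrite -expRM_natr divfK// gt_eqF.
rewrite lerXn2r ?nnegrE ?expR_ge0 ?divr_ge0//.
by apply: le_trans (expR_ge1Dx _); rewrite lerDr.
Qed.

(** [z] stands for [ln N]. Once [expR (sig * z / 2)] exceeds a polynomial in [z], the base is at
    most [expR (- (sig * z / 2))]; as [sig * z >= 4] and [k >= z ^ gam >= z], its [k]-th power
    absorbs [expR z] and still leaves the target. *)
Lemma tail_bound sig gam : 0 < sig -> 1 < gam -> exists z0, forall z, z0 <= z -> 1 <= z ->
  forall k : nat, k = (Num.truncn (z `^ gam)).+1 ->
  expR z * (16 * k%:R ^+ 2 / expR (sig * z)) ^+ k <= expR (- (z `^ gam)).
Proof.
(* [n] exceeds [gam], so [k ^+ 2] is at most [4 * z ^+ (2 * n)]; the one extra power of [z] in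
   degree [m] beats the constants. *)
move=> s0 g1; pose n := (Num.truncn gam).+1; pose m := (2 * n).+1.
have mR : 0 < m%:R :> R by rewrite ltr0n.
exists (Num.max (64 * (2 * m%:R / sig) ^+ m) (4 / sig)) => z.
rewrite ge_max => /andP[z1 z2] z3 k kE.
have z0 : 0 < z by lra.
set p := z `^ gam; have p0 : 0 <= p by exact: powR_ge0.
have zp : z <= p by rewrite /p -[leLHS](powRr1 (ltW z0)) ler_powR// ltW.
have p1 : 1 <= p by lra.
have kp : p <= k%:R by rewrite kE; apply/ltW/truncnS_gt.
have kp2 : k%:R <= 2 * p.
  have := truncn_le p; rewrite p0 => h; rewrite kE -natr1 -/p; lra.
have pn : p <= z ^+ n.
  rewrite /p -(powR_mulrn n (ltW z0)) ler_powR//; apply/ltW/truncnS_gt.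
have k2 : 16 * k%:R ^+ 2 <= 64 * z ^+ (2 * n).
  have h : k%:R ^+ 2 <= (2 * z ^+ n) ^+ 2 :> R.
    rewrite lerXn2r ?nnegrE//; first by rewrite mulr_ge0// exprn_ge0// ltW.
    by apply: (le_trans kp2); rewrite ler_wpM2l.
  rewrite exprMn -exprM [(n * 2)%N]mulnC in h.
  by lra.
have ex : 64 * z ^+ (2 * n) <= expR (sig * z / 2).
  have sz : 0 <= sig * z / 2 by rewrite divr_ge0// mulr_ge0 ?ltW.
  apply: le_trans (@expR_ge_power _ m isT sz).
  have -> : sig * z / 2 / m%:R = (2 * m%:R / sig)^-1 * z by field; rewrite !gt_eqF.
  rewrite exprMn exprVn ler_pdivlMl; last by rewrite exprn_gt0// divr_gt0// mulr_gt0.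
  rewrite [z ^+ m]exprS !mulrA ler_wpM2r//; first by rewrite exprn_ge0// ltW.
  by rewrite mulrC.
have base : 16 * k%:R ^+ 2 / expR (sig * z) <= expR (- (sig * z / 2)).
  rewrite ler_pdivrMr ?expR_gt0// -expRD.
  have -> : - (sig * z / 2) + sig * z = sig * z / 2 by field.
  exact: le_trans k2 ex.
apply: (@le_trans _ _ (expR z * expR (- (sig * z / 2)) ^+ k)).
  by rewrite ler_wpM2l ?expR_ge0// lerXn2r ?nnegrE ?expR_ge0//.
rewrite -expRM_natr -expRD ler_expR.
have s4 : 4 <= sig * z by rewrite mulrC -ler_pdivrMr.
have h : 2 * k%:R <= sig * z / 2 * k%:R by rewrite ler_wpM2r//; lra.
rewrite mulNr; lra.
Qed.

End Asymptotics.

(** * The random Laplacian minus its mean *)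

Section Deviation.
Variables (R : realType) (w : R -> R -> R) (tau : R) (N : nat).
Hypothesis w_sym : forall x y, I01 x -> I01 y -> w x y = w y x.
Implicit Types (A : 'M[bool]_N) (v : 'rV[R]_N).

Lemma edgeC (i j : 'I_N) : edge i j = edge j i.
Proof.
rewrite /edge; case: (ltngtP i j) => // ij.
by have -> : i = j by exact: val_inj.
Qed.

Lemma dev_mx_sym A : (dev_mx w tau A)^T = dev_mx w tau A.
Proof.
apply/matrixP => i j; rewrite !mxE edgeC (eq_sym j i).
by case: eqVneq => [->//|_]; rewrite !mul0r.
Qed.

Lemma edge_dev_entry A (i l : 'I_N) : simple_adj A -> l != i ->
  edge_dev w tau (edge i l) A = (A i l)%:R - edge_prob w tau i l.
Proof.
move=> /andP[/forallP As _] li; rewrite /edge_dev /edge.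
case: ifP => // _ /=; congr (_ - _).
  by have /forallP/(_ l)/eqP -> := As i.
by rewrite /edge_prob w_sym//; exact: vtx_I.
Qed.

Lemma laplacian_dev A v : (0 < N)%N -> simple_adj A ->
  v *m laplacian R A - (N%:R * rho tau N) *: sampled_laplacian w v = v *m dev_mx w tau A.
Proof.
move=> N0 As; have NR : N%:R != 0 :> R by rewrite pnatr_eq0 -lt0n.
have /andP[/forallP Asym _] := As.
apply/rowP => i; rewrite !mxE.
have -> : \sum_j v 0 j * dev_mx w tau A j i = \sum_(l | l != i) edge_dev w tau (edge i l) A * (v 0 i - v 0 l).
  have := dev_mx_mul w tau A v^T i 0; rewrite mxE => H.
  rewrite -[RHS](_ : \sum_(l | l != i) edge_dev w tau (edge i l) A * (v^T i 0 - v^T l 0) = _); last first.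
    by apply: eq_bigr => l _; rewrite !mxE.
  by rewrite -H; apply: eq_bigr => j _; rewrite [v^T _ _]mxE -{1}dev_mx_sym mxE mulrC.
have -> : \sum_j v 0 j * laplacian R A j i = \sum_l (A i l)%:R * (v 0 i - v 0 l).
  under eq_bigr do rewrite mxE mulrBr.
  rewrite sumrB (bigD1 i)//= eqxx mul1r [X in _ + X - _]big1 => [|j ji]; last by rewrite (negPf ji) mul0r mulr0.
  rewrite addr0 mulr_sumr -sumrB; apply: eq_bigr => l _; rewrite !mxE.
  by have /forallP/(_ l)/eqP -> := Asym i; ring.
rewrite [X in X - _](bigD1 i)//= subrr mulr0 add0r.
rewrite mulrA [N%:R * _]mulrC mulfK// [X in _ - _ * X](bigD1 i)//= subrr mulr0 add0r mulr_sumr -sumrB.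
by apply: eq_bigr => l li; rewrite edge_dev_entry// /edge_prob; ring.
Qed.

End Deviation.

Section MainTail.
Variable R : realType.
Implicit Types (w : R -> R -> R) (phi : R -> R).

Lemma powR_expR (N : nat) (a : R) : (0 < N)%N -> N%:R `^ a = expR (a * ln N%:R).
Proof. by move=> N0; rewrite /powR pnatr_eq0 gtn_eqF. Qed.

(** Lets all constants be taken from one fixed [phi0], so that they depend on [w] only: a normalized
    Fiedler function is [phi0] or its negative, almost everywhere. *)
Lemma fiedler_ground_unique w (K : R) (wK : lip_kernel w K) phi0 phi :
  robinsonian w -> A2 w -> A4 w -> ground w phi0 -> L2norm phi0 = 1 ->
  fiedler_function w phi -> L2norm phi = 1 -> L2 phi /\
  exists2 c : R, c ^+ 2 = 1 & ae_eq01 phi (fun x => c * phi0 x) /\ ground w (fun x => c * phi0 x).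
Proof.
move=> rob a2 a4 g0 n0 ff n1.
have [phiL [phi' [g' n' ae]]] := @fiedler_ground R w K wK rob a2 a4 phi ff n1.
have [c E] := @ground_simple R w K wK rob a2 a4 phi0 phi' g0 g' n0.
have L0 := ground_L2 g0.
split => //; exists c; last split.
- have : L2norm (fun x => c * phi0 x) = 1 by rewrite -n'; apply: L2norm_ext => x Ix; rewrite E.
  by rewrite L2normZ// n0 mulr1 => /(congr1 (fun z => z ^+ 2)); rewrite expr1n real_normK ?num_real.
- by rewrite /ae_eq01; apply: filterS ae => x /= H Ix; rewrite H// E.
have := @ground_lin R w K wK c 0 phi0 phi0 g0 g0.
by have -> : (fun x => c * phi0 x + 0 * phi0 x) = (fun x => c * phi0 x) by apply/funext => x; rewrite mul0r addr0.
Qed.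

Lemma fiedler_step_close w (K : R) (wK : lip_kernel w K) : robinsonian w -> A2 w -> A4 w ->
  exists mu g L : R, [/\ 0 < mu, 0 < g & 0 <= L] /\
  forall phi, fiedler_function w phi -> L2norm phi = 1 ->
  forall (N : nat) (A : 'M[bool]_N) (x theta : R), simple_adj A -> (0 < N)%N -> 0 < x -> 0 <= theta ->
  (forall v : 'rV[R]_N, dot (v *m laplacian R A - x *: sampled_laplacian w v)
      (v *m laplacian R A - x *: sampled_laplacian w v) <= (x * theta) ^+ 2 * dot v v) ->
  theta + 4 * K / N%:R < mu -> 4 * L <= N%:R ->
  good_event phi (2 / g * (2 * (theta + 4 * K / N%:R) + 4 * (2 + mu) * (2 * L / N%:R) ^+ 2)) A.
Proof.
move=> rob a2 a4.
have mu0 := @mu2_gt0 R w K wK rob a2 a4.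
have [phi0 [g0 n0]] := @ground_ex R w K wK a4.
have [g gpos gap] := @spectral_gap R w K wK rob a2 a4 phi0 g0 n0.
case: (g0) => -[[L l0] _] _; have L0 := ground_L2 g0.
exists (mu2 w), g, L; split; first by split => //; exact: lip_ge0 l0.
move=> phi ff n1 N A x theta As N0 x0 t0 cl d4 LN v fv nv pos.
have [phiL [c c2 [ae gc]]] := fiedler_ground_unique wK rob a2 a4 g0 n0 ff n1.
have c1 : `|c| = 1.
  by apply/eqP; rewrite -(@eqrXn2 _ 2)// real_normK ?num_real// c2 expr1n.
pose phi' x := c * phi0 x.
have phi'L : L2 phi' by exact: L2Z.
have n' : L2norm phi' = 1 by rewrite L2normZ// n0 c1 mulr1.
have l' : lip01 L phi' by have := lipZ c l0; rewrite c1 mul1r.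
have gap' f : L2 f -> J f = 0 -> inner f phi' = 0 -> g * inner f f <= qform w f f.
  move=> fL fJ; rewrite innerZr// => /eqP; rewrite mulf_eq0 => /orP[/eqP cz|/eqP]; last exact: gap.
  by move: c1; rewrite cz normr0 => /eqP; rewrite eq_sym oner_eq0.
have sL := stepfun_L2 v.
have pos' : 0 <= inner phi' (stepfun v) by rewrite -(inner_ae phiL phi'L sL ae).
have := @fiedler_close R w K wK mu0 phi' g L gc n' l' gpos gap' N A x theta As N0 x0 t0 cl d4 LN v fv nv pos'.
suff -> : L2norm (fun y => stepfun v y - phi y) = L2norm (fun y => stepfun v y - phi' y) by [].
rewrite /L2norm; congr Num.sqrt; apply: J_ae.
- by apply: measM; apply: measB; exact: L2_meas.
- by apply: measM; apply: measB; exact: L2_meas.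
- by rewrite /ae_eq01; apply: filterS ae => y /= H Iy; rewrite H.
Qed.

Lemma fiedler_step_tail w : is_graphon w -> robinsonian w -> A1 w -> A2 w -> A4 w ->
  exists C : R, 0 < C /\
    forall tau eta gamma : R, 0 <= tau < 1 -> 0 < eta < (1 - tau) / 3 -> 1 < gamma ->
    exists N0 : nat, forall phi : R -> R,
      fiedler_function w phi -> L2norm phi = 1 ->
      forall N : nat, (N0 <= N)%N ->
        1 - eps_gamma gamma N <= (@graph_prob R w tau N)
                     (good_event (N:=N) phi (C * N%:R `^ (- (3 * eta / 2)))).
Proof.
move=> [_ [wsym w01]] rob [K [Kpos wlip]] a2 a4.
have wK : lip_kernel w K by split.
have [mu [g [L [[mu0 gpos L0] H]]]] := fiedler_step_close wK rob a2 a4.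
(* This is [2 / g] times [3]: the perturbation bound contains [2 * theta], and the discretization
   terms together cost at most one more [theta]. *)
exists (6 / g); split; first by rewrite divr_gt0.
move=> tau eta gamma /andP[t0 t1] /andP[e0 e1] g1.
(* The exponent for which [x * theta ^+ 2] equals [N] to the power [sig]. *)
pose sig := 1 - tau - 3 * eta; have s0 : 0 < sig by rewrite /sig; lra.
have [z0 Hz] := tail_bound s0 g1.
pose M := 8 * K + 16 * (2 + mu) * L ^+ 2.
have M0 : 0 <= M by rewrite /M addr_ge0 ?mulr_ge0 ?sqr_ge0 ?(ltW Kpos)// addr_ge0// ltW.
(* Apart from the term [1], which gives [z >= 1], each summand enforces one of the lower bounds on
   [z = ln N] extracted below. *)
pose Z := `|z0| + 1 + 2 * M + 8 * K / mu + 4 * L + 4 / (3 * eta * mu).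
have Kmu : 0 <= 8 * K / mu by rewrite divr_ge0 ?(ltW mu0)// mulr_ge0// ltW.
have em0 : 0 < 3 * eta * mu by rewrite !mulr_gt0.
have emu : 0 <= 4 / (3 * eta * mu) by rewrite divr_ge0// ltW.
exists (Num.truncn (expR Z)).+1 => phi ff n1 N NN.
have N1 : (0 < N)%N by apply: leq_trans NN.
have NR : 0 < N%:R :> R by rewrite ltr0n.
pose z := ln (N%:R : R).
have NE : N%:R = expR z by rewrite /z lnK// posrE.
have zZ : Z <= z.
  rewrite -ler_expR -NE; apply/ltW/(lt_le_trans (truncnS_gt _)).
  by rewrite ler_nat.
have z1 : 1 <= z by have := normr_ge0 z0; move: zZ; rewrite /Z; lra.
have zz0 : z0 <= z by have := ler_norm z0; move: zZ; rewrite /Z; lra.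
have zM : 2 * M <= z by have := normr_ge0 z0; move: zZ; rewrite /Z; lra.
have zK : 8 * K / mu <= z by have := normr_ge0 z0; move: zZ; rewrite /Z; lra.
have zL : 4 * L <= z by have := normr_ge0 z0; move: zZ; rewrite /Z; lra.
have ze : 4 / (3 * eta * mu) <= z by have := normr_ge0 z0; move: zZ; rewrite /Z; lra.
have Nz : z <= N%:R by rewrite NE; apply: le_trans (expR_ge1Dx z); lra.
pose theta := N%:R `^ (- (3 * eta / 2)) : R.
have thE : theta = expR (- (3 * eta / 2) * z) by rewrite /theta powR_expR.
have th0 : 0 < theta by rewrite thE expR_gt0.
pose rh : R := rho tau N; have rhE : rh = expR (- tau * z) by rewrite /rh /rho powR_expR.
pose x := N%:R * rh; have xE : x = expR ((1 - tau) * z).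
  rewrite /x NE rhE -expRD; congr expR; ring.
have x0 : 0 < x by rewrite xE expR_gt0.
have x1 : 1 <= x.
  by rewrite xE -[leLHS]expR0 ler_expR mulr_ge0//; lra.
have rh1 : rh <= 1.
  by rewrite rhE -[leRHS]expR0 ler_expR mulNr oppr_le0 mulr_ge0//; lra.
have rh0 : 0 <= rh by rewrite rhE expR_ge0.
have p01 e : upper e -> 0 <= edge_prob w tau (N := N) e.1 e.2 <= 1.
  move=> _; rewrite /edge_prob -/rh; have /andP[a b] := w01 _ _ (vtx_I R e.1) (vtx_I R e.2).
  by rewrite mulr_ge0//= mulr_ile1.
have pr e : upper e -> edge_prob w tau (N := N) e.1 e.2 <= rh.
  move=> _; rewrite /edge_prob -/rh; have /andP[a b] := w01 _ _ (vtx_I R e.1) (vtx_I R e.2).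
  by rewrite ler_piMr.
(* The value for which [r = y ^+ 2 / N]; it is at least [1] because [tau < 1]. *)
pose y := Num.sqrt x.
have y2 : y ^+ 2 = x by rewrite sqr_sqrtr// ltW.
have y1 : 1 <= y by rewrite /y -[leLHS]sqrtr1 ler_sqrt// ltW.
have yr : rh = y ^+ 2 * N%:R^-1 by rewrite y2 /x mulrC mulKf// gt_eqF.
pose k := (Num.truncn (z `^ gamma)).+1.
pose t := x * theta; have tpos : 0 < t by rewrite mulr_gt0.
have bound : 6 / g * theta >=
    2 / g * (2 * (theta + 4 * K / N%:R) + 4 * (2 + mu) * (2 * L / N%:R) ^+ 2).
  have Nth : M <= N%:R * theta.
    have -> : N%:R * theta = expR ((1 - 3 * eta / 2) * z).
      rewrite NE thE -expRD; congr expR; ring.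
    apply: le_trans (expR_ge1Dx _).
    (* Here [3 * eta < 1], so [N * theta] grows at least like the square root of [N]. *)
    have : 1 / 2 * z <= (1 - 3 * eta / 2) * z by rewrite ler_wpM2r//; lra.
    lra.
  have Ninv : (N%:R^-1) ^+ 2 <= N%:R^-1 :> R.
    by rewrite expr2 ler_piMr ?invr_ge0 ?(ltW NR)// invf_le1// ler1n.
  have MN : M / N%:R <= theta by rewrite ler_pdivrMr// mulrC.
  have q0 : 0 <= 16 * (2 + mu) * L ^+ 2 by rewrite !mulr_ge0 ?sqr_ge0// addr_ge0// ltW.
  have := ler_wpM2l q0 Ninv.
  have -> : 4 * (2 + mu) * (2 * L / N%:R) ^+ 2 = 16 * (2 + mu) * L ^+ 2 * N%:R^-1 ^+ 2 by ring.
  have ME : M / N%:R = 8 * K / N%:R + 16 * (2 + mu) * L ^+ 2 * N%:R^-1 by rewrite /M; ring.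
  rewrite ME in MN => h.
  have -> : 6 / g * theta = 2 / g * (3 * theta) by ring.
  rewrite ler_wpM2l//; first by rewrite divr_ge0// ltW.
  have -> : 2 * (theta + 4 * K / N%:R) = 2 * theta + 8 * K / N%:R by ring.
  lra.
have thmu : theta + 4 * K / N%:R < mu.
  have h1 : 4 * K / N%:R <= mu / 2.
    rewrite ler_pdivrMr//; move: zK; rewrite ler_pdivrMr// => h.
    have := ler_wpM2r (ltW mu0) Nz; lra.
  have h2 : theta < mu / 2.
    rewrite thE mulNr expRN invf_plt ?posrE ?expR_gt0 ?divr_gt0//.
    have E : (mu / 2)^-1 = 3 * eta / 2 * (4 / (3 * eta * mu)).
      by field; rewrite !gt_eqF.
    apply: (@le_lt_trans _ _ (3 * eta / 2 * z)).
      by rewrite E ler_wpM2l// divr_ge0// mulr_ge0// ltW.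
    by apply: lt_le_trans (expR_ge1Dx _); rewrite ltrDr.
  lra.
pose F (A : 'M[bool]_N) : R := \tr (dev_mx w tau A ^+ (2 * k)).
have tk : 0 < t ^+ (2 * k) by rewrite exprn_gt0.
apply: le_trans (@graph_prob_markov R w tau N p01 F _ (t ^+ (2 * k)) tk _ _).
- rewrite lerD2l lerN2 ler_pdivrMr//.
  apply: (le_trans (@expect_trace R w tau N rh y p01 pr y1 yr (2 * k))).
  have := Hz z zz0 z1 k erefl; rewrite /eps_gamma -/z => h.
  rewrite -ler_pdivrMr//; apply: le_trans h.
  rewrite -NE -[leLHS]mulrA ler_wpM2l// -expr_div_n exprM.
  (* The trace bound at [L = 2 * k] and the threshold [t = x * theta] leave the base
     [(4 y k)^2 / (x theta)^2], which is [16 k^2 / (x theta^2)]. *)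
  rewrite le_eqVlt; apply/orP; left; apply/eqP; congr (_ ^+ k).
  have -> : expR (sig * z) = x * theta ^+ 2.
    by rewrite xE thE -expRM_natr -expRD /sig; congr expR; field.
  rewrite /t natrM -y2; field.
  by rewrite !gt_eqF// (lt_le_trans ltr01 y1).
- move=> A As; apply: trace_even_power_ge0; exact: dev_mx_sym.
move=> A As FA v fv nv pos; apply: le_trans bound.
apply: (H phi ff n1 N A x theta As N1 x0 (ltW th0)) => //; last first.
  by apply: le_trans Nz.
move=> u; rewrite laplacian_dev//.
exact: (operator_norm_trace (dev_mx_sym _ _ _) _ (ltW tpos) FA).
Qed.

End MainTail.

Theorem mainTheorem9 (R : realType) (w : R -> R -> R) :
  is_graphon w -> robinsonian w -> A1 w -> A2 w -> A3 w -> A4 w ->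
  (exists C : R, 0 < C /\
    forall tau eta eps : R, 0 <= tau < 1 -> 0 < eta < (1 - tau) / 3 -> 0 < eps < 1 ->
    exists N0 : nat, forall phi : R -> R,
      fiedler_function w phi -> L2norm phi = 1 ->
      forall N : nat, (N0 <= N)%N ->
        1 - eps <= (@graph_prob R w tau N)
                     (good_event (N:=N) phi (C * N%:R `^ (- (3 * eta / 2))))) /\
  (exists C' : R, 0 < C' /\
    forall tau eta gamma : R, 0 <= tau < 1 -> 0 < eta < (1 - tau) / 3 -> 1 < gamma ->
    exists N0' : nat, forall phi : R -> R,
      fiedler_function w phi -> L2norm phi = 1 ->
      forall N : nat, (N0' <= N)%N ->
        1 - eps_gamma gamma N <= (@graph_prob R w tau N)
                     (good_event (N:=N) phi (C' * N%:R `^ (- (3 * eta / 2))))).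
Proof.
move=> wg rob a1 a2 _ a4.
have tail := fiedler_step_tail wg rob a1 a2 a4; split => //.
have [C [C0 H]] := tail; exists C; split => // tau eta eps ht he /andP[eps0 eps1].
(* The choice [gamma = 2] suffices: [(ln N)^2 >= ln N >= - ln eps] for large [N]. *)
have [N0 HN] := H tau eta 2 ht he (ltr1n _ 2).
exists (maxn N0 (Num.truncn (expR (1 - ln eps))).+1) => phi ff n1 N.
rewrite geq_max => /andP[N0N NN]; apply: le_trans (HN phi ff n1 N N0N).
rewrite lerD2l lerN2 /eps_gamma -[leRHS](@lnK R eps) ?posrE// ler_expR.
have NR : 0 < N%:R :> R by rewrite ltr0n (leq_trans _ NN).
have le0 : ln eps <= 0 by rewrite -ln1 ler_ln ?posrE// ltW.
have zb : 1 - ln eps <= ln (N%:R : R).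
  rewrite -ler_expR lnK ?posrE//; apply/ltW/(lt_le_trans (truncnS_gt _)).
  by rewrite ler_nat.
have z1 : 1 <= ln (N%:R : R) by lra.
have : ln (N%:R : R) <= ln N%:R `^ 2.
  by rewrite -[leLHS]powRr1 ?ler_powR ?ler1n//; lra.
lra.
Qed.
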